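(* Let $\mathbf{T}$ be a pile of quadrangulations of a polygon such that $\varkappa=\varkappa(\mathbf{T})$ is not comfortable. Then there exists a coherent solution $\mathbf{x}$ of the Kashaev equation indexed by $\varkappa^0$ which cannot be extended to an array indexed by $\varkappa^{02}$ satisfying the K-hexahedron equations.
   Context: A quadrangulation of a polygon $R\subset\mathbb{R}^2$ is a face-to-face tiling by quadrilaterals. A flip replaces three quadrilaterals forming a hexagon with common degree-$3$ interior vertex $w$ by the other subdivision of the hexagon into three quadrilaterals (new interior vertex $v$). A pile is a sequence $(T_0,\dots,T_\ell)$ with consecutive quadrangulations related by a flip. $\varkappa(\mathbf{T})$: start with $T_0$; for each flip add the new vertex $v$ and a $3$-cube with vertices $w,v$ and the six hexagon vertices, whose $2$-faces are the three old and three new quadrilaterals, with bottom vertex $w$ and top vertex $v$. $\varkappa^0,\varkappa^2,\varkappa^3$: vertices, $2$-faces, $3$-cubes; $\varkappa^{02}=\varkappa^0\cup\varkappa^2$. A vertex is interior if it has a neighbourhood homeomorphic to an open ball in $\mathbb{R}^3$. Comfortable: with $\sim$ the equivalence relation on $\varkappa^2$ generated by opposite faces of $3$-cubes, $\varkappa_\boxdot$ its classes, and $\psi_\varkappa:\{-1,1\}^{\varkappa_\boxdot}\to\{-1,1\}^{\varkappa^3}$, $\psi_\varkappa(\mathbf{t})_C=t_{[a]}t_{[b]}t_{[c]}$ ($a,b,c$ representing the three pairs of opposite faces of $C$), a $\mathbf{u}\in\{-1,1\}^{\varkappa^3}$ lies in $\operatorname{im}\psi_\varkappa$ iff $\prod_{C\ni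 v}u_C=1$ for all interior vertices $v$. For a $3$-cube $C$ with vertex values $z_{ijk}$ (cube isomorphism $C\cong\{0,1\}^3$): $K^C=2(a^2+b^2+c^2+d^2)-(a+b+c+d)^2-4(s+t)$ with $a=z_{000}z_{111}$, $b=z_{100}z_{011}$, $c=z_{010}z_{101}$, $d=z_{001}z_{110}$, $s=z_{000}z_{011}z_{101}z_{110}$, $t=z_{111}z_{100}z_{010}z_{001}$; for a vertex $v$ labeled $000$, $K^C_v=\frac12(z_{111}z_{000}^2-z_{000}(z_{100}z_{011}+z_{010}z_{101}+z_{001}z_{110}))-z_{100}z_{010}z_{001}$. A coherent solution of the Kashaev equation: $K^C(\mathbf{x})=0$ for all $3$-cubes, and for every interior vertex $v$, $\prod_{C\ni v}K^C_v(\mathbf{x})=\prod_{S\ni v}(x_vx_{v_2}+x_{v_1}x_{v_3})$ (over $3$-cubes and $2$-faces containing $v$; $v,v_1,v_2,v_3$ in cyclic order on $S$). K-hexahedron equations for an array $\tilde{\mathbf{x}}$ on $\varkappa^{02}$ with nonzero vertex values: $x_s^2=x_{v_1}x_{v_3}+x_{v_2}x_{v_4}$ for each $2$-face $s$ (vertices in cyclic order), and for each $3$-cube, identified with $[0,1]^3$ with bottom $000$ and top $111$, with $z_{ijk}$ vertex values and $z_p$ the value at the face centered at $p$: $z_{1\frac12\frac12}=(z_{\frac120\frac12}z_{\frac12\frac120}+z_{0\frac12\frac12}z_{100})/z_{000}$, $z_{\frac121\frac12}=(z_{0\frac12\frac12}z_{\frac12\frac120}+z_{\frac120\frac12}z_{010})/z_{000}$,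 $z_{\frac12\frac121}=(z_{0\frac12\frac12}z_{\frac120\frac12}+z_{\frac12\frac120}z_{001})/z_{000}$, $z_{111}=(A+2z_{0\frac12\frac12}z_{\frac120\frac12}z_{\frac12\frac120})/z_{000}^2$, $A=2z_{100}z_{010}z_{001}+z_{000}(z_{100}z_{011}+z_{010}z_{101}+z_{001}z_{110})$. *)

(* Defs.v *)
From HB Require Import structures.
From mathcomp Require Import all_boot all_order all_algebra.
From mathcomp Require Import all_classical all_reals all_analysis.
From mathcomp Require Import complex.
Set Implicit Arguments. Unset Strict Implicit. Unset Printing Implicit Defensive.
Import Order.TTheory GRing.Theory Num.Theory numFieldNormedType.Exports.
Local Open Scope classical_set_scope.
Local Open Scope ring_scope.

Section Geometry.
Variable R : realType.
Notation pt := (R * R)%type.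

Definition det3 (p q r : pt) : R :=
  (q.1 - p.1) * (r.2 - p.2) - (q.2 - p.2) * (r.1 - p.1).

Definition collinear (p q r : pt) : bool := det3 p q r == 0.

Definition opp_sides (p q a b : pt) : bool := det3 p q a * det3 p q b < 0.

Definition triangle (p q r : pt) : set pt :=
  [set z | exists a b c : R, [/\ 0 <= a, 0 <= b, 0 <= c, a + b + c = 1 &
     z = (a * p.1 + b * q.1 + c * r.1, a * p.2 + b * q.2 + c * r.2)]].

Definition segment (p q : pt) : set pt :=
  [set z | exists t : R, [/\ 0 <= t, t <= 1 &
     z = ((1 - t) * p.1 + t * q.1, (1 - t) * p.2 + t * q.2)]].

(* p1 p2 p3 p4 (in cyclic order) are the corners of a (possibly non-convex)
   simple, non-degenerate quadrilateral: no three corners are collinear and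
   one of the two diagonals lies inside (separates the two other corners). *)
Definition is_quadrilateral (p1 p2 p3 p4 : pt) : bool :=
  [&& ~~ collinear p1 p2 p3, ~~ collinear p2 p3 p4, ~~ collinear p3 p4 p1,
      ~~ collinear p4 p1 p2 &
      opp_sides p1 p3 p2 p4 || opp_sides p2 p4 p1 p3].

(* the closed region bounded by the quadrilateral p1 p2 p3 p4: the union of
   the two triangles cut out by an interior diagonal *)
Definition quad_region (p1 p2 p3 p4 : pt) : set pt :=
  if opp_sides p1 p3 p2 p4 then triangle p1 p2 p3 `|` triangle p1 p3 p4
  else triangle p2 p3 p4 `|` triangle p2 p4 p1.

Definition pedge (qs : seq pt) (i : nat) : set pt :=
  segment (nth (0, 0) qs i) (nth (0, 0) qs ((i + 1) %% size qs)%N).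

Definition simple_closed_polygon (qs : seq pt) : Prop :=
  (3 <= size qs)%N /\
  forall i j : nat, (i < size qs)%N -> (j < size qs)%N ->
    (j = ((i + 1) %% size qs)%N -> pedge qs i `&` pedge qs j = [set nth (0, 0) qs j])
    /\ (i <> j -> j <> ((i + 1) %% size qs)%N -> i <> ((j + 1) %% size qs)%N ->
         pedge qs i `&` pedge qs j = set0).

(* Rg is a (closed) polygon: the closed region bounded by a simple closed
   polygonal curve, i.e. a bounded set with nonempty interior, equal to the
   closure of its interior, whose boundary is the curve. *)
Definition is_polygon (Rg : set pt) : Prop :=
  exists qs : seq pt, simple_closed_polygon qs /\
    Rg = closure (interior Rg) /\
    interior Rg !=set0 /\
    (exists M : R, forall z, Rg z -> `|z.1| <= M /\ `|z.2| <= M) /\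
    closure Rg `\` interior Rg =
      [set z | exists2 i, (i < size qs)%N & pedge qs i z].
End Geometry.

(* a quadrilateral given by its four vertex labels in cyclic order *)
Definition quad := (nat * nat * nat * nat)%type.

Definition qv (q : quad) (k : nat) : nat :=
  let '(a, b, c, d) := q in nth a [:: a; b; c; d] (k %% 4)%N.

Definition qverts (q : quad) : seq nat := [:: qv q 0; qv q 1; qv q 2; qv q 3].

Definition same_face (q q' : quad) : bool :=
  [exists k : 'I_4,
     [forall j : 'I_4, qv q' j == qv q (k + j)%N] ||
     [forall j : 'I_4, qv q' j == qv q (k + 4 - j)%N]].

Definition mem_face (q : quad) (T : seq quad) : bool := has (same_face q) T.

Definition verts (T : seq quad) : seq nat := flatten (map qverts T).

Section Quadrangulation.
Variable R : realType.
Notation pt := (R * R)%type.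
Variable pos : nat -> pt.

Definition tile_region (q : quad) : set pt :=
  quad_region (pos (qv q 0)) (pos (qv q 1)) (pos (qv q 2)) (pos (qv q 3)).

Definition quadrangulation (Rg : set pt) (T : seq quad) : Prop :=
  {in verts T &, injective pos} /\
  (forall q, q \in T ->
     is_quadrilateral (pos (qv q 0)) (pos (qv q 1)) (pos (qv q 2)) (pos (qv q 3))) /\
  [set z | exists2 q, q \in T & tile_region q z] = Rg /\
  forall i j : nat, (i < size T)%N -> (j < size T)%N -> i <> j ->
    let qi := nth (0, 0, 0, 0)%N T i in
    let qj := nth (0, 0, 0, 0)%N T j in
    interior (tile_region qi) `&` interior (tile_region qj) = set0 /\
    (tile_region qi `&` tile_region qj = set0 \/
     (exists u, [/\ u \in qverts qi, u \in qverts qj &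
        tile_region qi `&` tile_region qj = [set pos u]]) \/
     (exists k l : nat, [/\ (k < 4)%N, (l < 4)%N,
        (qv qi k == qv qj l) && (qv qi k.+1 == qv qj l.+1) ||
        (qv qi k == qv qj l.+1) && (qv qi k.+1 == qv qj l) &
        tile_region qi `&` tile_region qj = segment (pos (qv qi k)) (pos (qv qi k.+1))])).
End Quadrangulation.

(* A flip: the hexagon a1 ... a6 (cyclic order) is subdivided by the three
   quadrilaterals (w a1 a2 a3), (w a3 a4 a5), (w a5 a6 a1) around the old
   degree-3 vertex w, and these are replaced by (v a2 a3 a4), (v a4 a5 a6),
   (v a6 a1 a2) around the new vertex v. *)
Record flip := Flip { fw : nat; fv : nat;
  fa1 : nat; fa2 : nat; fa3 : nat; fa4 : nat; fa5 : nat; fa6 : nat }.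

Definition flip0 := Flip 0 0 0 0 0 0 0 0.

Definition old_x (f : flip) : quad := (fw f, fa3 f, fa4 f, fa5 f).
Definition old_y (f : flip) : quad := (fw f, fa5 f, fa6 f, fa1 f).
Definition old_z (f : flip) : quad := (fw f, fa1 f, fa2 f, fa3 f).
Definition new_x (f : flip) : quad := (fv f, fa6 f, fa1 f, fa2 f).
Definition new_y (f : flip) : quad := (fv f, fa2 f, fa3 f, fa4 f).
Definition new_z (f : flip) : quad := (fv f, fa4 f, fa5 f, fa6 f).

Definition old_quads f := [:: old_x f; old_y f; old_z f].
Definition new_quads f := [:: new_x f; new_y f; new_z f].

(* T' is obtained from T by the flip f (combinatorially); w has degree 3 *)
Definition is_flip (T T' : seq quad) (f : flip) : Prop :=
  uniq [:: fw f; fv f; fa1 f; fa2 f; fa3 f; fa4 f; fa5 f; fa6 f] /\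
  all (mem_face ^~ T) (old_quads f) /\
  (forall q, q \in T -> fw f \in qverts q -> has (same_face q) (old_quads f)) /\
  (forall q, mem_face q T' =
     (mem_face q T && ~~ has (same_face q) (old_quads f)) || has (same_face q) (new_quads f)).

Definition is_pile (R : realType) (pos : nat -> R * R) (Rg : set (R * R))
    (Ts : seq (seq quad)) (fl : seq flip) : Prop :=
  size Ts = (size fl).+1 /\ is_polygon Rg /\
  (forall i, (i < size Ts)%N -> quadrangulation pos Rg (nth [::] Ts i)) /\
  forall i, (i < size fl)%N ->
    let f := nth flip0 fl i in
    [/\ is_flip (nth [::] Ts i) (nth [::] Ts i.+1) f,
        interior Rg (pos (fw f)) &
        forall j, (j <= i)%N -> fv f \notin verts (nth [::] Ts j)].

(* The cube complex kappa(T), determined by T_0 and the flips         *)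
Section Kappa.
Variables (T0 : seq quad) (fl : seq flip).

Definition kverts : seq nat := verts T0 ++ map fv fl.
Definition kfaces : seq quad := T0 ++ flatten (map new_quads fl).

(* the cube of a flip, identified with {0,1}^3: bottom 000 = w, top 111 = v,
   its 2-faces being the three old and the three new quadrilaterals
   (faces x=0 / x=1 are old_x / new_x, etc.) *)
Definition cv (f : flip) (i j k : bool) : nat :=
  match i, j, k with
  | false, false, false => fw f
  | true,  false, false => fa1 f
  | false, true,  false => fa3 f
  | false, false, true  => fa5 f
  | true,  true,  false => fa2 f
  | false, true,  true  => fa4 f
  | true,  false, true  => fa6 f
  | true,  true,  true  => fv f
  end.

Definition in_cube (f : flip) (v : nat) : bool :=
  [exists e : bool * bool * bool, cv f e.1.1 e.1.2 e.2 == v].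

(* geometric realization of kappa: vertex u is the basis vector delta u of
   R^N, and each 2-face / 3-cube is the image of [0,1]^2 / [0,1]^3 under the
   multilinear map interpolating its vertices *)
Definition kN : nat := (\max_(u <- kverts) u).+1.

Variable R : realType.

Definition kdelta (u : nat) : 'rV[R]_kN := \row_j ((j : nat) == u)%:R.

Definition face_pt (q : quad) (s t : R) : 'rV[R]_kN :=
  ((1 - s) * (1 - t)) *: kdelta (qv q 0) + (s * (1 - t)) *: kdelta (qv q 1)
  + (s * t) *: kdelta (qv q 2) + ((1 - s) * t) *: kdelta (qv q 3).

Definition cube_pt (f : flip) (t1 t2 t3 : R) : 'rV[R]_kN :=
  \sum_(e : bool * bool * bool)
    ((if e.1.1 then t1 else 1 - t1) * (if e.1.2 then t2 else 1 - t2)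
       * (if e.2 then t3 else 1 - t3)) *: kdelta (cv f e.1.1 e.1.2 e.2).

Definition unit_interval (t : R) : Prop := 0 <= t <= 1.

Definition realization : set 'rV[R]_kN :=
  [set p | (exists2 u, u \in kverts & p = kdelta u) \/
           (exists q s t, [/\ q \in kfaces, unit_interval s, unit_interval t &
                              p = face_pt q s t]) \/
           (exists i t1 t2 t3, [/\ (i < size fl)%N, unit_interval t1,
              unit_interval t2, unit_interval t3 &
              p = cube_pt (nth flip0 fl i) t1 t2 t3])].

Definition open_ball3 : set 'rV[R]_3 := [set y | \sum_(i < 3) y ord0 i ^+ 2 < 1].

Definition interior_vertex (v : nat) : Prop :=
  v \in kverts /\
  exists O : set 'rV[R]_kN, [/\ open O, O (kdelta v) &
    let U := O `&` realization in
    exists (g : 'rV[R]_kN -> 'rV[R]_3) (h : 'rV[R]_3 -> 'rV[R]_kN),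
      [/\ forall p, U p -> open_ball3 (g p),
          forall y, open_ball3 y -> U (h y),
          forall p, U p -> h (g p) = p,
          forall y, open_ball3 y -> g (h y) = y &
          {within U, continuous g} /\ {within open_ball3, continuous h}]].

(* comfortable: u in {-1,1}^{kappa^3} is in the image of psi iff the product
   of u around every interior vertex is 1. A sign vector on the classes
   kappa_boxdot is encoded as a {-1,1}-valued function on faces (quadrilaterals
   up to rotation/reversal) taking equal values on opposite faces of cubes. *)
Definition is_sign (s : int) : bool := (s == 1) || (s == -1).

Definition class_sign (t : quad -> int) : Prop :=
  (forall q, is_sign (t q)) /\
  (forall q q', same_face q q' -> t q = t q') /\
  (forall i, (i < size fl)%N -> let f := nth flip0 fl i in
     [/\ t (old_x f) = t (new_x f), t (old_y f) = t (new_y f) &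
         t (old_z f) = t (new_z f)]).

Definition psi (t : quad -> int) (f : flip) : int :=
  t (old_x f) * t (old_y f) * t (old_z f).

Definition comfortable : Prop :=
  forall u : nat -> int, (forall i, (i < size fl)%N -> is_sign (u i)) ->
    ((exists t, class_sign t /\ forall i, (i < size fl)%N -> u i = psi t (nth flip0 fl i))
     <-> (forall v, interior_vertex v ->
            \prod_(i < size fl | in_cube (nth flip0 fl i) v) u i = 1)).

Notation C := R[i].

Definition KC (z : bool -> bool -> bool -> C) : C :=
  let a := z false false false * z true true true in
  let b := z true false false * z false true true in
  let c := z false true false * z true false true in
  let d := z false false true * z true true false in
  let s := z false false false * z false true true * z true false true * z true true false in
  let t := z true true true * z true false false * z false true false * z false false true in
  2 * (a ^+ 2 + b ^+ 2 + c ^+ 2 + d ^+ 2) - (a + b + c + d) ^+ 2 - 4 * (s + t).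

(* K^C_v where v is the vertex with label e = (e1,e2,e3); relabel the cube by
   the symmetry x |-> x xor e, which sends v to 000 *)
Definition KCv (z : bool -> bool -> bool -> C) (e1 e2 e3 : bool) : C :=
  let z' i j k := z (i (+) e1) (j (+) e2) (k (+) e3) in
  2^-1 * (z' true true true * z' false false false ^+ 2
          - z' false false false * (z' true false false * z' false true true
                                    + z' false true false * z' true false true
                                    + z' false false true * z' true true false))
  - z' true false false * z' false true false * z' false false true.

Definition xcube (x : nat -> C) (f : flip) : bool -> bool -> bool -> C :=
  fun i j k => x (cv f i j k).

Definition coherent_solution (x : nat -> C) : Prop :=
  (forall i, (i < size fl)%N -> KC (xcube x (nth flip0 fl i)) = 0) /\
  forall v, interior_vertex v ->
    \prod_(f <- fl) \prod_(e : bool * bool * bool | cv f e.1.1 e.1.2 e.2 == v)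
        KCv (xcube x f) e.1.1 e.1.2 e.2
    = \prod_(q <- kfaces) \prod_(k < 4 | qv q k == v)
        (x v * x (qv q (k + 2)%N) + x (qv q (k + 1)%N) * x (qv q (k + 3)%N)).

Definition K_hexahedron (x : nat -> C) (y : quad -> C) : Prop :=
  (forall u, u \in kverts -> x u != 0) /\
  (forall q, q \in kfaces ->
     y q ^+ 2 = x (qv q 0) * x (qv q 2) + x (qv q 1) * x (qv q 3)) /\
  forall i, (i < size fl)%N ->
    let f := nth flip0 fl i in
    let z := xcube x f in
    let z000 := z false false false in
    (* face centres: (0,1/2,1/2) = old_x, (1/2,0,1/2) = old_y, (1/2,1/2,0) = old_z,
       (1,1/2,1/2) = new_x, (1/2,1,1/2) = new_y, (1/2,1/2,1) = new_z *)
    let A := 2 * z true false false * z false true false * z false false true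
             + z000 * (z true false false * z false true true
                       + z false true false * z true false true
                       + z false false true * z true true false) in
    [/\ y (new_x f) = (y (old_y f) * y (old_z f) + y (old_x f) * z true false false) / z000,
        y (new_y f) = (y (old_x f) * y (old_z f) + y (old_y f) * z false true false) / z000,
        y (new_z f) = (y (old_x f) * y (old_y f) + y (old_z f) * z false false true) / z000 &
        z true true true = (A + 2 * y (old_x f) * y (old_y f) * y (old_z f)) / z000 ^+ 2].

(* x extends to an array on kappa^{02} (values on 2-faces, a 2-face being a
   quadrilateral up to rotation/reversal) satisfying the K-hexahedron eqs *)
Definition K_hex_extendable (x : nat -> C) : Prop :=
  exists y : quad -> C, (forall q q', same_face q q' -> y q = y q') /\ K_hexahedron x y.

End Kappa.

(* Main.v *)
(* A sign vector u on the cubes twists the K-hexahedron equations: replacing the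
   product XYZ of the three bottom face values of a cube C by u_C XYZ still gives
   K^C = 0, and then K^C_v = +-u_C times the product of the values of the three
   faces of C at v, with sign + exactly when v is the bottom or the top of C. At
   a vertex v created and later destroyed by flips every face lies in exactly two
   cubes. Hence the number of cubes at v, and so the number of minus signs, is even,
   and the product of the K^C_v over C is the product of the squared face values
   times the product of the u_C. For generic initial data no vertex or face
   value vanishes, and an untwisted extension of the vertex values differs from
   the twisted one by signs t with psi(t) = u. A vector u that satisfies the
   conditions at the interior vertices but is not in the image of psi thus gives
   the solution; the converse conditions hold for every psi(t).

   This needs that a vertex v of the first or of the last quadrangulation is not
   interior. It lies on a face q contained in at most one cube, and near a generic
   point of q the realization is a half-space or a plane. Both are ruled out by
   Sperner's lemma in the cube: a boundary point of a half-space can be pushed off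
   itself, and the plane has fine brick tilings with at most three bricks at a
   point. *)

Require Import Defs.
From mathcomp Require Import all_boot all_order all_algebra.
From mathcomp Require Import all_classical all_reals all_analysis.
From mathcomp Require Import complex.
From mathcomp Require Import ring lra zify.
Set Implicit Arguments. Unset Strict Implicit. Unset Printing Implicit Defensive.
Import Order.TTheory GRing.Theory Num.Theory numFieldNormedType.Exports.
Local Open Scope classical_set_scope.
Local Open Scope ring_scope.

(** * Faces and flips *)

(** As a quadratic equation for the top value of a cube, the Kashaev equation has the two roots
    $(A\pm 2XYZ)/z_{000}^2$; the signs [u] record which root is taken, relative to chosen square
    roots at the faces. Complex values make these square roots available.

    Genericity is the algebraic obstacle, since later vertex values involve nested square roots of
    the initial ones. It is handled backwards: a nonzero polynomial condition on the vertices of one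
    quadrangulation is pulled back through the flip to a nonzero polynomial condition on those of
    the previous one, by multiplying over both roots.

    The number of cubes at an interior vertex is even because each of them has three faces there and
    each of these faces is counted twice. The number of cubes with this vertex at the bottom or at
    the top is even because a vertex that is absent at both ends of the pile enters and leaves
    equally often.

    Interior vertices are defined topologically while these counts are combinatorial. Bridging the
    two amounts to two cases of invariance of domain for complexes glued from squares and cubes. *)

Definition face_orbit (T : Type) (q : T * T * T * T) : seq (T * T * T * T) :=
  let: (a, b, c, d) := q in
  [:: (a, b, c, d); (b, c, d, a); (c, d, a, b); (d, a, b, c);
      (a, d, c, b); (b, a, d, c); (c, b, a, d); (d, c, b, a)].

Lemma same_face_intro (q q' : quad) (k : nat) : (k < 4)%N ->
  (forall j : nat, (j < 4)%N -> qv q' j == qv q (k + j)) \/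
  (forall j : nat, (j < 4)%N -> qv q' j == qv q (k + 4 - j)) -> same_face q q'.
Proof.
move=> k4 H; apply/existsP; exists (Ordinal k4) => /=.
by case: H => H; apply/orP; [left|right]; apply/forallP => j; apply: H.
Qed.

(** An explicit list of the eight dihedral relabelings turns every question about [same_face] into
    eight cases. The list is polymorphic because it is used for quadruples of cube corners as
    well. *)
Lemma same_faceE q q' : same_face q q' = (q' \in face_orbit q).
Proof.
move: q q' => [[[a b] c] d] [[[a' b'] c'] d']; apply/idP/idP.
  move=> /existsP[k /orP[] /forallP H];
  have := (H (inord 0), H (inord 1), H (inord 2), H (inord 3));
  move: H => _; rewrite /qv !inordK //; case: k => [[|[|[|[|]]]]] //= _;
  by move=> [[[/eqP-> /eqP->] /eqP->] /eqP->]; rewrite !inE eqxx ?orbT.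
rewrite !inE.
move=> /orP[|/orP[|/orP[|/orP[|/orP[|/orP[|/orP[|]]]]]]] /eqP[-> -> -> ->].
- by apply: (@same_face_intro _ _ 0%N) => //; left => -[|[|[|[|]]]].
- by apply: (@same_face_intro _ _ 1%N) => //; left => -[|[|[|[|]]]].
- by apply: (@same_face_intro _ _ 2%N) => //; left => -[|[|[|[|]]]].
- by apply: (@same_face_intro _ _ 3%N) => //; left => -[|[|[|[|]]]].
- by apply: (@same_face_intro _ _ 0%N) => //; right => -[|[|[|[|]]]].
- by apply: (@same_face_intro _ _ 1%N) => //; right => -[|[|[|[|]]]].
- by apply: (@same_face_intro _ _ 2%N) => //; right => -[|[|[|[|]]]].
- by apply: (@same_face_intro _ _ 3%N) => //; right => -[|[|[|[|]]]].
Qed.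

Lemma same_face_refl q : same_face q q.
Proof. by rewrite same_faceE; case: q => [[[a b] c] d]; rewrite inE eqxx. Qed.

Lemma same_face_trans : transitive same_face.
Proof.
move=> q2 q1 q3; rewrite !same_faceE; case: q1 => [[[a b] c] d]; rewrite !inE.
move=> /orP[|/orP[|/orP[|/orP[|/orP[|/orP[|/orP[|]]]]]]] /eqP->;
rewrite !inE => /orP[|/orP[|/orP[|/orP[|/orP[|/orP[|/orP[|]]]]]]] /eqP->;
by rewrite eqxx ?orbT.
Qed.

Lemma same_face_sym : symmetric same_face.
Proof.
suff S q q' : same_face q q' -> same_face q' q by move=> q q'; apply/idP/idP; apply: S.
rewrite !same_faceE; case: q => [[[a b] c] d]; rewrite !inE.
move=> /orP[|/orP[|/orP[|/orP[|/orP[|/orP[|/orP[|]]]]]]] /eqP->;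
by rewrite !inE eqxx ?orbT.
Qed.

Lemma same_face_verts q q' : same_face q q' -> qverts q =i qverts q'.
Proof.
rewrite same_faceE; case: q => [[[a b] c] d]; rewrite !inE /qverts /qv /=.
move=> /orP[|/orP[|/orP[|/orP[|/orP[|/orP[|/orP[|]]]]]]] /eqP-> x;
rewrite !inE /=; by do 4 case: (x == _).
Qed.

Lemma same_face_uniq q q' : same_face q q' -> uniq (qverts q) -> uniq (qverts q').
Proof.
rewrite same_faceE; case: q => [[[a b] c] d]; rewrite !inE /qverts /qv /=.
move=> /orP[|/orP[|/orP[|/orP[|/orP[|/orP[|/orP[|]]]]]]] /eqP-> /=;
rewrite !inE !negb_or !andbT -!andbA => /and5P[ab ac ad bc /andP[bd cd]];
by rewrite ?ab ?ac ?ad ?bc ?bd ?cd ?(eq_sym b a) ?(eq_sym c a) ?(eq_sym d a)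
  ?(eq_sym c b) ?(eq_sym d b) ?(eq_sym d c) ?ab ?ac ?ad ?bc ?bd ?cd.
Qed.

Lemma mem_face_same q q' T : same_face q q' -> mem_face q T = mem_face q' T.
Proof.
move=> s; rewrite /mem_face; apply: eq_has => x; apply/idP/idP => H.
  by apply: same_face_trans H; rewrite same_face_sym.
exact: same_face_trans H.
Qed.

Lemma mem_vertsP v T : reflect (exists2 q, q \in T & v \in qverts q) (v \in verts T).
Proof. exact: flatten_mapP. Qed.

Lemma mem_verts_face v T : v \in verts T <-> exists2 q, mem_face q T & v \in qverts q.
Proof.
split=> [/mem_vertsP[q qT vq]|[q /hasP[q' q'T s] vq]].
  by exists q => //; apply/hasP; exists q => //; exact: same_face_refl.
by apply/mem_vertsP; exists q' => //; rewrite -(same_face_verts s).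
Qed.

Definition flip_verts (f : flip) :=
  [:: fw f; fv f; fa1 f; fa2 f; fa3 f; fa4 f; fa5 f; fa6 f].

Lemma old_quads_verts f q u : has (same_face q) (old_quads f) -> u \in qverts q ->
  u \in [:: fw f; fa1 f; fa2 f; fa3 f; fa4 f; fa5 f; fa6 f].
Proof.
rewrite /= orbF => /or3P[] /same_face_verts ->; rewrite /qverts /qv /= !inE;
by move=> /or4P[] /eqP->; rewrite eqxx ?orbT.
Qed.

Lemma new_quads_verts f q u : has (same_face q) (new_quads f) -> u \in qverts q ->
  u \in [:: fv f; fa1 f; fa2 f; fa3 f; fa4 f; fa5 f; fa6 f].
Proof.
rewrite /= orbF => /or3P[] /same_face_verts ->; rewrite /qverts /qv /= !inE;
by move=> /or4P[] /eqP->; rewrite eqxx ?orbT.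
Qed.

Lemma new_quads_top f q : has (same_face q) (new_quads f) -> fv f \in qverts q.
Proof.
by rewrite /= orbF => /or3P[] /same_face_verts ->; rewrite /qverts /qv /= !inE eqxx.
Qed.

Section Flip.
Variables (T T' : seq quad) (f : flip).
Hypothesis flT : is_flip T T' f.

Lemma old_quads_mem q : has (same_face q) (old_quads f) -> mem_face q T.
Proof.
case: flT => _ [/allP ao _] /hasP[q' q'o s].
by rewrite (mem_face_same _ s); apply: ao.
Qed.

Lemma verts_hexagon u : u \in [:: fw f; fa1 f; fa2 f; fa3 f; fa4 f; fa5 f; fa6 f] ->
  u \in verts T.
Proof.
move=> uf; apply/mem_verts_face.
suff [q qo uq] : exists2 q, q \in old_quads f & u \in qverts q.
  by exists q => //; apply: old_quads_mem; apply/hasP; exists q => //; apply: same_face_refl.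
move: uf; rewrite !inE => /or4P[|||/or4P[]] /eqP->.
- by exists (old_x f); rewrite ?inE ?eqxx ?orbT.
- by exists (old_y f); rewrite ?inE ?eqxx ?orbT.
- by exists (old_z f); rewrite ?inE ?eqxx ?orbT.
- by exists (old_x f); rewrite ?inE ?eqxx ?orbT.
- by exists (old_x f); rewrite ?inE ?eqxx ?orbT.
- by exists (old_x f); rewrite ?inE ?eqxx ?orbT.
- by exists (old_y f); rewrite ?inE ?eqxx ?orbT.
Qed.

Lemma verts_flip u : (u \in verts T') = (u \in verts T) && (u != fw f) || (u == fv f).
Proof.
case: (flT) => un [ao [wo mT']]; apply/idP/idP.
  move=> /mem_verts_face[q]; rewrite mT' => /orP[/andP[qT qo] uq|qn uq].
    apply/orP; left; apply/andP; split; first by apply/mem_verts_face; exists q.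
    apply: contraNneq qo => uw; move/hasP: qT => [q' q'T s].
    have := wo _ q'T; rewrite -(same_face_verts s) -uw => /(_ uq).
    by move=> /hasP[q'' q''o s']; apply/hasP; exists q'' => //; apply: same_face_trans s'.
  have := new_quads_verts qn uq; rewrite inE => /predU1P[->|uf]; first by rewrite eqxx orbT.
  rewrite verts_hexagon /=; last by rewrite inE uf orbT.
  rewrite (_ : u != fw f) //; apply: contraTneq uf => ->; by case/andP: un; rewrite inE negb_or => /andP[].
move=> H; apply/mem_verts_face.
have [un'|unn] := boolP (u \in [:: fv f; fa1 f; fa2 f; fa3 f; fa4 f; fa5 f; fa6 f]).
  suff [q qo uq] : exists2 q, q \in new_quads f & u \in qverts q.
    exists q => //; rewrite mT'; apply/orP; right; apply/hasP; exists q => //.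
    exact: same_face_refl.
  move: un'; rewrite !inE => /or4P[|||/or4P[]] /eqP->.
  - by exists (new_x f); rewrite ?inE ?eqxx ?orbT.
  - by exists (new_x f); rewrite ?inE ?eqxx ?orbT.
  - by exists (new_x f); rewrite ?inE ?eqxx ?orbT.
  - by exists (new_y f); rewrite ?inE ?eqxx ?orbT.
  - by exists (new_y f); rewrite ?inE ?eqxx ?orbT.
  - by exists (new_z f); rewrite ?inE ?eqxx ?orbT.
  - by exists (new_x f); rewrite ?inE ?eqxx ?orbT.
case/orP: H unn => [/andP[/mem_verts_face[q qT uq] uw]|/eqP->]; last by rewrite inE eqxx.
rewrite inE negb_or => /andP[_ unn]; exists q => //; rewrite mT' qT /=.
apply/orP; left; apply/negP => /old_quads_verts -/(_ _ uq).
by rewrite inE (negPf uw) (negPf unn).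
Qed.

Lemma old_not_mem q : has (same_face q) (old_quads f) -> mem_face q T' = false.
Proof.
case: (flT) => un [ao [wo mT']] qo; rewrite mT' qo andbF /=.
apply/negP => /new_quads_top /(old_quads_verts qo) H.
case/andP: un => _ /andP[vn _].
move: H; rewrite inE => /predU1P[vw|]; last by rewrite (negPf vn).
case: (flT) => /andP[+ _] _; by rewrite vw inE eqxx.
Qed.

End Flip.

(** Canonical representatives, so that lists of faces up to [same_face] can be compared as
    duplicate-free lists. *)
Definition face_rep (q : quad) : quad := choose (same_face q) q.

Lemma face_repP q : same_face q (face_rep q).
Proof. exact: chooseP (same_face_refl q). Qed.

Lemma face_repE q q' : (face_rep q == face_rep q') = same_face q q'.
Proof.
apply/eqP/idP => [e|s].
  apply: same_face_trans (face_repP q) _; rewrite e same_face_sym; exact: face_repP.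
have e : same_face q =1 same_face q'.
  move=> x; apply/idP/idP; last exact: same_face_trans.
  by apply: same_face_trans; rewrite same_face_sym.
rewrite /face_rep -(eq_choose e); apply: choose_id; first by rewrite same_face_refl.
by [].
Qed.

(** The position of a corner in [flip_verts], through which uniqueness of that list becomes
    injectivity of [cv]. *)
Definition corner_index (e : bool * bool * bool) : nat :=
  match e with
  | (false, false, false) => 0 | (true, true, true) => 1
  | (true, false, false) => 2 | (true, true, false) => 3
  | (false, true, false) => 4 | (false, true, true) => 5
  | (false, false, true) => 6 | (true, false, true) => 7
  end.

Lemma cv_inj f e e' : uniq (flip_verts f) ->
  cv f e.1.1 e.1.2 e.2 = cv f e'.1.1 e'.1.2 e'.2 -> e = e'.
Proof.
move=> un.
have E x : cv f x.1.1 x.1.2 x.2 = nth 0%N (flip_verts f) (corner_index x).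
  by case: x => [[[] []] []].
rewrite !E => /eqP; rewrite nth_uniq //; [|by case: (e) => [[[] []] []]..|by case: (e') => [[[] []] []]].
by case: e e' => [[[] []] []] [[[] []] []].
Qed.

Definition facex f b := if b then new_x f else old_x f.
Definition facey f b := if b then new_y f else old_y f.
Definition facez f b := if b then new_z f else old_z f.

Section CubeFaces.
Variables (f : flip) (un : uniq (flip_verts f)).

Lemma mem_facex e b : (cv f e.1.1 e.1.2 e.2 \in qverts (facex f b)) = (e.1.1 == b).
Proof.
have -> : qverts (facex f b) =i [:: cv f b false false; cv f b true false; cv f b true true; cv f b false true].
  by case: b => x; rewrite /qverts /qv /= !inE; do 4 case: (x == _).
apply/idP/eqP => [|<-]; last first.
  by case: e => [[i [] ] []]; rewrite !inE eqxx ?orbT.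
by rewrite !inE => /or4P[] /eqP; [move=> /(@cv_inj _ _ (b, false, false) un) ->
  | move=> /(@cv_inj _ _ (b, true, false) un) -> | move=> /(@cv_inj _ _ (b, true, true) un) ->
  | move=> /(@cv_inj _ _ (b, false, true) un) ->].
Qed.

Lemma mem_facey e b : (cv f e.1.1 e.1.2 e.2 \in qverts (facey f b)) = (e.1.2 == b).
Proof.
have -> : qverts (facey f b) =i [:: cv f false b false; cv f true b false; cv f true b true; cv f false b true].
  by case: b => x; rewrite /qverts /qv /= !inE; do 4 case: (x == _).
apply/idP/eqP => [|<-]; last first.
  by case: e => [[[] i ] []]; rewrite !inE eqxx ?orbT.
by rewrite !inE => /or4P[] /eqP; [move=> /(@cv_inj _ _ (false, b, false) un) ->
  | move=> /(@cv_inj _ _ (true, b, false) un) -> | move=> /(@cv_inj _ _ (true, b, true) un) ->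
  | move=> /(@cv_inj _ _ (false, b, true) un) ->].
Qed.

Lemma mem_facez e b : (cv f e.1.1 e.1.2 e.2 \in qverts (facez f b)) = (e.2 == b).
Proof.
have -> : qverts (facez f b) =i [:: cv f false false b; cv f true false b; cv f true true b; cv f false true b].
  by case: b => x; rewrite /qverts /qv /= !inE; do 4 case: (x == _).
apply/idP/eqP => [|<-]; last first.
  by case: e => [[[] [] ] i]; rewrite !inE eqxx ?orbT.
by rewrite !inE => /or4P[] /eqP; [move=> /(@cv_inj _ _ (false, false, b) un) ->
  | move=> /(@cv_inj _ _ (true, false, b) un) -> | move=> /(@cv_inj _ _ (true, true, b) un) ->
  | move=> /(@cv_inj _ _ (false, true, b) un) ->].
Qed.

Lemma mem_cube_face v q : q \in old_quads f ++ new_quads f -> v \in qverts q ->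
  exists e, v = cv f e.1.1 e.1.2 e.2.
Proof.
move=> qf vq; suff : v \in flip_verts f.
  rewrite !inE => /or4P[|||/or4P[|||/orP[]]] /eqP->.
  - by exists (false, false, false).
  - by exists (true, true, true).
  - by exists (true, false, false).
  - by exists (true, true, false).
  - by exists (false, true, false).
  - by exists (false, true, true).
  - by exists (false, false, true).
  - by exists (true, false, true).
move: qf vq; rewrite !inE => /or4P[|||/or3P[]] /eqP-> ;
by rewrite /qv /= => /or4P[] /eqP->; rewrite eqxx ?orbT.
Qed.

Lemma prod_corner (A : comPzRingType) (F : bool * bool * bool -> A) v :
  \prod_(e : bool * bool * bool | cv f e.1.1 e.1.2 e.2 == v) F e =
  if [pick e | cv f e.1.1 e.1.2 e.2 == v] is Some e then F e else 1.
Proof.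
case: pickP => [e /eqP <-|no]; last by rewrite big_pred0.
rewrite (big_pred1 e) // => e' /=; apply/eqP/eqP => [/(cv_inj un)|->] //.
Qed.

(** At most one corner [e] of the cube is [v], and the faces through it are the three whose constant
    coordinate agrees with that of [e]. *)
Lemma prod_corner_faces (A : comPzRingType) (phi : quad -> A) v :
  \prod_(e : bool * bool * bool | cv f e.1.1 e.1.2 e.2 == v)
     (phi (facex f e.1.1) * phi (facey f e.1.2) * phi (facez f e.2)) =
  \prod_(q <- old_quads f ++ new_quads f | v \in qverts q) phi q.
Proof.
rewrite prod_corner; case: pickP => [e /eqP <-|no]; last first.
  rewrite big_seq_cond big_pred0 // => q; apply/andP => -[qf /(mem_cube_face qf)[e ve]].
  by move: (no e); rewrite ve eqxx.
rewrite !big_cons big_nil.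
have [[mx my] mz] := (mem_facex e, mem_facey e, mem_facez e).
rewrite -[new_x f]/(facex f true) -[old_x f]/(facex f false) -[new_y f]/(facey f true) -[old_y f]/(facey f false) -[new_z f]/(facez f true) -[old_z f]/(facez f false) !mx !my !mz.
case: e {mx my mz} => [[[] []] []] /=; rewrite ?mulr1; ring.
Qed.
End CubeFaces.

(** * Piles *)

Section Pile.
Variables (Ts : seq (seq quad)) (fl : seq flip).
Local Notation T := (nth [::] Ts).
Local Notation F := (nth flip0 fl).
Local Notation n := (size fl).
Hypothesis T0_uniq : forall q, q \in T 0 -> uniq (qverts q).
Hypothesis flT : forall i, (i < n)%N -> is_flip (T i) (T i.+1) (F i).
Hypothesis fresh : forall i, (i < n)%N -> forall j, (j <= i)%N -> fv (F i) \notin verts (T j).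

(** Faces and vertices of the complex built by the first [k] flips, for inductions along the
    pile. *)
Definition prefix_faces k := T 0 ++ flatten (map new_quads (take k fl)).
Definition prefix_verts k := verts (T 0) ++ map fv (take k fl).

Lemma prefix_facesS k : (k < n)%N -> prefix_faces k.+1 = prefix_faces k ++ new_quads (F k).
Proof.
by move=> kn; rewrite /prefix_faces (take_nth flip0 kn) map_rcons flatten_rcons catA.
Qed.

Lemma prefix_vertsS k : (k < n)%N -> prefix_verts k.+1 = rcons (prefix_verts k) (fv (F k)).
Proof. by move=> kn; rewrite /prefix_verts (take_nth flip0 kn) map_rcons rcons_cat. Qed.

(** A face that came back would contain the new vertex of a flip, yet it already occurred before
    that vertex existed. *)
Lemma face_gone q i j k : (i <= j <= k)%N -> (k <= n)%N ->
  mem_face q (T i) -> ~~ mem_face q (T j) -> ~~ mem_face q (T k).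
Proof.
move=> /andP[ij jk] kn ui uj; elim: k jk kn => [|k IH].
  by rewrite leqn0 => /eqP <-.
rewrite leq_eqVlt => /predU1P[<- //|]; rewrite ltnS => jk kn.
case: (flT kn) => _ [_ [_ ->]]; rewrite (negPf (IH jk (ltnW kn))) /=.
apply/negP => /new_quads_top vq.
have := fresh kn (leq_trans ij jk); apply/negP; rewrite negbK.
by apply/mem_verts_face; exists q.
Qed.

Lemma new_face_now k q : (k < n)%N -> has (same_face q) (new_quads (F k)) -> mem_face q (T k.+1).
Proof. by move=> kn qk; case: (flT kn) => _ [_ [_ ->]]; rewrite qk orbT. Qed.

Lemma new_face_before k j q : (k < n)%N -> (j <= k)%N ->
  has (same_face q) (new_quads (F k)) -> ~~ mem_face q (T j).
Proof.
move=> kn jk /new_quads_top vq; have := fresh kn jk; apply: contra => qj.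
by apply/mem_verts_face; exists q.
Qed.

Lemma old_face_after k j q : (k < n)%N -> (k < j <= n)%N ->
  has (same_face q) (old_quads (F k)) -> ~~ mem_face q (T j).
Proof.
move=> kn /andP[kj jn] qk; apply: (@face_gone q k k.+1 j) => //; first by rewrite leqnSn.
  by rewrite (old_quads_mem (flT kn)).
by rewrite (old_not_mem (flT kn)).
Qed.

(** Together with [old_face_inj]: a face is created by at most one flip and destroyed by at most
    one, so it lies in at most two cubes. *)
Lemma new_face_inj i j q : (i < n)%N -> (j < n)%N ->
  has (same_face q) (new_quads (F i)) -> has (same_face q) (new_quads (F j)) -> i = j.
Proof.
wlog ij : i j / (i <= j)%N => [H|]; first by case: (leqP i j) => [|/ltnW] ? ? ? ? ?; [|symmetry]; apply: H.
move=> i_n j_n qi qj; apply/eqP; rewrite eqn_leq ij leqNgt; apply/negP => {}ij.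
by have := new_face_before j_n ij qj; rewrite (new_face_now i_n qi).
Qed.

Lemma old_face_inj i j q : (i < n)%N -> (j < n)%N ->
  has (same_face q) (old_quads (F i)) -> has (same_face q) (old_quads (F j)) -> i = j.
Proof.
wlog ij : i j / (i <= j)%N => [H|]; first by case: (leqP i j) => [|/ltnW] ? ? ? ? ?; [|symmetry]; apply: H.
move=> i_n j_n qi qj; apply/eqP; rewrite eqn_leq ij leqNgt; apply/negP => {}ij.
have := @old_face_after i j q i_n; rewrite ij ltnW // => /(_ isT qi).
by rewrite (old_quads_mem (flT j_n)).
Qed.

Lemma prefix_face_mem k q : (k <= n)%N -> q \in prefix_faces k ->
  exists2 j, (j <= k)%N & mem_face q (T j).
Proof.
elim: k => [|k IH] kn.
  rewrite /prefix_faces take0 cats0 => q0; exists 0%N => //.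
  by apply/hasP; exists q => //; apply: same_face_refl.
rewrite prefix_facesS // mem_cat => /orP[/(IH (ltnW kn))[j jk qj]|qn].
  by exists j => //; apply: leqW.
exists k.+1 => //; apply: new_face_now => //; apply/hasP; exists q => //.
exact: same_face_refl.
Qed.

Lemma mem_face_prefix k q : (k <= n)%N -> mem_face q (T k) -> mem_face q (prefix_faces k).
Proof.
elim: k => [|k IH] kn; first by rewrite /prefix_faces take0 cats0.
case: (flT kn) => _ [_ [_ ->]] H; rewrite prefix_facesS //.
move: (IH (ltnW kn)); rewrite /mem_face has_cat in H * => {}IH.
by case/orP: H => [/andP[/IH ->] //|->]; rewrite orbT.
Qed.

Lemma verts_prefix k u : (k <= n)%N -> u \in verts (T k) -> u \in prefix_verts k.
Proof.
elim: k => [|k IH] kn; first by rewrite /prefix_verts take0 cats0.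
rewrite (verts_flip (flT kn)) prefix_vertsS // mem_rcons inE.
by move=> /orP[/andP[/(IH (ltnW kn)) -> _]|->] //; rewrite orbT.
Qed.

Lemma prefix_vert_mem k u : (k <= n)%N -> u \in prefix_verts k ->
  exists2 j, (j <= k)%N & u \in verts (T j).
Proof.
elim: k => [|k IH] kn; first by rewrite /prefix_verts take0 cats0 => ?; exists 0%N.
rewrite prefix_vertsS // mem_rcons inE => /predU1P[->|/(IH (ltnW kn))[j jk uj]].
  by exists k.+1 => //; rewrite (verts_flip (flT kn)) eqxx orbT.
by exists j => //; apply: leqW.
Qed.

Lemma fresh_prefix k : (k < n)%N -> fv (F k) \notin prefix_verts k.
Proof.
move=> kn; apply/negP => /(prefix_vert_mem (ltnW kn))[j jk]; apply/negP; exact: fresh.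
Qed.

Lemma prefix_verts_sub j k : (j <= k)%N -> {subset prefix_verts j <= prefix_verts k}.
Proof.
move=> jk u; rewrite !mem_cat => /orP[->//|].
by rewrite -(subnKC jk) takeD map_cat mem_cat => ->; rewrite orbT.
Qed.

Lemma prefix_face_verts k q u : (k <= n)%N -> q \in prefix_faces k -> u \in qverts q ->
  u \in prefix_verts k.
Proof.
move=> kn /(prefix_face_mem kn)[j jk qj] uq.
have : u \in verts (T j) by apply/mem_verts_face; exists q.
by move=> /(verts_prefix (leq_trans jk kn)); apply: prefix_verts_sub.
Qed.

Lemma prefix_faces_n : prefix_faces n = kfaces (T 0) fl.
Proof. by rewrite /prefix_faces take_size. Qed.

Lemma prefix_verts_n : prefix_verts n = kverts (T 0) fl.
Proof. by rewrite /prefix_verts take_size. Qed.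

Lemma kverts_vert k u : (k <= n)%N -> u \in verts (T k) -> u \in kverts (T 0) fl.
Proof.
by move=> kn /(verts_prefix kn); rewrite -prefix_verts_n; apply: prefix_verts_sub.
Qed.

Lemma flip_vert_kvert i u : (i < n)%N -> u \in flip_verts (F i) -> u \in kverts (T 0) fl.
Proof.
move=> i_n; rewrite inE => /predU1P[->|].
  apply: (kverts_vert (ltnW i_n)); apply: (verts_hexagon (flT i_n)).
  by rewrite inE eqxx.
rewrite inE => /predU1P[->|H].
  apply: (kverts_vert i_n).
  by rewrite (verts_flip (flT i_n)) eqxx orbT.
apply: (kverts_vert (ltnW i_n)); apply: (verts_hexagon (flT i_n)).
by rewrite inE H orbT.
Qed.

Lemma kface_uniq q : q \in kfaces (T 0) fl -> uniq (qverts q).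
Proof.
rewrite -prefix_faces_n; elim: {-2}n (leqnn n) => [_|i IH i_n].
  by rewrite /prefix_faces take0 cats0; apply: T0_uniq.
rewrite prefix_facesS // mem_cat => /orP[/(IH (ltnW i_n)) //|].
have [un _] := flT i_n; set s := [:: _, _ & _] in un.
have U a b c d : uniq [:: a; b; c; d] -> all (gtn 8%N) [:: a; b; c; d] ->
    uniq (map (nth 0%N s) [:: a; b; c; d]).
  move=> u4 /allP lt; rewrite map_inj_in_uniq // => x y /lt xs /lt ys /eqP.
  by rewrite nth_uniq // => /eqP.
rewrite !inE => /or3P[] /eqP->.
- exact: (U 1%N 7%N 2%N 3%N isT isT).
- exact: (U 1%N 3%N 4%N 5%N isT isT).
- exact: (U 1%N 5%N 6%N 7%N isT isT).
Qed.
End Pile.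

Lemma uniq_face_rep3 q1 q2 q3 : ~~ same_face q1 q2 -> ~~ same_face q1 q3 -> ~~ same_face q2 q3 ->
  uniq (map face_rep [:: q1; q2; q3]).
Proof. by move=> h1 h2 h3; rewrite /= !inE !face_repE negb_or h1 h2 h3. Qed.

Lemma uniq_face_rep_old f : uniq (flip_verts f) -> uniq (map face_rep (old_quads f)).
Proof.
move=> un; have [[mx my] mz] := (mem_facex un, mem_facey un, mem_facez un).
apply: uniq_face_rep3; apply/negP => /same_face_verts E.
- by have := mx (false, true, false) false; have := my (false, true, false) false; rewrite /= E => ->.
- by have := mx (false, false, true) false; have := mz (false, false, true) false; rewrite /= E => ->.
- by have := my (false, false, true) false; have := mz (false, false, true) false; rewrite /= E => ->.
Qed.

Lemma uniq_face_rep_new f : uniq (flip_verts f) -> uniq (map face_rep (new_quads f)).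
Proof.
move=> un; have [[mx my] mz] := (mem_facex un, mem_facey un, mem_facez un).
apply: uniq_face_rep3; apply/negP => /same_face_verts E.
- by have := mx (true, false, true) true; have := my (true, false, true) true; rewrite /= E => ->.
- by have := mx (true, true, false) true; have := mz (true, true, false) true; rewrite /= E => ->.
- by have := my (true, true, false) true; have := mz (true, true, false) true; rewrite /= E => ->.
Qed.

(** * Faces and cubes around a vertex *)

Section Pile.
Variables (Ts : seq (seq quad)) (fl : seq flip).
Local Notation T := (nth [::] Ts).
Local Notation F := (nth flip0 fl).
Local Notation n := (size fl).
Hypothesis T0_uniq : forall q, q \in T 0 -> uniq (qverts q).
Hypothesis flT : forall i, (i < n)%N -> is_flip (T i) (T i.+1) (F i).
Hypothesis fresh : forall i, (i < n)%N -> forall j, (j <= i)%N -> fv (F i) \notin verts (T j).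

Lemma mem_flatten_take (g : flip -> seq quad) k q : (k <= n)%N ->
  reflect (exists2 j, (j < k)%N & q \in g (F j)) (q \in flatten (map g (take k fl))).
Proof.
move=> kn; apply: (iffP idP) => [|[j jk qj]].
  elim: k kn => [|k IH] kn; first by rewrite take0.
  rewrite (take_nth flip0 kn) map_rcons flatten_rcons mem_cat => /orP[/(IH (ltnW kn))[j jk qj]|qk].
    by exists j => //; apply: ltnW.
  by exists k.
have jn := leq_trans jk kn.
rewrite -(subnKC jk) takeD map_cat flatten_cat (take_nth flip0 jn) map_rcons flatten_rcons.
by rewrite !mem_cat qj orbT.
Qed.

Lemma uniq_face_rep_flatten (g : flip -> seq quad) :
  (forall i, (i < n)%N -> uniq (map face_rep (g (F i)))) ->
  (forall i j q q', (i < n)%N -> (j < n)%N -> q \in g (F i) -> q' \in g (F j) ->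
     same_face q q' -> i = j) ->
  uniq (map face_rep (flatten (map g fl))).
Proof.
move=> ug gi; rewrite -[in X in uniq X](take_size fl).
elim: {-2}n (leqnn n) => [|k IH] kn; first by rewrite take0.
rewrite (take_nth flip0 kn) map_rcons flatten_rcons map_cat cat_uniq IH ?ug ?(ltnW kn) //=.
rewrite andbT; apply/hasPn => _ /mapP[q qk ->]; apply/negP => /mapP[q' q'k /eqP].
rewrite face_repE => s; case/(mem_flatten_take _ _ (ltnW kn)) : q'k => j jk q'j.
by have /eqP := gi _ _ _ _ kn (ltn_trans jk kn) qk q'j s; rewrite gtn_eqF.
Qed.

(** A face of the first quadrangulation is never created by a flip, and a face of the last one is
    never destroyed; either way only one of the two possible cubes remains. *)
Lemma boundary_face v : v \in kverts (T 0) fl -> v \in verts (T 0) \/ v \in verts (T n) ->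
  exists q, [/\ q \in kfaces (T 0) fl, v \in qverts q &
   forall i j, (i < n)%N -> (j < n)%N ->
     has (same_face q) (old_quads (F i) ++ new_quads (F i)) ->
     has (same_face q) (old_quads (F j) ++ new_quads (F j)) -> i = j].
Proof.
move=> vk [v0|vn].
  case/mem_vertsP: v0 => q q0 vq; exists q; split=> //; first by rewrite mem_cat q0.
  have q0' : mem_face q (T 0) by apply/hasP; exists q => //; exact: same_face_refl.
  have nn k : (k < n)%N -> has (same_face q) (new_quads (F k)) = false.
    by move=> kn; apply/negP => /(new_face_before fresh kn (leq0n _)); rewrite q0'.
  move=> i j i_n j_n; rewrite !has_cat !nn // !orbF; exact: (old_face_inj flT fresh).
case/mem_verts_face: vn => q qn vq.
have /hasP[q' q'k s] := mem_face_prefix flT (leqnn n) qn.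
exists q'; rewrite -prefix_faces_n -(same_face_verts s); split=> //.
have q'n : mem_face q' (T n) by rewrite -(mem_face_same _ s).
have nn k : (k < n)%N -> has (same_face q') (old_quads (F k)) = false.
  by move=> kn; apply/negP => /(@old_face_after _ _ flT fresh _ n _ kn); rewrite kn leqnn q'n => /(_ isT).
move=> i j i_n j_n; rewrite !has_cat !nn //; exact: (new_face_inj flT fresh).
Qed.

Section Interior.
Variable v : nat.
Hypotheses (vk : v \in kverts (T 0) fl) (v0 : v \notin verts (T 0)) (vn : v \notin verts (T n)).

Lemma interior_face_new q i : (i < n)%N -> q \in old_quads (F i) -> v \in qverts q ->
  exists2 q', same_face q q' & q' \in flatten (map new_quads fl).
Proof.
move=> i_n qi vq.
have qo : has (same_face q) (old_quads (F i)) by apply/hasP; exists q => //; exact: same_face_refl.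
have /hasP[q' q'p s] := mem_face_prefix flT (ltnW i_n) (old_quads_mem (flT i_n) qo).
exists q' => //; move: q'p; rewrite mem_cat => /orP[q0|].
  by case/negP: v0; apply/mem_vertsP; exists q' => //; rewrite -(same_face_verts s).
case/(mem_flatten_take _ _ (ltnW i_n)) => j jk qj.
rewrite -(take_size fl); apply/(mem_flatten_take _ _ (leqnn n)); exists j => //.
exact: ltn_trans jk i_n.
Qed.

Lemma interior_face_old q i : (i < n)%N -> q \in new_quads (F i) -> v \in qverts q ->
  exists2 q', same_face q q' & q' \in flatten (map old_quads fl).
Proof.
move=> i_n qi vq.
have qn : has (same_face q) (new_quads (F i)) by apply/hasP; exists q => //; exact: same_face_refl.
have qT := new_face_now flT i_n qn.
have qTn : ~~ mem_face q (T n).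
  by apply: contra vn => qTn; apply/mem_verts_face; exists q.
(* The face is absent at the end because [v] is. The flip just before its first absence must have
   destroyed it. *)
have [j /andP[ij jn] /andP[qj qj1]] : exists2 j, (i < j < n)%N & mem_face q (T j) && ~~ mem_face q (T j.+1).
  have : exists j, (i < j <= n)%N && ~~ mem_face q (T j) by exists n; rewrite i_n leqnn.
  move=> /ex_minnP[[|j] /andP[/andP[ij jn] qj] jmin] //; exists j; last first.
    rewrite qj andbT; apply/negPn/negP => qj'.
    have ij' : (i < j)%N.
      by rewrite ltn_neqAle -ltnS ij andbT; apply: contraNneq qj => <-.
    by have := jmin j; rewrite ij' ltnW // qj' ltnn => /(_ isT).
  by rewrite jn andbT ltn_neqAle -ltnS ij andbT; apply: contraNneq qj => <-.
have [_ [_ [_ E]]] := flT jn; move: qj1; rewrite E qj andTb negb_or negbK => /andP[/hasP[q' q'o s] _].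
exists q' => //; rewrite -(take_size fl); apply/(mem_flatten_take _ _ (leqnn n)).
by exists j.
Qed.

(** All faces at [v] are created by flips and later destroyed by flips, so the new faces at [v] and
    the old faces at [v] are two listings of the same set without repetition. *)
Lemma interior_prod_faces (A : comPzRingType) (phi : quad -> A) :
  (forall q q', same_face q q' -> phi q = phi q') ->
  \prod_(f <- fl) \prod_(q <- old_quads f ++ new_quads f | v \in qverts q) phi q =
  \prod_(q <- kfaces (T 0) fl | v \in qverts q) phi q ^+ 2.
Proof.
move=> phiE; have phic s : \prod_(q <- s | v \in qverts q) phi q =
    \prod_(q <- map face_rep [seq q <- s | v \in qverts q]) phi q.
  by rewrite big_map big_filter; apply: eq_bigr => q _; apply: phiE (face_repP q).
under eq_bigr do rewrite big_cat.
have FL g : \prod_(f <- fl) \prod_(q <- g f | v \in qverts q) phi q =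
    \prod_(q <- flatten (map g fl) | v \in qverts q) phi q by rewrite big_flatten big_map.
rewrite big_split /= !FL.
rewrite big_cat /= [in RHS]big1_seq ?mul1r; last first.
  move=> q /andP[vq q0]; case/negP: v0; apply/mem_vertsP; exists q => //.
rewrite prodrXl expr2; congr (_ * _); rewrite !phic; apply: perm_big.
have un k : (k < n)%N -> uniq (flip_verts (F k)) by move=> kn; case: (flT kn).
apply: uniq_perm.
- apply: subseq_uniq (map_subseq _ (filter_subseq _ _)) _.
  apply: uniq_face_rep_flatten => [i i_n|i j q q' i_n j_n qi qj s]; first exact: uniq_face_rep_old (un _ i_n).
  apply: (@old_face_inj _ _ flT fresh i j q') => //; apply/hasP.
    by exists q; rewrite // same_face_sym.
  by exists q' => //; apply: same_face_refl.
- apply: subseq_uniq (map_subseq _ (filter_subseq _ _)) _.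
  apply: uniq_face_rep_flatten => [i i_n|i j q q' i_n j_n qi qj s]; first exact: uniq_face_rep_new (un _ i_n).
  apply: (@new_face_inj _ _ flT fresh i j q') => //; apply/hasP.
    by exists q; rewrite // same_face_sym.
  by exists q' => //; apply: same_face_refl.
- move=> c; apply/mapP/mapP => -[q]; rewrite mem_filter => /andP[vq];
  rewrite -{1}(take_size fl) => /(mem_flatten_take _ _ (leqnn n))[i i_n qi] ->.
    have [q' s q'n] := interior_face_new i_n qi vq.
    by exists q'; [rewrite mem_filter q'n -(same_face_verts s) vq|apply/eqP; rewrite face_repE].
  have [q' s q'n] := interior_face_old i_n qi vq.
  by exists q'; [rewrite mem_filter q'n -(same_face_verts s) vq|apply/eqP; rewrite face_repE].
Qed.

End Interior.

(** A flip changes whether [v] is present exactly when [v] is its bottom or its top, so the signs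
    telescope along the pile. *)
Lemma prod_sign_verts (v : nat) (A : comPzRingType) : 
  \prod_(f <- fl) ((-1) ^+ (v == fw f) * (-1) ^+ (v == fv f)) =
  (-1) ^+ (v \in verts (T 0)) * (-1) ^+ (v \in verts (T n)) :> A.
Proof.
rewrite -[in LHS](take_size fl); elim: {-2}n (leqnn n) => [|k IH] kn.
  by rewrite take0 big_nil -expr2 sqrr_sign.
rewrite (take_nth flip0 kn) big_rcons IH ?(ltnW kn) //= (verts_flip (flT kn)).
have wk : fw (F k) \in verts (T k) by apply: (verts_hexagon (flT kn)); rewrite inE eqxx.
have vk : fv (F k) \notin verts (T k) by apply: fresh.
have wv : fw (F k) != fv (F k) by apply: contraNneq vk => <-.
case: (eqVneq v (fw (F k))) => [->|vw]; first by rewrite wk (negPf wv) /=; ring.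
case: (eqVneq v (fv (F k))) => [->|vv]; first by rewrite (negPf vk) /=; ring.
by rewrite /= andbT orbF; ring.
Qed.
End Pile.

(** * Sperner's lemma for the cubical grid *)

Section Kuhn.
Local Open Scope nat_scope.

Lemma big_addb_telescope k (g : nat -> bool) :
  \big[addb/false]_(i < k) (g i.+1 (+) g i) = g k (+) g 0.
Proof.
elim: k => [|k IH]; first by rewrite big_ord0 addbb.
by rewrite big_ord_recr /= IH; case: (g 0) (g k) (g k.+1) => [] [] [].
Qed.

Section Sperner.
Variables (k : nat) (L : nat -> nat -> nat -> nat).
Hypothesis L4 : forall x y z, L x y z < 4.
Hypothesis Lx0 : forall y z, L 0 y z = 0.
Hypothesis Lxk : forall y z, L k y z != 0.
Hypothesis Ly0 : forall x z, L x 0 z < 2.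
Hypothesis Lyk : forall x z, L x k z != 1.
Hypothesis Lz0 : forall x y, L x y 0 < 3.
Hypothesis Lzk : forall x y, L x y k != 2.

(** Indicators of fully labelled edges, triangles and tetrahedra, to be summed modulo 2. With the
    labels suitably bounded, each is the sum over the boundary of the indicator one dimension
    lower. *)
Let E a b := perm_eq [:: a; b] [:: 0; 1].
Let D a b c := perm_eq [:: a; b; c] [:: 0; 1; 2].
Let S a b c d := perm_eq [:: a; b; c; d] [:: 0; 1; 2; 3].

Let E_boundary a b : a < 2 -> b < 2 -> E a b = (a == 0) (+) (b == 0).
Proof. by move: a b => [|[|]] // [|[|]]. Qed.

Let D_boundary a b c : a < 3 -> b < 3 -> c < 3 -> D a b c = E b c (+) E a c (+) E a b.
Proof. by move: a b c => [|[|[|]]] // [|[|[|]]] // [|[|[|]]]. Qed.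

Let S_boundary a b c d : a < 4 -> b < 4 -> c < 4 -> d < 4 ->
  S a b c d = (D b c d (+) D a b c) (+) (D a b d (+) D a c d).
Proof. by move: a b c d => [|[|[|[|]]]] // [|[|[|[|]]]] // [|[|[|[|]]]] // [|[|[|[|]]]]. Qed.

Let E_no0 a b : a != 0 -> b != 0 -> E a b = false.
Proof. by move=> a0 b0; apply/negP => /perm_mem /(_ 0); rewrite !inE /= !(eq_sym 0) (negPf a0) (negPf b0). Qed.
Let E_no1 a b : a != 1 -> b != 1 -> E a b = false.
Proof. by move=> a0 b0; apply/negP => /perm_mem /(_ 1); rewrite !inE /= !(eq_sym 1) (negPf a0) (negPf b0). Qed.
Let D_no0 a b c : a != 0 -> b != 0 -> c != 0 -> D a b c = false.
Proof. by move=> a0 b0 c0; apply/negP => /perm_mem /(_ 0); rewrite !inE /= !(eq_sym 0) (negPf a0) (negPf b0) (negPf c0). Qed.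
Let D_no1 a b c : a != 1 -> b != 1 -> c != 1 -> D a b c = false.
Proof. by move=> a0 b0 c0; apply/negP => /perm_mem /(_ 1); rewrite !inE /= !(eq_sym 1) (negPf a0) (negPf b0) (negPf c0). Qed.
Let D_no2 a b c : a != 2 -> b != 2 -> c != 2 -> D a b c = false.
Proof. by move=> a0 b0 c0; apply/negP => /perm_mem /(_ 2); rewrite !inE /= !(eq_sym 2) (negPf a0) (negPf b0) (negPf c0). Qed.

Let square x y := D (L x y 0) (L x.+1 y 0) (L x.+1 y.+1 0) (+) D (L x y 0) (L x y.+1 0) (L x.+1 y.+1 0).

(** Sperner's lemma on the bottom square. The sides [x = 0], [x = k] and [y = k] carry no full edge,
    and along [y = 0] the label changes from zero to nonzero an odd number of times. *)
Let square_sum : \big[addb/false]_(x < k) \big[addb/false]_(y < k) square x y = true.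
Proof.
pose E1 x y := E (L x y 0) (L x y.+1 0).
pose E0 x y := E (L x y 0) (L x.+1 y 0).
have sq x y : square x y = (E1 x.+1 y (+) E1 x y) (+) (E0 x y.+1 (+) E0 x y).
  rewrite /square !D_boundary // /E1 /E0.
  by case: (E _ _) (E _ _) (E _ _) (E _ _) (E _ _) => [] [] [] [] [].
under eq_bigr => x _ do under eq_bigr => y _ do rewrite sq.
under eq_bigr => x _ do rewrite big_split (big_addb_telescope k (E0 x)).
rewrite big_split exchange_big /= big1 => [|y _]; last first.
  by rewrite (big_addb_telescope k (E1^~ y)) /E1 E_no0 // E_no1 ?Lx0.
rewrite addFb.
have E0k x : E0 x k (+) E0 x 0 = (L x.+1 0 0 == 0) (+) (L x 0 0 == 0).
  by rewrite /E0 E_no1 // addFb E_boundary // addbC.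
under eq_bigr => x _ do rewrite E0k.
by rewrite (big_addb_telescope k (fun x => L x 0 0 == 0)) Lx0 (negPf (Lxk _ _)).
Qed.

(* The six simplices of the Kuhn triangulation of a unit cube, in cyclic order. *)
Let cube x y z :=
  S (L x y z) (L x.+1 y z) (L x.+1 y.+1 z) (L x.+1 y.+1 z.+1) (+)
  S (L x y z) (L x y.+1 z) (L x.+1 y.+1 z) (L x.+1 y.+1 z.+1) (+)
  S (L x y z) (L x y.+1 z) (L x y.+1 z.+1) (L x.+1 y.+1 z.+1) (+)
  S (L x y z) (L x y z.+1) (L x y.+1 z.+1) (L x.+1 y.+1 z.+1) (+)
  S (L x y z) (L x y z.+1) (L x.+1 y z.+1) (L x.+1 y.+1 z.+1) (+)
  S (L x y z) (L x.+1 y z) (L x.+1 y z.+1) (L x.+1 y.+1 z.+1).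

(** The [m] are the six triangles through the main diagonal of the cube. Each is shared by two
    consecutive simplices and cancels, which leaves the outer triangles [p]. *)
Let hexagon p1 p2 p3 p4 p5 p6 m1 m2 m3 m4 m5 m6 :
  (p1 (+) (m1 (+) m2)) (+) (p2 (+) (m3 (+) m2)) (+) (p3 (+) (m3 (+) m4)) (+)
  (p4 (+) (m5 (+) m4)) (+) (p5 (+) (m5 (+) m6)) (+) (p6 (+) (m1 (+) m6)) =
  p1 (+) p2 (+) p3 (+) p4 (+) p5 (+) p6.
Proof.
by move: m1 m2 m3 m4 m5 m6 p1 p2 p3 p4 p5 p6 =>
  [] [] [] [] [] [] [] [] [] [] [] [].
Qed.

Let regroup b1 t1 b2 t2 b3 t3 b4 t4 b5 t5 b6 t6 :
  (t1 (+) b1) (+) (t2 (+) b2) (+) (t3 (+) b3) (+) (t4 (+) b4) (+) (t5 (+) b5) (+) (t6 (+) b6) =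
  (((t1 (+) t6) (+) (b3 (+) b4)) (+) ((t2 (+) t3) (+) (b6 (+) b5))) (+) ((t5 (+) t4) (+) (b1 (+) b2)).
Proof.
by move: b1 t1 b2 t2 b3 t3 b4 t4 b5 t5 b6 t6 =>
  [] [] [] [] [] [] [] [] [] [] [] [].
Qed.

(** The outer triangles cancel between adjacent cubes. Of the six sides of the grid only [z = 0] can
    carry full triangles, and there [square_sum] applies: each other side misses one of the labels
    0, 1, 2. *)
Let cube_sum : \big[addb/false]_(x < k) \big[addb/false]_(y < k) \big[addb/false]_(z < k) cube x y z = true.
Proof.
pose Gx x y z := D (L x y z) (L x y.+1 z) (L x y.+1 z.+1) (+) D (L x y z) (L x y z.+1) (L x y.+1 z.+1).
pose Gy x y z := D (L x y z) (L x.+1 y z) (L x.+1 y z.+1) (+) D (L x y z) (L x y z.+1) (L x.+1 y z.+1).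
pose Gz x y z := D (L x y z) (L x.+1 y z) (L x.+1 y.+1 z) (+) D (L x y z) (L x y.+1 z) (L x.+1 y.+1 z).
have cb x y z : cube x y z = ((Gx x.+1 y z (+) Gx x y z) (+) (Gy x y.+1 z (+) Gy x y z)) (+) (Gz x y z.+1 (+) Gz x y z).
  by rewrite /cube !S_boundary // hexagon regroup.
have Gx0 y z : Gx k y z (+) Gx 0 y z = false by rewrite /Gx ![D (L k _ _) _ _]D_no0 // ![D (L 0 _ _) _ _]D_no1 ?Lx0.
have ne1 x z : L x 0 z != 2 by have := Ly0 x z; case: (L x 0 z) => [|[|]].
have Gy0 x z : Gy x k z (+) Gy x 0 z = false.
  by rewrite /Gy ![D (L _ k _) _ _]D_no1 // !D_no2.
have Gzk x y : Gz x y k = false by rewrite /Gz !D_no2.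
under eq_bigr => x _ do under eq_bigr => y _ do under eq_bigr => z _ do rewrite cb.
under eq_bigr => x _ do under eq_bigr => y _ do rewrite big_split big_split /= (big_addb_telescope k (Gz x y)) Gzk.
under eq_bigr => x _ do rewrite big_split big_split /=.
rewrite big_split big_split /=.
rewrite [X in X (+) _ (+) _](_ : _ = false); last first.
  rewrite exchange_big big1 //= => y _; rewrite exchange_big big1 //= => z _.
  by rewrite (big_addb_telescope k (fun x => Gx x y z)).
rewrite [X in _ (+) X (+) _](_ : _ = false); last first.
  rewrite big1 //= => x _; rewrite exchange_big big1 //= => z _.
  by rewrite (big_addb_telescope k (fun y => Gy x y z)).
exact: square_sum.
Qed.

Lemma sperner3 : exists x y z, [/\ x < k, y < k, z < k &
  forall l, l < 4 -> exists i j m : bool, L (x + i) (y + j) (z + m) = l].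
Proof.
have [x [y [z [xk yk zk c]]]] : exists x y z, [/\ x < k, y < k, z < k & cube x y z].
  have /existsP[x /existsP[y /existsP[z c]]] :
      [exists x : 'I_k, exists y : 'I_k, exists z : 'I_k, cube x y z].
    apply: contraT => N; have := cube_sum; rewrite big1 // => x _.
    rewrite big1 // => y _; rewrite big1 // => z _; apply: contraNF N => c.
    by apply/existsP; exists x; apply/existsP; exists y; apply/existsP; exists z.
  by exists x, y, z.
exists x, y, z; split=> // l l4.
have P a b c' d : S a b c' d -> l \in [:: a; b; c'; d].
  by move=> /perm_mem ->; move: l l4 {c} => [|[|[|[|]]]].
have [A|[A|[A|[A|[A|A]]]]] : S (L x y z) (L x.+1 y z) (L x.+1 y.+1 z) (L x.+1 y.+1 z.+1) \/
  S (L x y z) (L x y.+1 z) (L x.+1 y.+1 z) (L x.+1 y.+1 z.+1) \/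
  S (L x y z) (L x.+1 y z) (L x.+1 y z.+1) (L x.+1 y.+1 z.+1) \/
  S (L x y z) (L x y z.+1) (L x.+1 y z.+1) (L x.+1 y.+1 z.+1) \/
  S (L x y z) (L x y.+1 z) (L x y.+1 z.+1) (L x.+1 y.+1 z.+1) \/
  S (L x y z) (L x y z.+1) (L x y.+1 z.+1) (L x.+1 y.+1 z.+1).
  by move: c; rewrite /cube; do 6 (case: (S _ _ _ _); rewrite ?addbT ?addbF ?addTb ?addFb; try by tauto).
all: move/P: A; rewrite !inE => /or4P[] /eqP->.
all: by [exists false, false, false; rewrite !addn0 | exists true, false, false; rewrite !addn0 addn1 |
  exists false, true, false; rewrite !addn0 addn1 | exists false, false, true; rewrite !addn0 addn1 |
  exists true, true, false; rewrite addn0 !addn1 | exists true, false, true; rewrite addn0 !addn1 |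
  exists false, true, true; rewrite addn0 !addn1 | exists true, true, true; rewrite !addn1].
Qed.
End Sperner.

End Kuhn.

(** * A covering lemma of Knaster-Kuratowski-Mazurkiewicz type on a box *)

Section KKM.
Variable R : realType.

Lemma rV_ballP n (x y : 'rV[R]_n) (e : R) : 0 < e ->
  ball x e y <-> forall j, `|x ord0 j - y ord0 j| < e.
Proof.
move=> e0; split=> [[_ H] j|H]; first exact: H.
by split=> // i j; rewrite ord1; apply: H.
Qed.

Lemma within_continuous_ball n m (A : set 'rV[R]_n) (f : 'rV[R]_n -> 'rV[R]_m) :
  {within A, continuous f} -> forall x, A x -> forall e, 0 < e ->
  exists2 d, 0 < d & forall y, A y -> ball x d y -> ball (f x) e (f y).
Proof.
move=> /subspace_continuousP cf x Ax e e0.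
have : nbhs (f x) (ball (f x) e) by exact: nbhsx_ballx.
move=> /(cf x Ax); rewrite /= /within /= => /nbhs_ballP[d d0 H].
by exists d => // y Ay xy; apply: H.
Qed.

Definition cbox (c : 'rV[R]_3) (d : R) : set 'rV[R]_3 :=
  [set y | forall i, `|y ord0 i - c ord0 i| <= d].

Lemma cbox_compact c d : compact (cbox c d).
Proof.
rewrite (_ : cbox c d = [set v | forall i, `[c ord0 i - d, c ord0 i + d]%classic (v ord0 i)]).
  by apply: (@rV_compact _ _ (fun i => `[c ord0 i - d, c ord0 i + d]%classic)) => i; exact: segment_compact.
by apply/seteqP; split=> y /= H i; have := H i; rewrite in_itv /= ler_distl.
Qed.

Variables (c : 'rV[R]_3) (d : R) (low : 'I_3 -> 'rV[R]_3 -> bool).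
Hypothesis d0 : 0 < d.
Let Q := cbox c d.
Hypothesis low_min : forall i y, Q y -> y ord0 i = c ord0 i - d -> low i y.
Hypothesis low_max : forall i y, Q y -> y ord0 i = c ord0 i + d -> ~~ low i y.

Let i0 : 'I_3 := inord 0.
Let i1 : 'I_3 := inord 1.
Let i2 : 'I_3 := inord 2.

(** The first low coordinate, or 3 if there is none. The conditions on [low] at opposite sides of
    the box become the boundary conditions of [sperner3]. *)
Let label y : nat := if low i0 y then 0 else if low i1 y then 1 else if low i2 y then 2 else 3.

(** The indices are truncated at [k] because [sperner3] asks for its boundary conditions at all
    natural indices. *)
Let grid (k x1 x2 x3 : nat) : 'rV[R]_3 :=
  \row_i (c ord0 i - d + d *+ 2 * (minn (nth 0%N [:: x1; x2; x3] i) k)%:R / k%:R).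

Let gridQ k x1 x2 x3 : (0 < k)%N -> Q (grid k x1 x2 x3).
Proof.
move=> k0 i; rewrite mxE; set a := minn _ _.
have ak : (a <= k)%N by rewrite geq_minr.
have : 0 <= (a%:R / k%:R : R) <= 1.
  by rewrite divr_ge0 ?ler0n //= ler_pdivrMr ?ltr0n // mul1r ler_nat.
move=> /andP[r0 r1]; rewrite -mulrA ler_norml; set r := _ / _ in r0 r1 *.
have dr0 : 0 <= d * r by rewrite mulr_ge0 // ltW.
have dr1 : d * r <= d by rewrite ler_piMr // ltW.
by rewrite mulrnAl; apply/andP; split; lra.
Qed.

Let grid_label k : (0 < k)%N -> exists y : 'rV[R]_3, Q y /\
  forall l, (l < 4)%N -> exists z, [/\ Q z, label z = l & forall i, `|y ord0 i - z ord0 i| <= d *+ 2 / k%:R].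
Proof.
move=> k0.
have gQ := gridQ _ _ _ k0.
have v0 : nat_of_ord i0 = 0%N by rewrite inordK.
have v1 : nat_of_ord i1 = 1%N by rewrite inordK.
have v2 : nat_of_ord i2 = 2%N by rewrite inordK.
have kn0 : (k%:R : R) != 0 by rewrite pnatr_eq0 -lt0n.
have := @sperner3 k (fun x y z => label (grid k x y z)).
have lmin (i : 'I_3) x1 x2 x3 : nth 0%N [:: x1; x2; x3] i = 0%N -> low i (grid k x1 x2 x3).
  by move=> e; apply: low_min => //; rewrite mxE e min0n mulr0 mul0r addr0.
have lmax (i : 'I_3) x1 x2 x3 : nth 0%N [:: x1; x2; x3] i = k -> low i (grid k x1 x2 x3) = false.
  by move=> e; apply/negbTE; apply: low_max => //; rewrite mxE e minnn mulfK //; lra.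
case.
- by move=> x y z; rewrite /label; do 3 case: ifP => // _.
- by move=> y z; rewrite /label lmin // v0.
- by move=> y z; rewrite /label lmax ?v0 //; do 2 case: ifP => // _.
- by move=> x z; rewrite /label (lmin i1) ?v1 //; case: ifP.
- by move=> x z; rewrite /label (lmax i1) ?v1 //; do 2 case: ifP => // _.
- by move=> x y; rewrite /label (lmin i2) ?v2 //; do 2 case: ifP => // _.
- by move=> x y; rewrite /label (lmax i2) ?v2 //; do 2 case: ifP => // _.
move=> x1 [x2 [x3 [x1k x2k x3k H]]]; exists (grid k x1 x2 x3); split=> // l l4.
have [a1 [a2 [a3 E]]] := H l l4.
exists (grid k (x1 + a1) (x2 + a2) (x3 + a3)); split=> // i.
rewrite !mxE; set u := nth _ _ _; set w := nth _ _ _.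
have [b -> uk] : exists2 b : bool, w = (u + b)%N & (u < k)%N.
  by rewrite /u /w; case: (i) => [[|[|[|]]]] //= _; [exists a1|exists a2|exists a3].
rewrite (minn_idPl (ltnW uk)) (minn_idPl _); last by case: b; rewrite ?addn1 ?addn0 // ltnW.
rewrite natrD -[X in `|X|](_ : - (d *+ 2 / k%:R * b%:R) = _); last by field.
rewrite normrN ger0_norm; last by rewrite !mulr_ge0 ?invr_ge0 ?ler0n // mulrn_wge0 // ltW.
by rewrite ler_piMr ?lern1 ?leq_b1 // mulr_ge0 ?invr_ge0 ?ler0n // mulrn_wge0 // ltW.
Qed.

(** The fully labelled cubes of ever finer grids accumulate at [y] by compactness. Nothing makes
    [low] a closed condition, so the labels are found arbitrarily near [y] and not at [y] itself. *)
Lemma kkm3 : exists2 y, Q y & forall e, 0 < e ->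
  exists y0 y1 y2 y3,
  [/\ Q y0 /\ ball y e y0, Q y1 /\ ball y e y1, Q y2 /\ ball y e y2 & Q y3 /\ ball y e y3] /\
  [/\ low i0 y0, ~~ low i0 y1 && low i1 y1, [&& ~~ low i0 y2, ~~ low i1 y2 & low i2 y2] &
      [&& ~~ low i0 y3, ~~ low i1 y3 & ~~ low i2 y3]].
Proof.
have /choice[b bP] : forall n : nat, exists y : 'rV[R]_3, Q y /\
  forall l, (l < 4)%N -> exists z, [/\ Q z, label z = l & forall i, `|y ord0 i - z ord0 i| <= d *+ 2 / n.+1%:R].
  by move=> n; exact: grid_label.
have Qb : (b @ \oo) Q by exists 0%N => // n _; case: (bP n).
have [y [Qy yb]] := @cbox_compact c d _ _ Qb.
exists y => // e e0.
have e20 : 0 < e / 2 by rewrite divr_gt0.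
have d2e : 0 < e / 2 / (d *+ 2) by rewrite divr_gt0 // pmulrn_lgt0.
have [N _ HN] := near_infty_natSinv_lt (PosNum d2e).
have A : (b @ \oo) [set b n | n in [set n | (N <= n)%N]] by exists N => // n /= Nn; exists n.
have B : nbhs y (ball y (e / 2)) by exact: nbhsx_ballx.
have [_ [[n /= Nn <-] ynb]] := yb _ _ A B.
have {}HN : d *+ 2 / n.+1%:R < e / 2.
  by have := HN n Nn; rewrite /= ltr_pdivlMr ?pmulrn_lgt0 // mulrC.
have [_ bl] := bP n.
have P l : (l < 4)%N -> exists z, (Q z /\ ball y e z) /\ label z = l.
  move=> l4; have [z [Qz zl zb]] := bl l l4; exists z; split=> //; split=> //.
  rewrite (splitr e); apply: ball_triangle ynb _; apply/rV_ballP => // j.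
  exact: le_lt_trans (zb j) HN.
have [y0 [? l0]] := P 0%N isT; have [y1 [? l1]] := P 1%N isT.
have [y2 [? l2]] := P 2%N isT; have [y3 [? l3]] := P 3%N isT.
exists y0, y1, y2, y3; split=> //.
move: l0 l1 l2 l3; rewrite /label.
by do 4 (do 3 case: ifP => //=).
Qed.

End KKM.

(** * Points of a three-dimensional chart *)

Section Chart.
Variable R : realType.

Lemma coord_cvg n (j : 'I_n) (y : 'rV[R]_n) : (fun v : 'rV[R]_n => v ord0 j : R) @ y --> (y ord0 j : R).
Proof. exact: (@coord_continuous R 1 n ord0 j y). Qed.

Lemma open_ball3_open (c : 'rV[R]_3) : open_ball3 c ->
  exists2 d, 0 < d & ball c d `<=` @open_ball3 R.
Proof.
move=> c1; pose f (y : 'rV[R]_3) := \sum_(i < 3) y ord0 i ^+ 2.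
have cf : f y @[y --> c] --> f c.
  have -> : f = (fun y => y ord0 ord0 * y ord0 ord0 + (y ord0 (lift ord0 ord0) * y ord0 (lift ord0 ord0)
      + y ord0 (lift ord0 (lift ord0 ord0)) * y ord0 (lift ord0 (lift ord0 ord0)))).
    by apply/funext => y; rewrite /f !big_ord_recl big_ord0 addr0 !expr2.
  have cc (j : 'I_3) : (fun y : 'rV[R]_3 => y ord0 j * y ord0 j) @ c --> c ord0 j * c ord0 j.
    exact: (cvgM (@coord_cvg _ j c) (@coord_cvg _ j c)).
  exact: (cvgD (cc _) (cvgD (cc _) (cc _))).
have c1' : f c < 1 := c1.
have : nbhs (f c) [set z | z < 1] := lt_nbhsl c1'.
by move=> /cf /nbhs_ballP[d d0 H]; exists d.
Qed.

Variables (n : nat) (U : set 'rV[R]_n) (g : 'rV[R]_n -> 'rV[R]_3) (h : 'rV[R]_3 -> 'rV[R]_n).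
Hypothesis gU : forall p, U p -> open_ball3 (g p).
Hypothesis hB : forall y, open_ball3 y -> U (h y).
Hypothesis gK : forall p, U p -> h (g p) = p.
Hypothesis hK : forall y, open_ball3 y -> g (h y) = y.
Hypothesis cg : {within U, continuous g}.
Hypothesis ch : {within @open_ball3 R, continuous h}.

Lemma chart_box (p : 'rV[R]_n) e : U p -> 0 < e ->
  exists d, [/\ 0 < d, cbox (g p) d `<=` @open_ball3 R & forall y, cbox (g p) d y -> ball p e (h y)].
Proof.
move=> Up e0; have [d1 d10 H1] := open_ball3_open (gU Up).
have [d2 d20 H2] := within_continuous_ball ch (gU Up) e0.
pose d := Num.min d1 d2 / 2.
have d0 : 0 < d by rewrite divr_gt0 // lt_min d10.
have dd : d < Num.min d1 d2 by rewrite /d gtr_pMr ?lt_min ?d10 ?d20 // invf_lt1 ?ltr1n.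
have B y : cbox (g p) d y -> ball (g p) (Num.min d1 d2) y.
  move=> H; apply/rV_ballP; first by rewrite lt_min d10.
  by move=> j; rewrite distrC; apply: le_lt_trans (H j) dd.
have S y : cbox (g p) d y -> open_ball3 y.
  by move=> /B yb; apply: H1; apply: le_ball yb; rewrite ge_min lexx.
exists d; split=> // y yd; rewrite -[X in ball X](gK Up); apply: H2; first exact: S.
by apply: le_ball (B _ yd); rewrite ge_min lexx orbT.
Qed.

Lemma chart_cvg (A : set 'rV[R]_3) y : A `<=` @open_ball3 R -> A y ->
  h z @[z --> within A (nbhs y)] --> h y.
Proof.
move=> AB Ay; have /subspace_continuousP := ch => /(_ y (AB _ Ay)).
apply: cvg_trans; apply: cvg_app => W WA.
have {}WA : nbhs y (fun z => open_ball3 z -> W z) := WA.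
change (nbhs y (fun z => A z -> W z)).
by apply: filterS WA => z zW /AB; apply: zW.
Qed.

(* A boundary point can be pushed off itself: composing the chart with the push
   gives a map of the box that fixes its boundary and misses its centre. *)
Lemma no_push (p : 'rV[R]_n) (V : 'rV[R]_n -> 'rV[R]_n) e : U p -> 0 < e -> continuous V ->
  (forall P t, U P -> ball p e P -> 0 <= t < e -> U (P + t *: V P)) ->
  (forall P t, U P -> ball p e P -> 0 <= t < e -> P + t *: V P = p -> t = 0) -> False.
Proof.
move=> Up e0 cV VU Vp; have [d [d0 dB dp]] := chart_box Up e0.
set c := g p in dB dp; pose Q := cbox c d.
have cB : open_ball3 c by exact: gU.
have Qin y : Q y -> U (h y) /\ ball p e (h y) by move=> Qy; split; [apply/hB/dB|exact: dp].
(* [s i] is 1 at the centre and 0 on the two sides in direction [i]. Hence the pushing time [tau]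
   vanishes on the boundary of the box and equals [e / 2], safely below [e], at the centre. *)
pose s (i : 'I_3) (y : 'rV[R]_3) := 1 - ((y ord0 i - c ord0 i) / d) ^+ 2.
pose i0 : 'I_3 := inord 0; pose i1 : 'I_3 := inord 1; pose i2 : 'I_3 := inord 2.
pose tau y := e / 2 * (s i0 y * (s i1 y * s i2 y)).
have s01 i y : Q y -> 0 <= s i y <= 1.
  move=> /(_ i) yi; rewrite /s; set r := _ / d.
  have : `|r| <= 1 by rewrite normrM normfV (gtr0_norm d0) ler_pdivrMr // mul1r.
  by rewrite ler_norml => /andP[? ?]; apply/andP; split; nra.
have tau01 y : Q y -> 0 <= tau y < e.
  move=> Qy; have /andP[? ?] := s01 i0 y Qy; have /andP[? ?] := s01 i1 y Qy.
  have /andP[? ?] := s01 i2 y Qy; have e20 : 0 <= e / 2 by rewrite divr_ge0 // ltW.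
  apply/andP; split; first by apply: mulr_ge0 => //; apply: mulr_ge0 => //; apply: mulr_ge0.
  have le : e / 2 * (s i0 y * (s i1 y * s i2 y)) <= e / 2.
    by rewrite ler_piMr // mulr_ile1 ?mulr_ge0 // mulr_ile1.
  by apply: le_lt_trans le _; rewrite gtr_pMr // invf_lt1 ?ltr1n.
have i3 (i : 'I_3) : [\/ i = i0, i = i1 | i = i2].
  by case: i => [[|[|[|]]] //= ?]; [apply: Or31|apply: Or32|apply: Or33]; apply/val_inj; rewrite /= inordK.
have tau0 i (y : 'rV[R]_3) : `|y ord0 i - c ord0 i| = d -> tau y = 0.
  move=> yi; have si : s i y = 0.
    rewrite /s -real_normK ?num_real // normrM normfV (gtr0_norm d0) yi divff ?gt_eqF //.
    by rewrite expr1n subrr.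
  by rewrite /tau; case: (i3 i) si => -> ->; rewrite ?(mul0r, mulr0).
pose G y := h y + tau y *: V (h y).
have GU y : Q y -> U (G y) by move=> Qy; have [? ?] := Qin y Qy; apply: VU => //; exact: tau01.
pose F y := g (G y).
pose low i y := F y ord0 i <= c ord0 i.
have Fb i (y : 'rV[R]_3) : Q y -> `|y ord0 i - c ord0 i| = d -> F y = y.
  by move=> Qy /tau0 t0; rewrite /F /G t0 scale0r addr0 hK //; exact: dB.
have [||y Qy ky] := @kkm3 R c d low d0.
- move=> i y Qy yi; rewrite /low (Fb i) // yi; first by rewrite gerBl ltW.
  by rewrite addrAC subrr sub0r normrN gtr0_norm.
- move=> i y Qy yi; rewrite /low (Fb i) // yi; first by rewrite -ltNge ltrDl.
  by rewrite addrAC subrr add0r gtr0_norm.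
have cG : G z @[z --> within Q (nbhs y)] --> G y.
  have ch' := chart_cvg dB Qy.
  apply: cvgD => //; apply: cvgZ; last first.
    by apply: cvg_comp ch' _; apply: cV.
  have cs i : s i z @[z --> within Q (nbhs y)] --> s i y.
    apply: cvg_within_filter; apply: cvgB; first exact: cvg_cst.
    rewrite /= !expr2; apply: cvgM; apply: cvgM; try exact: cvg_cst;
    by apply: cvgB; [exact: coord_cvg|exact: cvg_cst].
  by apply: cvgM; [exact: cvg_cst|apply: cvgM => //; apply: cvgM].
have cF e' : 0 < e' -> exists2 r, 0 < r & forall z, Q z -> ball y r z -> ball (F y) e' (F z).
  move=> e'0; have [r r0 Hr] := within_continuous_ball cg (GU y Qy) e'0.
  have : nbhs (G y) (ball (G y) r) by exact: nbhsx_ballx.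
  move=> /cG; rewrite /= /within /= => /nbhs_ballP[r' r'0 Hr'].
  by exists r' => // z Qz zb; apply: Hr; [exact: GU|exact: Hr'].
(* Arbitrarily near [y] the [i]-th coordinate of [F] takes values on both sides of that of [c], so
   continuity puts it at [c]. *)
have Fc i : F y ord0 i = c ord0 i.
  apply/eqP; rewrite -subr_eq0 -normr_le0; apply/ler_addgt0Pr => e' e'0; rewrite add0r.
  have [r r0 Hr] := cF _ e'0.
  have [y0 [y1 [y2 [y3 [[[Q0 b0] [Q1 b1] [Q2 b2] [Q3 b3]] [l0 /andP[l1 l1'] /and3P[_ l2 l2'] /and3P[l30 l31 l32]]]]]]] := ky r r0.
  have [_ /(_ ord0 i) k0] := Hr _ Q0 b0.
  have [_ /(_ ord0 i) k1] := Hr _ Q1 b1.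
  have [_ /(_ ord0 i) k2] := Hr _ Q2 b2.
  have [_ /(_ ord0 i) k3] := Hr _ Q3 b3.
  have [z0 [z1 [Fz0 Fz1 kz0 kz1]]] : exists z0 z1, [/\ F z0 ord0 i <= c ord0 i, c ord0 i < F z1 ord0 i,
      `|F y ord0 i - F z0 ord0 i| < e' & `|F y ord0 i - F z1 ord0 i| < e'].
    move: l0 l1' l2' l30 l31 l32; rewrite /low -!ltNge.
    case: (i3 i) k0 k1 k2 k3 => -> k0 k1 k2 k3 l0 l1' l2' l30 l31 l32.
    - by exists y0, y3.
    - by exists y1, y3.
    - by exists y2, y3.
  move: kz0 kz1; rewrite !ltr_distl => /andP[? ?] /andP[? ?].
  by rewrite ler_distl; apply/andP; split; lra.
have FyC : F y = c by apply/rowP => i; rewrite Fc.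
have Gp : G y = p by rewrite -(gK (GU y Qy)) -/(F y) FyC gK.
have [Uy By] := Qin y Qy.
(* Reaching [p] takes time 0, so [h y] is already [p] and [y] is the centre; but there the pushing
   time is positive. *)
have t0 := Vp _ _ Uy By (tau01 y Qy) Gp.
have yc : y = c.
  by move: Gp; rewrite /G t0 scale0r addr0 => hy; rewrite -[y]hK ?hy //; exact: dB.
move: t0; rewrite yc /tau /s !subrr !mul0r expr2 mul0r !subr0 !mulr1 => /eqP.
by rewrite gt_eqF // divr_gt0.
Qed.
End Chart.

(** * Brick tilings of the plane *)

Section Brick.
Variable R : realType.

(* Rows of unit bricks, each row shifted by half a brick with respect to the next one. *)
Definition brick (a t : R) : int * int :=
  let j := Num.floor t in
  (j, Num.floor (a + if (j %% 2)%Z == 0 then 0 else 2^-1)).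

Lemma floor_two (x y : R) : x <= y -> y < x + 1 ->
  Num.floor y = Num.floor x \/ Num.floor y = Num.floor x + 1.
Proof.
move=> xy yx; have /andP[x1 x2] := floor_itv x.
have [lt|ge] := ltP y (Num.floor x + 1)%:~R; [left|right]; apply: floor_def.
  by rewrite lt andbT (le_trans x1).
rewrite ge /=; apply: lt_trans yx _; rewrite intrD; lra.
Qed.

(** A window of side 1/4 meets at most two adjacent rows. Their vertical joints lie at integers and
    at half-integers respectively, so in one of these rows the window has no joint and meets a
    single brick; in the other it meets at most two. *)
Lemma brick_order3 (a t : R) (p0 p1 p2 p3 : R * R) :
  (forall p, p \in [:: p0; p1; p2; p3] -> `|a - p.1| < 8^-1 /\ `|t - p.2| < 8^-1) ->
  ~~ uniq [seq brick p.1 p.2 | p <- [:: p0; p1; p2; p3]].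
Proof.
move=> H; apply/negP => un.
pose j := Num.floor (t - 8^-1).
pose off (j : int) : R := if (j %% 2)%Z == 0 then 0 else 2^-1.
suff [s [s3 sin]] : exists s : seq (int * int), size s = 3%N /\
    forall p, p \in [:: p0; p1; p2; p3] -> brick p.1 p.2 \in s.
  have sub : {subset [seq brick p.1 p.2 | p <- [:: p0; p1; p2; p3]] <= s}.
    by move=> b /mapP[p pin ->]; apply: sin.
  by have := uniq_leq_size un sub; rewrite size_map s3.
have row p : p \in [:: p0; p1; p2; p3] -> Num.floor p.2 = j \/ Num.floor p.2 = j + 1.
  move=> /H[_]; rewrite ltr_distl => /andP[? ?]; apply: floor_two; lra.
have col p c : p \in [:: p0; p1; p2; p3] ->
    Num.floor (p.1 + c) = Num.floor (a - 8^-1 + c) \/ Num.floor (p.1 + c) = Num.floor (a - 8^-1 + c) + 1.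
  move=> /H[+ _]; rewrite ltr_distl => /andP[? ?]; apply: floor_two; lra.
have [c0 [c01 [m cm]]] : exists c0, (c0 = off j \/ c0 = off (j + 1)) /\
    exists m, forall p, p \in [:: p0; p1; p2; p3] -> Num.floor (p.1 + c0) = m.
  suff [c0 c01 cm] : exists2 c0, c0 = 0 \/ c0 = 2^-1 & exists m, forall p, p \in [:: p0; p1; p2; p3] -> Num.floor (p.1 + c0) = m.
    exists c0; split=> //; rewrite /off.
    have [e|e] := eqVneq (j %% 2)%Z 0; have [e'|e'] := eqVneq ((j + 1) %% 2)%Z 0; first lia; last lia.
      by case: c01; auto.
    by case: c01; auto.
  pose k := Num.floor (a - 8^-1); have /andP[k1 k2] := floor_itv (a - 8^-1).
  rewrite -/k intrD in k1 k2.
  (* Either the window contains no integer in its interior, or it does and is too short to contain a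
     half-integer as well. *)
  have [le|gt] := leP (a + 8^-1) (k%:~R + 1).
    exists 0; first by left.
    exists k => p /H[+ _]; rewrite ltr_distl addr0 => /andP[? ?]; apply: floor_def.
    by rewrite intrD; apply/andP; split; lra.
  exists 2^-1; first by right.
  exists (k + 1) => p /H[+ _]; rewrite ltr_distl => /andP[? ?]; apply: floor_def.
  by rewrite !intrD; apply/andP; split; lra.
have brickE p : brick p.1 p.2 = (Num.floor p.2, Num.floor (p.1 + off (Num.floor p.2))) by [].
case: c01 => e.
  pose m' := Num.floor (a - 8^-1 + off (j + 1)).
  exists [:: (j, m); (j + 1, m'); (j + 1, m' + 1)]; split=> // p pin; rewrite brickE !inE.
  case: (row p pin) => ->; first by rewrite -e cm // eqxx.
  by case: (col p (off (j + 1)) pin) => ->; rewrite eqxx ?orbT.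
pose m' := Num.floor (a - 8^-1 + off j).
exists [:: (j + 1, m); (j, m'); (j, m' + 1)]; split=> // p pin; rewrite brickE !inE.
case: (row p pin) => ->; last by rewrite -e cm // eqxx.
by case: (col p (off j) pin) => ->; rewrite eqxx ?orbT.
Qed.
End Brick.

(** * No open piece of a three-dimensional chart injects into the plane *)

Section Planar.
Variable R : realType.
Variables (n : nat) (U : set 'rV[R]_n) (g : 'rV[R]_n -> 'rV[R]_3) (h : 'rV[R]_3 -> 'rV[R]_n).
Hypothesis gU : forall p, U p -> open_ball3 (g p).
Hypothesis hB : forall y, open_ball3 y -> U (h y).
Hypothesis gK : forall p, U p -> h (g p) = p.
Hypothesis hK : forall y, open_ball3 y -> g (h y) = y.
Hypothesis cg : {within U, continuous g}.
Hypothesis ch : {within @open_ball3 R, continuous h}.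

(* Lebesgue's covering argument: label a point of the box through its brick. A
   point near which all four labels occur would be near four distinct bricks. *)
Lemma no_planar_chart (p : 'rV[R]_n) (f1 f2 : 'rV[R]_n -> R) e :
  U p -> 0 < e -> continuous f1 -> continuous f2 ->
  (forall P P', U P -> U P' -> ball p e P -> ball p e P' -> f1 P = f1 P' -> f2 P = f2 P' -> P = P') ->
  False.
Proof.
move=> Up e0 cf1 cf2 inj; have [d [d0 dB dp]] := chart_box gU gK ch Up e0.
set c := g p in dB dp; pose Q := cbox c d.
have FF (y : 'rV[R]_3) : Filter (nbhs y) := nbhs_filter y.
have Qin y : Q y -> U (h y) /\ ball p e (h y) by move=> Qy; split; [apply/hB/dB|exact: dp].
pose F1 y := f1 (h y); pose F2 y := f2 (h y).
have cF (f : 'rV[R]_n -> R) y : continuous f -> Q y ->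
    f (h z) @[z --> within Q (nbhs y)] --> f (h y).
  by move=> cf Qy; apply: cvg_comp (chart_cvg ch dB Qy) _; apply: cf.
have cFb (f : 'rV[R]_n -> R) y : continuous f -> Q y -> forall r, 0 < r ->
    exists2 s, 0 < s & forall z, Q z -> ball y s z -> `|f (h y) - f (h z)| < r.
  move=> cf Qy r r0; have : nbhs (f (h y)) (ball (f (h y)) r) by exact: nbhsx_ballx.
  move=> /(cF f y cf Qy) H.
  have {}H : nbhs y (fun z => Q z -> ball (f (h y)) r (f (h z))) := H.
  by move/nbhs_ballP: H => [s s0 H]; exists s => // z Qz yz; apply: H.
(* Uniform continuity of the inverse of the injection [(F1, F2)]: otherwise pairs of points at
   distance at least [d] with ever closer images would accumulate at two points with the same
   image. *)
have [m m0 fine] : exists2 m : nat, (0 < m)%N & forall y z, Q y -> Q z ->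
    `|F1 y - F1 z| < m%:R^-1 -> `|F2 y - F2 z| < m%:R^-1 -> forall i, `|y ord0 i - z ord0 i| < d.
  apply: contrapT => no.
  have /choice[b bP] : forall k : nat, exists yz : 'rV[R]_3 * 'rV[R]_3, [/\ Q yz.1, Q yz.2,
      `|F1 yz.1 - F1 yz.2| < k.+1%:R^-1, `|F2 yz.1 - F2 yz.2| < k.+1%:R^-1 &
      exists i, d <= `|yz.1 ord0 i - yz.2 ord0 i|].
    move=> k; apply: contrapT => no'; apply: no; exists k.+1 => // y z Qy Qz h1 h2 i.
    by rewrite ltNge; apply/negP => di; apply: no'; exists (y, z); split=> //; exists i.
  have Qb : (b @ \oo) (Q `*` Q) by exists 0%N => // k _; case: (bP k).
  have [[y z] [[/= Qy Qz] yzb]] := compact_setX (@cbox_compact R c d) (@cbox_compact R c d) _ Qb.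
  have near r : 0 < r -> forall N, exists k, [/\ (N <= k)%N, ball y r (b k).1 & ball z r (b k).2].
    move=> r0 N.
    have A : (b @ \oo) [set b k | k in [set k | (N <= k)%N]] by exists N => // k /= Nk; exists k.
    have B : nbhs (y, z) [set w | ball y r w.1 /\ ball z r w.2].
      by exists (ball y r, ball z r) => //; split; exact: nbhsx_ballx.
    by have [_ [[k /= Nk <-] [? ?]]] := yzb _ _ A B; exists k.
  have same (f : 'rV[R]_n -> R) : continuous f ->
      (forall k, `|f (h (b k).1) - f (h (b k).2)| < k.+1%:R^-1) -> f (h y) = f (h z).
    move=> cf fb; apply/eqP; rewrite -subr_eq0 -normr_le0; apply/ler_addgt0Pr => r r0; rewrite add0r.
    have r30 : 0 < r / 3 by rewrite divr_gt0.
    have [s1 s10 H1] := cFb f y cf Qy _ r30; have [s2 s20 H2] := cFb f z cf Qz _ r30.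
    have [N _ HN] := near_infty_natSinv_lt (PosNum r30).
    have m1 : Num.min s1 s2 <= s1 by rewrite ge_min lexx.
    have m2 : Num.min s1 s2 <= s2 by rewrite ge_min lexx orbT.
    have m0 : 0 < Num.min s1 s2 by rewrite lt_min s10.
    have [k [Nk b1 b2]] := near _ m0 N.
    have [Q1 Q2 _ _ _] := bP k.
    have := H1 _ Q1 (le_ball m1 b1).
    have := H2 _ Q2 (le_ball m2 b2).
    have := HN k Nk; rewrite /= => kr.
    have := lt_trans (fb k) kr.
    rewrite !ltr_norml => /andP[? ?] /andP[? ?] /andP[? ?].
    by rewrite ler_norml; apply/andP; split; lra.
  have yz : y = z.
    have [Uy By] := Qin y Qy; have [Uz Bz] := Qin z Qz.
    rewrite -(hK (dB _ Qy)) -(hK (dB _ Qz)); congr (g _); apply: inj => //.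
    - by apply: same => // k; case: (bP k).
    - by apply: same => // k; case: (bP k).
  have d20 : 0 < d / 2 by rewrite divr_gt0.
  have [k [_ b1 b2]] := near _ d20 0%N.
  have [q1 q2 q3 q4 q5] := bP k; case: q5 => i; rewrite leNgt => /negP; apply.
  have [_ /(_ ord0 i) k1] := b1; have [_ /(_ ord0 i) k2] := b2.
  move: k1 k2; rewrite yz /ball /= !ltr_norml => /andP[? ?] /andP[? ?].
  by apply/andP; split; lra.
pose b y := brick (F1 y * m%:R) (F2 y * m%:R).
(* One point of the box is chosen for each brick, so that [low] depends on the brick only. The
   default is never reached for [y] in [Q], since [y] is itself a candidate. *)
pose rep y := xget 0 [set z | Q z /\ b z = b y].
have repP y : Q y -> Q (rep y) /\ b (rep y) = b y.
  by move=> Qy; apply: (@xgetPex _ 0 [set z | Q z /\ b z = b y]); exists y.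
have mR0 : 0 < m%:R :> R by rewrite ltr0n.
have rep_near y i : Q y -> `|y ord0 i - rep y ord0 i| < d.
  move=> Qy; have [Qr br] := repP y Qy.
  have fl (u v : R) : Num.floor u = Num.floor v -> `|v - u| < 1.
    move=> uv; have /andP[u1 u2] := floor_itv u; have /andP[v1 v2] := floor_itv v.
    by rewrite uv in u1 u2; rewrite !intrD in u2 v2; rewrite ltr_norml; apply/andP; split; lra.
  have sc (u v : R) : `|v * m%:R - u * m%:R| < 1 -> `|v - u| < m%:R^-1.
    by rewrite -mulrBl normrM (gtr0_norm mR0) -ltr_pdivlMr // mul1r.
  move: br; rewrite /b /brick => -[br2]; rewrite br2 => br1; apply: fine => //; apply: sc; last exact: fl.
  have := fl _ _ br1; rewrite ltr_norml => /andP[? ?].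
  by rewrite ltr_norml; apply/andP; split; lra.
pose low i y := rep y ord0 i <= c ord0 i.
have [||y Qy ky] := @kkm3 R c d low d0.
- by move=> i y Qy yi; have := rep_near y i Qy; rewrite yi /low ltr_distl => /andP[? ?]; lra.
- by move=> i y Qy yi; have := rep_near y i Qy; rewrite yi /low ltr_distl => /andP[? ?]; rewrite -ltNge; lra.
(* The bricks have size [1 / m], so this is the tolerance 1/8 of [brick_order3] after rescaling. *)
have r0 : 0 < 8^-1 / m%:R :> R by rewrite divr_gt0.
have [s1 s10 H1] := cFb f1 y cf1 Qy _ r0; have [s2 s20 H2] := cFb f2 y cf2 Qy _ r0.
have s0 : 0 < Num.min s1 s2 by rewrite lt_min s10.
have [y0 [y1 [y2 [y3 [[[Q0 b0] [Q1 b1] [Q2 b2] [Q3 b3]] [l0 /andP[l1 l1'] /and3P[l2 l2' l2''] /and3P[l3 l3' l3'']]]]]]] := ky _ s0.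
pose pr z := (F1 z * m%:R, F2 z * m%:R).
have cl z : Q z -> ball y (Num.min s1 s2) z ->
    `|F1 y * m%:R - (pr z).1| < 8^-1 /\ `|F2 y * m%:R - (pr z).2| < 8^-1.
  move=> Qz yz; rewrite /= -!mulrBl !normrM (gtr0_norm mR0) -!ltr_pdivlMr //; split.
    by apply: H1 => //; apply: le_ball yz; rewrite ge_min lexx.
  by apply: H2 => //; apply: le_ball yz; rewrite ge_min lexx orbT.
have low_b i u v : low i u -> ~~ low i v -> b u != b v.
  move=> lu; apply: contraNneq => uv; rewrite /low.
  by rewrite /rep -uv.
have := @brick_order3 R (F1 y * m%:R) (F2 y * m%:R) (pr y0) (pr y1) (pr y2) (pr y3).
case/(_ _)/negP.
  by move=> q; rewrite !inE => /or4P[] /eqP ->; apply: cl.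
rewrite /= !inE !negb_or -!/(b _).
by rewrite (low_b _ _ _ l0 l1) (low_b _ _ _ l0 l2) (low_b _ _ _ l0 l3) (low_b _ _ _ l1' l2')
  (low_b _ _ _ l1' l3') (low_b _ _ _ l2'' l3'').
Qed.
End Planar.

(** * Local structure of the realization *)

Section Coordinates.
Variables (T0 : seq quad) (fl : seq flip) (R : realType).
Local Notation N := (kN T0 fl).
Local Notation kd := (kdelta T0 fl R).
Local Notation face_pt := (@face_pt T0 fl R).
Local Notation cube_pt := (@cube_pt T0 fl R).
Local Notation K := (kverts T0 fl).

Definition co (P : 'rV[R]_N) (u : nat) : R := P ord0 (@inord (\max_(u <- K) u) u).

Lemma co_kdelta u w : u \in K -> co (kd w) u = (u == w)%:R.
Proof.
move=> uK; rewrite /co mxE inordK // ltnS.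
by rewrite (big_rem u uK) /= leq_max leqnn.
Qed.

Lemma coD P Q u : co (P + Q) u = co P u + co Q u. Proof. by rewrite /co mxE. Qed.

Lemma coZ k P u : co (k *: P) u = k * co P u. Proof. by rewrite /co mxE. Qed.

Lemma co_cvg u P : co Q u @[Q --> P] --> co P u.
Proof. exact: coord_cvg. Qed.

Lemma co_ball e u P Q : ball P e Q -> `|co P u - co Q u| < e.
Proof. by case=> _; apply. Qed.

Lemma co_face q s t u : u \in K -> co (face_pt q s t) u =
  (1 - s) * (1 - t) * (u == qv q 0)%:R + s * (1 - t) * (u == qv q 1)%:R
  + s * t * (u == qv q 2)%:R + (1 - s) * t * (u == qv q 3)%:R.
Proof. by move=> uK; rewrite /Defs.face_pt !coD !coZ !co_kdelta. Qed.

Definition weight (t1 t2 t3 : R) (e : bool * bool * bool) : R :=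
  (if e.1.1 then t1 else 1 - t1) * (if e.1.2 then t2 else 1 - t2) * (if e.2 then t3 else 1 - t3).

Lemma co_cube f t1 t2 t3 u : u \in K -> co (cube_pt f t1 t2 t3) u =
  \sum_(e : bool * bool * bool | cv f e.1.1 e.1.2 e.2 == u) weight t1 t2 t3 e.
Proof.
move=> uK; rewrite /Defs.cube_pt /co summxE [RHS]big_mkcond /=; apply: eq_bigr => e _.
have := coZ (weight t1 t2 t3 e) (kd (cv f e.1.1 e.1.2 e.2)) u.
by rewrite co_kdelta // eq_sym /co => ->; case: ifP; rewrite ?mulr1 ?mulr0.
Qed.

Lemma co_cube_corner f t1 t2 t3 e : uniq (flip_verts f) -> cv f e.1.1 e.1.2 e.2 \in K ->
  co (cube_pt f t1 t2 t3) (cv f e.1.1 e.1.2 e.2) = weight t1 t2 t3 e.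
Proof.
move=> un uK; rewrite co_cube // (big_pred1 e) // => e' /=.
by apply/eqP/eqP => [/(cv_inj un)|->].
Qed.

(** A cube seen as a prism over its face [q]: the corners of the opposite face [q'] are listed in
    matching order, and [r] is the height above [q]. *)
Definition box_pt q q' s t r := (1 - r) *: face_pt q s t + r *: face_pt q' s t.

Definition faceset q : set 'rV[R]_N :=
  [set P | exists s t, [/\ unit_interval s, unit_interval t & P = face_pt q s t]].

Definition boxset q q' : set 'rV[R]_N :=
  [set P | exists s t r, [/\ unit_interval s, unit_interval t, unit_interval r & P = box_pt q q' s t r]].

Definition cubeset f : set 'rV[R]_N :=
  [set P | exists t1 t2 t3, [/\ unit_interval t1, unit_interval t2, unit_interval t3 &
     P = cube_pt f t1 t2 t3]].

Lemma unit_intervalC (t : R) : unit_interval t -> unit_interval (1 - t).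
Proof. by move=> /andP[? ?]; apply/andP; split; lra. Qed.

Lemma face_pt_rot a b c d s t : face_pt (b, c, d, a) s t = face_pt (a, b, c, d) (1 - t) s.
Proof. by apply/rowP => j; rewrite !mxE /qv /=; ring. Qed.

Lemma face_pt_refl a b c d s t : face_pt (a, d, c, b) s t = face_pt (a, b, c, d) t s.
Proof. by apply/rowP => j; rewrite !mxE /qv /=; ring. Qed.

Lemma boxset_rot a b c d a' b' c' d' :
  boxset (b, c, d, a) (b', c', d', a') = boxset (a, b, c, d) (a', b', c', d').
Proof.
apply/seteqP; split=> P [s [t [r [hs ht hr ->]]]].
  exists (1 - t), s, r; split=> //; first exact: unit_intervalC.
  by rewrite /box_pt (face_pt_rot a b c d) (face_pt_rot a' b' c' d').
exists t, (1 - s), r; split=> //; first exact: unit_intervalC.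
by rewrite /box_pt (face_pt_rot a b c d) (face_pt_rot a' b' c' d') subKr.
Qed.

Lemma boxset_refl a b c d a' b' c' d' :
  boxset (a, d, c, b) (a', d', c', b') = boxset (a, b, c, d) (a', b', c', d').
Proof.
apply/seteqP; split=> P [s [t [r [hs ht hr ->]]]].
  by exists t, s, r; split=> //; rewrite /box_pt (face_pt_refl a b c d) (face_pt_refl a' b' c' d').
by exists t, s, r; split=> //; rewrite /box_pt (face_pt_refl a b c d) (face_pt_refl a' b' c' d').
Qed.

Lemma faceset_rot a b c d : faceset (b, c, d, a) = faceset (a, b, c, d).
Proof.
apply/seteqP; split=> P [s [t [hs ht ->]]].
  by exists (1 - t), s; split=> //; [exact: unit_intervalC|rewrite (face_pt_rot a b c d)].
exists t, (1 - s); split=> //; first exact: unit_intervalC.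
by rewrite (face_pt_rot a b c d) subKr.
Qed.

Lemma faceset_refl a b c d : faceset (a, d, c, b) = faceset (a, b, c, d).
Proof.
by apply/seteqP; split=> P [s [t [hs ht ->]]]; exists t, s; split=> //; rewrite (face_pt_refl a b c d).
Qed.

Lemma same_face_set q q' : same_face q q' -> faceset q = faceset q'.
Proof.
rewrite same_faceE; case: q => [[[a b] c] d]; rewrite !inE.
move=> /orP[|/orP[|/orP[|/orP[|/orP[|/orP[|/orP[|]]]]]]] /eqP-> //.
- by rewrite [RHS]faceset_rot.
- by rewrite [RHS]faceset_rot [RHS]faceset_rot.
- by rewrite [RHS]faceset_rot [RHS]faceset_rot [RHS]faceset_rot.
- by rewrite faceset_refl.
- by rewrite -[LHS]faceset_rot [RHS]faceset_refl.
- by rewrite -[LHS]faceset_rot -[LHS]faceset_rot [RHS]faceset_refl.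
- by rewrite -[LHS]faceset_rot -[LHS]faceset_rot -[LHS]faceset_rot [RHS]faceset_refl.
Qed.

(** Whatever rotates or reverses the base of the prism must be applied to the opposite face too. *)
Lemma same_face_boxset q q' G : same_face q G -> exists2 G', boxset q q' = boxset G G' & perm_eq (qverts q') (qverts G').
Proof.
rewrite same_faceE; case: q q' => [[[a b] c] d] [[[a' b'] c'] d']; rewrite !inE.
have P u v w x u' v' w' x' : (forall z, count_mem z [:: u; v; w; x] = count_mem z [:: u'; v'; w'; x']) ->
  perm_eq [:: u; v; w; x] [:: u'; v'; w'; x'].
  by move=> H; apply/allP => z _; apply/eqP; apply: H.
move=> /orP[|/orP[|/orP[|/orP[|/orP[|/orP[|/orP[|]]]]]]] /eqP->.
- by exists (a', b', c', d').
- exists (b', c', d', a'); first by rewrite [RHS]boxset_rot.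
  by apply: P => z /=; lia.
- exists (c', d', a', b'); first by rewrite [RHS]boxset_rot [RHS]boxset_rot.
  by apply: P => z /=; lia.
- exists (d', a', b', c'); first by rewrite [RHS]boxset_rot [RHS]boxset_rot [RHS]boxset_rot.
  by apply: P => z /=; lia.
- exists (a', d', c', b'); first by rewrite boxset_refl.
  by apply: P => z /=; lia.
- exists (b', a', d', c'); first by rewrite -[LHS]boxset_rot [RHS]boxset_refl.
  by apply: P => z /=; lia.
- exists (c', b', a', d'); first by rewrite -[LHS]boxset_rot -[LHS]boxset_rot [RHS]boxset_refl.
  by apply: P => z /=; lia.
- exists (d', c', b', a'); first by rewrite -[LHS]boxset_rot -[LHS]boxset_rot -[LHS]boxset_rot [RHS]boxset_refl.
  by apply: P => z /=; lia.
Qed.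

Lemma sum_corners (V : nmodType) (F : bool * bool * bool -> V) : \sum_e F e =
  F (true, true, true) + F (true, true, false) + (F (true, false, true) + F (true, false, false))
  + (F (false, true, true) + F (false, true, false) + (F (false, false, true) + F (false, false, false))).
Proof.
under eq_bigr => -[[i j] k] _ do rewrite -[(i, j, k)]/((i, j), k).
rewrite (eq_bigr (fun p => (fun q k => F (q, k)) p.1 p.2)); last by case.
rewrite -(pair_bigA _ (fun q k => F (q, k))) /=.
rewrite (eq_bigr (fun p => (fun i j => \sum_k F (i, j, k)) p.1 p.2)); last by case.
by rewrite -(pair_bigA _ (fun i j => \sum_k F (i, j, k))) /= !big_bool.
Qed.

Lemma cubeset_box f G : G \in old_quads f ++ new_quads f ->
  exists2 G', cubeset f = boxset G G' & perm_eq (qverts G ++ qverts G') (flip_verts f).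
Proof.
have U := @unit_intervalC.
have P s : (forall z, count_mem z s = count_mem z (flip_verts f)) -> perm_eq s (flip_verts f).
  by move=> H; apply/allP => z _; apply/eqP; apply: H.
rewrite !inE => /or4P[|||/or3P[]] /eqP->.
- exists (fa1 f, fa2 f, fv f, fa6 f); last by apply: P => z /=; lia.
  apply/seteqP; split=> p.
    move=> [t1 [t2 [t3 [h1 h2 h3 ->]]]]; exists t2, t3, t1; split=> //.
    by rewrite /Defs.cube_pt sum_corners; apply/rowP => j; rewrite !mxE /qv /=; ring.
  move=> [s [t [r [h1 h2 h3 ->]]]]; exists r, s, t; split=> //.
  by rewrite /Defs.cube_pt sum_corners; apply/rowP => j; rewrite !mxE /qv /=; ring.
- exists (fa3 f, fa4 f, fv f, fa2 f); last by apply: P => z /=; lia.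
  apply/seteqP; split=> p.
    move=> [t1 [t2 [t3 [h1 h2 h3 ->]]]]; exists t3, t1, t2; split=> //.
    by rewrite /Defs.cube_pt sum_corners; apply/rowP => j; rewrite !mxE /qv /=; ring.
  move=> [s [t [r [h1 h2 h3 ->]]]]; exists t, r, s; split=> //.
  by rewrite /Defs.cube_pt sum_corners; apply/rowP => j; rewrite !mxE /qv /=; ring.
- exists (fa5 f, fa6 f, fv f, fa4 f); last by apply: P => z /=; lia.
  apply/seteqP; split=> p.
    move=> [t1 [t2 [t3 [h1 h2 h3 ->]]]]; exists t1, t2, t3; split=> //.
    by rewrite /Defs.cube_pt sum_corners; apply/rowP => j; rewrite !mxE /qv /=; ring.
  move=> [s [t [r [h1 h2 h3 ->]]]]; exists s, t, r; split=> //.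
  by rewrite /Defs.cube_pt sum_corners; apply/rowP => j; rewrite !mxE /qv /=; ring.
(* The new faces are listed from the top corner, hence all three parameters are reversed. *)
- exists (fa4 f, fa5 f, fw f, fa3 f); last by apply: P => z /=; lia.
  apply/seteqP; split=> p.
    move=> [t1 [t2 [t3 [h1 h2 h3 ->]]]]; exists (1 - t2), (1 - t3), (1 - t1); split; try exact: U.
    by rewrite /Defs.cube_pt sum_corners; apply/rowP => j; rewrite !mxE /qv /=; ring.
  move=> [s [t [r [h1 h2 h3 ->]]]]; exists (1 - r), (1 - s), (1 - t); split; try exact: U.
  by rewrite /Defs.cube_pt sum_corners; apply/rowP => j; rewrite !mxE /qv /=; ring.
- exists (fa6 f, fa1 f, fw f, fa5 f); last by apply: P => z /=; lia.
  apply/seteqP; split=> p.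
    move=> [t1 [t2 [t3 [h1 h2 h3 ->]]]]; exists (1 - t3), (1 - t1), (1 - t2); split; try exact: U.
    by rewrite /Defs.cube_pt sum_corners; apply/rowP => j; rewrite !mxE /qv /=; ring.
  move=> [s [t [r [h1 h2 h3 ->]]]]; exists (1 - t), (1 - r), (1 - s); split; try exact: U.
  by rewrite /Defs.cube_pt sum_corners; apply/rowP => j; rewrite !mxE /qv /=; ring.
- exists (fa2 f, fa3 f, fw f, fa1 f); last by apply: P => z /=; lia.
  apply/seteqP; split=> p.
    move=> [t1 [t2 [t3 [h1 h2 h3 ->]]]]; exists (1 - t1), (1 - t2), (1 - t3); split; try exact: U.
    by rewrite /Defs.cube_pt sum_corners; apply/rowP => j; rewrite !mxE /qv /=; ring.
  move=> [s [t [r [h1 h2 h3 ->]]]]; exists (1 - s), (1 - t), (1 - r); split; try exact: U.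
  by rewrite /Defs.cube_pt sum_corners; apply/rowP => j; rewrite !mxE /qv /=; ring.
Qed.
End Coordinates.

(** * Which cells reach a generic point of a face *)

Definition corners : seq (bool * bool * bool) :=
  let o := false in let i := true in
  [:: (o, o, o); (o, o, i); (o, i, o); (o, i, i); (i, o, o); (i, o, i); (i, i, o); (i, i, i)].

Lemma mem_corners e : e \in corners.
Proof. by case: e => [[[] []] []]. Qed.

(** Coordinates exchanged between two corners according to the mask [m]. Exchanging them in both
    directions preserves the product of the two trilinear weights. *)
Definition mix (m e e' : bool * bool * bool) :=
  (if m.1.1 then e.1.1 else e'.1.1, if m.1.2 then e.1.2 else e'.1.2, if m.2 then e.2 else e'.2).

Definition corner_faces : seq ((bool * bool * bool) * (bool * bool * bool) * (bool * bool * bool) * (bool * bool * bool)) :=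
  let o := false in let i := true in
  [:: ((o, o, o), (o, i, o), (o, i, i), (o, o, i)); ((o, o, o), (o, o, i), (i, o, i), (i, o, o));
      ((o, o, o), (i, o, o), (i, i, o), (o, i, o)); ((i, i, i), (i, o, i), (i, o, o), (i, i, o));
      ((i, i, i), (i, i, o), (o, i, o), (o, i, i)); ((i, i, i), (o, i, i), (o, o, i), (i, o, i))].

(** What can be said of four cube corners taken as a quadruple in cyclic order. If they are distinct
    and do not form a face, either some exchange of coordinates leaves the set, or the two sides of
    one of the strict inequalities of [near_face] have equal weight products. All quadruples are
    checked by computation. *)
Definition corner_check ea eb ec ed :=
  let s := [:: ea; eb; ec; ed] in
  [|| ~~ uniq s, has (fun F => (ea, eb, ec, ed) \in face_orbit F) corner_faces,
      has (fun m => has (fun e => has (fun e' => mix m e e' \notin s) s) s) corners,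
      has (fun m => perm_eq [:: mix m ea eb; mix m eb ea] [:: ec; ed]) corners |
      has (fun m => perm_eq [:: mix m ea ed; mix m ed ea] [:: eb; ec]) corners].

Lemma corner_checkP ea eb ec ed : corner_check ea eb ec ed.
Proof.
have : all (fun ea => all (fun eb => all (fun ec => all (corner_check ea eb ec) corners) corners) corners) corners.
  by vm_compute.
by move=> /allP/(_ _ (mem_corners ea))/allP/(_ _ (mem_corners eb))/allP/(_ _ (mem_corners ec))
  /allP/(_ _ (mem_corners ed)).
Qed.

Section Local.
Variables (T0 : seq quad) (fl : seq flip) (R : realType).
Local Notation N := (kN T0 fl).
Local Notation face_pt := (@face_pt T0 fl R).
Local Notation cube_pt := (@cube_pt T0 fl R).
Local Notation K := (kverts T0 fl).
Local Notation co := (@co T0 fl R).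

(* Open conditions, satisfied by points of the face q near its corner [qv q 0],
   which exclude all cells that do not have q as a face. *)
Definition near_face (q : quad) (P : 'rV[R]_N) : Prop :=
  [/\ forall x, x \in qverts q -> 0 < co P x,
      co P (qv q 2) * co P (qv q 3) < co P (qv q 0) * co P (qv q 1),
      co P (qv q 1) * co P (qv q 2) < co P (qv q 0) * co P (qv q 3) &
      forall u x y, u \in K -> u \notin qverts q -> x \in qverts q -> y \in qverts q ->
        co P u < co P x * co P y].

Lemma weight_mix (t1 t2 t3 : R) m e e' :
  weight t1 t2 t3 e * weight t1 t2 t3 e' = weight t1 t2 t3 (mix m e e') * weight t1 t2 t3 (mix m e' e).
Proof. by case: m => [[[] []] []]; rewrite /weight /=; ring. Qed.

Lemma weight01 (t1 t2 t3 : R) e : unit_interval t1 -> unit_interval t2 -> unit_interval t3 ->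
  0 <= weight t1 t2 t3 e <= 1.
Proof.
move=> h1 h2 h3; have C (b : bool) (t : R) : unit_interval t -> 0 <= (if b then t else 1 - t) <= 1.
  by move=> h; case: b => //; exact: unit_intervalC.
have /andP[a1 b1] := C e.1.1 _ h1; have /andP[a2 b2] := C e.1.2 _ h2.
have /andP[a3 b3] := C e.2 _ h3.
by rewrite /weight !mulr_ge0 //= mulr_ile1 ?mulr_ge0 // mulr_ile1.
Qed.

(** Positive coordinates force the vertices of [q] to be corners of the cube. An exchange leaving
    them would give a vertex outside [q] a coordinate at least the product of two coordinates of
    [q], since weights are at most 1; the equalities of products contradict the strict
    inequalities. *)
Lemma near_face_cube q f t1 t2 t3 : unit_interval t1 -> unit_interval t2 -> unit_interval t3 ->
  uniq (flip_verts f) -> {subset flip_verts f <= K} -> uniq (qverts q) -> {subset qverts q <= K} ->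
  near_face q (cube_pt f t1 t2 t3) -> has (same_face q) (old_quads f ++ new_quads f).
Proof.
move=> h1 h2 h3 un fK; case: q => [[[a b] c] d] uq qK [pos AB AD far].
have cvK e : cv f e.1.1 e.1.2 e.2 \in K.
  by apply: fK; case: e => [[[] []] []]; rewrite !inE eqxx ?orbT.
have cor x : x \in qverts (a, b, c, d) -> exists e, x = cv f e.1.1 e.1.2 e.2.
  move=> xq; have := pos x xq; rewrite co_cube ?qK //.
  have [e /eqP <- _|no] := pickP (fun e => cv f e.1.1 e.1.2 e.2 == x); first by exists e.
  by rewrite big_pred0 // ltxx.
have [ea Ea] := cor a (ltac:(by rewrite !inE eqxx ?orbT)).
have [eb Eb] := cor b (ltac:(by rewrite !inE eqxx ?orbT)).
have [ec Ec] := cor c (ltac:(by rewrite !inE eqxx ?orbT)).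
have [ed Ed] := cor d (ltac:(by rewrite !inE eqxx ?orbT)).
pose s := [:: ea; eb; ec; ed]; pose g e := cv f e.1.1 e.1.2 e.2.
pose w := weight t1 t2 t3.
have qs : qverts (a, b, c, d) = map g s by rewrite /qverts /qv /= Ea Eb Ec Ed.
have ginj : injective g by move=> e e'; exact: cv_inj.
have cow e : co (cube_pt f t1 t2 t3) (g e) = w e by apply: co_cube_corner.
rewrite /qv /= Ea Eb Ec Ed -!/(g _) !cow in AB AD.
have := corner_checkP ea eb ec ed; rewrite /corner_check -/s.
have us : uniq s by rewrite -(map_inj_uniq ginj) -qs.
have w2 e e' : \prod_(i <- [:: e; e']) w i = w e * w e' by rewrite !big_cons big_nil mulr1.
case/or4P => [|/hasP[F Fc qF]| /hasP[m _ /hasP[e es /hasP[e' e's mx]]]|/orP[/hasP[m _ pm]| /hasP[m _ pm]]].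
- by rewrite us.
- pose g4 (F : (bool * bool * bool) * (bool * bool * bool) * (bool * bool * bool) * (bool * bool * bool)) :=
    (g F.1.1.1, g F.1.1.2, g F.1.2, g F.2).
  apply/hasP; exists (g4 F).
    by move: Fc; rewrite /corner_faces !inE => /or4P[|||/or3P[]] /eqP->; rewrite eqxx ?orbT.
  suff : same_face (g4 F) (a, b, c, d) by rewrite same_face_sym.
  rewrite same_faceE.
  have -> : face_orbit (g4 F) = map g4 (face_orbit F) by case: (F) => [[[x y] z] t].
  by apply/mapP; exists (ea, eb, ec, ed); rewrite // /g4 /= /g -Ea -Eb -Ec -Ed.
- have := far (g (mix m e e')) (g e) (g e') (cvK _); rewrite qs !mem_map // !cow.
  move=> /(_ mx es e's); rewrite /w (weight_mix _ _ _ m) => lt.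
  have /andP[w0 _] := weight01 (mix m e e') h1 h2 h3.
  have /andP[_ w1] := weight01 (mix m e' e) h1 h2 h3.
  have := ler_piMr w0 w1; lra.
- have : w ea * w eb = w ec * w ed.
    by rewrite /w (weight_mix _ _ _ m) -!w2 (perm_big _ pm).
  by lra.
- have : w ea * w ed = w eb * w ec.
    by rewrite /w (weight_mix _ _ _ m) -!w2 (perm_big _ pm).
  by lra.
Qed.

(** On a face the coordinates have equal products along the two diagonals. The two inequalities of
    [near_face] exclude this for every pairing of the vertices of [q] other than its own diagonals,
    so [q'] has the same cyclic order. *)
Lemma near_face_face q q' s t : uniq (qverts q) -> {subset qverts q <= K} ->
  uniq (qverts q') -> {subset qverts q' <= K} -> near_face q (face_pt q' s t) -> same_face q q'.
Proof.
move=> uq qK uq' q'K [pos AB AD _].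
have sub : {subset qverts q <= qverts q'}.
  move=> x xq; have := pos x xq; rewrite co_face ?qK //; apply: contraTT => xq'.
  move: xq'; rewrite !inE !negb_or => /and4P[/negPf-> /negPf-> /negPf-> /negPf->].
  by rewrite !mulr0 !addr0 ltxx.
have prodE : co (face_pt q' s t) (qv q' 0) * co (face_pt q' s t) (qv q' 2) =
    co (face_pt q' s t) (qv q' 1) * co (face_pt q' s t) (qv q' 3).
  case: q' uq' q'K {sub pos AB AD} => [[[a b] c] d] uq' q'K.
  have k u : u \in qverts (a, b, c, d) -> u \in K by exact: q'K.
  rewrite !co_face ?k ?inE ?eqxx ?orbT // /qv /=.
  move: uq'; rewrite /qverts /qv /= !inE !negb_or !andbT -!andbA.
  move=> /and5P[/negPf n1 /negPf n2 /negPf n3 /negPf n4 /andP[/negPf n5 /negPf n6]].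
  rewrite ?eqxx (eq_sym b a) (eq_sym c a) (eq_sym d a) ?(eq_sym c b) ?(eq_sym d b) ?(eq_sym d c) ?n1 ?n2 ?n3 ?n4 ?n5 ?n6 ?mulr0 ?addr0 ?add0r ?mulr1.
  by ring.
move: prodE AB AD sub uq; set P := face_pt q' s t; clearbody P.
clear uq' q'K pos; case: q' => [[[a' b'] c'] d']; case: q qK => [[[a b] c] d] _.
rewrite /qv /= => prodE AB AD sub.
have := (sub a, sub b, sub c, sub d).
rewrite /qverts /qv /= !inE !eqxx !orbT /= => -[[[ha hb] hc] hd].
rewrite same_faceE /= !inE !negb_or !andbT -!andbA => /and5P[n1 n2 n3 n4 /andP[n5 n6]].
move: (ha isT) (hb isT) (hc isT) (hd isT) prodE AB AD n1 n2 n3 n4 n5 n6 => {ha hb hc hd sub}.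
move=> /or4P[] /eqP-> /or4P[] /eqP->; rewrite ?eqxx //;
move=> /or4P[] /eqP->; rewrite ?eqxx //;
move=> /or4P[] /eqP->; rewrite ?eqxx ?orbT // => *; exfalso; lra.
Qed.
End Local.

(** * Vertices on a face of at most one cube *)

Section NotInterior.
Variables (T0 : seq quad) (fl : seq flip) (R : realType).
Local Notation N := (kN T0 fl).
Local Notation face_pt := (@face_pt T0 fl R).
Local Notation K := (kverts T0 fl).
Local Notation co := (@co T0 fl R).
Local Notation F := (nth flip0 fl).
Local Notation n := (size fl).
Local Notation bpt := (@box_pt T0 fl R).
Hypothesis face_uniq : forall q, q \in kfaces T0 fl -> uniq (qverts q).
Hypothesis face_sub : forall q, q \in kfaces T0 fl -> {subset qverts q <= K}.
Hypothesis flip_un : forall i, (i < n)%N -> uniq (flip_verts (F i)).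
Hypothesis flip_sub : forall i, (i < n)%N -> {subset flip_verts (F i) <= K}.

Lemma pos_near m (f : 'rV[R]_m -> R) p : continuous f -> 0 < f p ->
  exists2 e, 0 < e & forall P, ball p e P -> 0 < f P.
Proof.
move=> cf fp; have H : nbhs (f p) [set z | 0 < z] := lt_nbhsr fp.
by have /nbhs_ballP[e e0 H'] := cf p _ H; exists e.
Qed.

Lemma qverts_qv q j : (j < 4)%N -> qv q j \in qverts q.
Proof. by case: j => [|[|[|[|]]]] //= _; rewrite !inE eqxx ?orbT. Qed.

Lemma co_face_corners q s t : uniq (qverts q) -> {subset qverts q <= K} ->
  [/\ co (face_pt q s t) (qv q 0) = (1 - s) * (1 - t), co (face_pt q s t) (qv q 1) = s * (1 - t),
      co (face_pt q s t) (qv q 2) = s * t & co (face_pt q s t) (qv q 3) = (1 - s) * t].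
Proof.
move=> uq qK; rewrite !co_face; try by apply: qK; apply: qverts_qv.
move: uq; case: q qK => [[[a b] c] d] _; rewrite /qverts /qv /= !inE !negb_or !andbT -!andbA.
move=> /and5P[/negPf n1 /negPf n2 /negPf n3 /negPf n4 /andP[/negPf n5 /negPf n6]].
rewrite ?eqxx (eq_sym b a) (eq_sym c a) (eq_sym d a) (eq_sym c b) (eq_sym d b) (eq_sym d c) n1 n2 n3 n4 n5 n6.
by rewrite ?mulr0 ?mulr1 ?addr0 ?add0r.
Qed.

Lemma near_face_nbhs q s t : uniq (qverts q) -> {subset qverts q <= K} ->
  0 < s < 2^-1 -> 0 < t < 2^-1 ->
  exists2 e, 0 < e & forall P, ball (face_pt q s t) e P -> near_face q P.
Proof.
move=> uq qK /andP[s0 s1] /andP[t0 t1]; set p := face_pt q s t.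
have [pa pb pc pd] := co_face_corners s t uq qK.
have [a1 a0 b1 b0] : [/\ 0 < 1 - s - s, 0 < s, 0 < 1 - t - t & 0 < t] by split; lra.
have cont (f1 f2 f3 f4 : nat) : continuous (fun P => co P f1 * co P f2 - co P f3 * co P f4).
  move=> P; have c := @co_cvg T0 fl R _ P.
  exact: (cvgB (cvgM (c f1) (c f2)) (cvgM (c f3) (c f4))).
have [|e1 e10 H1] := @pos_near _ _ p (cont (qv q 0) (qv q 1) (qv q 2) (qv q 3)).
  rewrite pa pb pc pd (_ : _ - _ = s * (1 - s) * (1 - t - t)); last by ring.
  by rewrite !mulr_gt0 //; lra.
have [|e2 e20 H2] := @pos_near _ _ p (cont (qv q 0) (qv q 3) (qv q 1) (qv q 2)).
  rewrite pa pb pc pd (_ : _ - _ = t * (1 - t) * (1 - s - s)); last by ring.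
  by rewrite !mulr_gt0 //; lra.
(* Since [s] and [t] are below 1/2, [C] is the least of the four corner coordinates of [p]. Within
   [e3] of [p] they stay above [C / 2], while all others stay below $e_3=(C/2)^2$. *)
pose C := s * t; have C0 : 0 < C by rewrite mulr_gt0.
have C1 : C <= 1 by rewrite mulr_ile1 //; lra.
pose e3 := C ^+ 2 / 4.
have e30 : 0 < e3 by rewrite divr_gt0 // exprn_gt0.
exists (Num.min e3 (Num.min e1 e2)) => [|P PB]; first by rewrite !lt_min e10 e20 e30.
have B3 : ball p e3 P by apply: le_ball PB; rewrite ge_min lexx.
have B1 : ball p e1 P by apply: le_ball PB; rewrite !ge_min lexx orbT.
have B2 : ball p e2 P by apply: le_ball PB; rewrite !ge_min lexx !orbT.
have big x : x \in qverts q -> C / 2 < co P x.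
  move=> xq; have := co_ball x B3; rewrite ltr_distl => /andP[_ lt].
  have Cx : C <= co p x.
    move: xq; rewrite !inE => /or4P[] /eqP->; rewrite ?pa ?pb ?pc ?pd /C; nra.
  have : e3 <= C / 2 by rewrite /e3 expr2; nra.
  lra.
split=> [x xq|||u x y uK uq' xq yq].
- by apply: lt_trans (big x xq); rewrite divr_gt0.
- by rewrite -subr_gt0; apply: H1.
- by rewrite -subr_gt0; apply: H2.
- have pu : co p u = 0.
    rewrite co_face //; move: uq'; rewrite !inE !negb_or => /and4P[/negPf-> /negPf-> /negPf-> /negPf->].
    by rewrite !mulr0 !addr0.
  have := co_ball u B3; rewrite pu sub0r normrN => /(le_lt_trans (ler_norm _)) lt.
  apply: lt_le_trans lt _; have bx := big x xq; have by' := big y yq.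
  have -> : e3 = C / 2 * (C / 2) by rewrite /e3 expr2; field.
  by apply: ler_pM; rewrite ?ltW // divr_gt0.
Qed.

Lemma local_structure q P : q \in kfaces T0 fl -> @realization T0 fl R P -> forall q1, same_face q q1 ->
  near_face q1 P -> @faceset T0 fl R q1 P \/
  exists2 i, (i < n)%N & has (same_face q1) (old_quads (F i) ++ new_quads (F i)) /\
     @cubeset T0 fl R (F i) P.
Proof.
move=> qk XP q1 qq1 nP.
have u1 : uniq (qverts q1) by apply: same_face_uniq qq1 (face_uniq qk).
have s1 : {subset qverts q1 <= K} by move=> x; rewrite -(same_face_verts qq1); exact: face_sub.
case: XP => [[u uK Pu]|[[q' [s [t [q'k hs ht Pq']]]]|[i [t1 [t2 [t3 [i_n h1 h2 h3 PC]]]]]]].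
- case: nP => pos _ _ _; exfalso.
  have := pos _ (@qverts_qv q1 0%N isT); have := pos _ (@qverts_qv q1 1%N isT).
  rewrite Pu !co_kdelta; try by apply: s1; apply: qverts_qv.
  case: eqP => [<-|_]; last by rewrite ltxx.
  move: u1; rewrite /= inE negb_or => /andP[/andP[/negPf ne _] _].
  by rewrite ne ltxx.
- left; rewrite Pq' in nP.
  have sf := near_face_face u1 s1 (face_uniq q'k) (face_sub q'k) nP.
  by rewrite (same_face_set T0 fl R sf); exists s, t.
- right; exists i => //; split; last by exists t1, t2, t3.
  by rewrite PC in nP; apply: near_face_cube nP; auto.
Qed.

Lemma rotate_to v q : v \in qverts q -> exists2 q1, same_face q q1 & qv q1 0 = v.
Proof.
case: q => [[[a b] c] d]; rewrite !inE /qv /= => /or4P[] /eqP->.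
- by exists (a, b, c, d); rewrite // same_face_refl.
- by exists (b, c, d, a); rewrite // same_faceE !inE eqxx ?orbT.
- by exists (c, d, a, b); rewrite // same_faceE !inE eqxx ?orbT.
- by exists (d, a, b, c); rewrite // same_faceE !inE eqxx ?orbT.
Qed.

Lemma faceset_realization q : q \in kfaces T0 fl -> @faceset T0 fl R q `<=` @realization T0 fl R.
Proof. by move=> qk P [s [t [hs ht ->]]]; right; left; exists q, s, t. Qed.

Lemma cubeset_realization i : (i < n)%N -> @cubeset T0 fl R (F i) `<=` @realization T0 fl R.
Proof. by move=> i_n P [t1 [t2 [t3 [h1 h2 h3 ->]]]]; right; right; exists i, t1, t2, t3. Qed.

(** Every neighbourhood of a vertex of a face contains a point of that face to which
    [near_face_nbhs] applies. *)
Lemma face_pt_near_corner q e : 0 < e -> exists2 s, 0 < s < 2^-1 & ball (kdelta T0 fl R (qv q 0)) e (face_pt q s s).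
Proof.
move=> e0; pose s := Num.min 4^-1 (e / 8).
have s0 : 0 < s by rewrite lt_min divr_gt0 // invr_gt0 ltr0n.
have s4 : s <= 4^-1 by rewrite ge_min lexx.
have se : s <= e / 8 by rewrite ge_min lexx orbT.
exists s; first by rewrite s0 /=; lra.
apply/rV_ballP => // j; rewrite !mxE.
have w1 : 0 <= s * (1 - s) <= s by apply/andP; split; nra.
have w2 : 0 <= s * s <= s by apply/andP; split; nra.
have w0 : (1 - s) * (1 - s) = 1 - s - s * (1 - s) by ring.
have w3 : (1 - s) * s = s * (1 - s) by ring.
rewrite w0 w3; move: w1 w2; set x := s * (1 - s); set y := s * s => /andP[? ?] /andP[? ?].
rewrite ltr_norml.
by case: (_ == _); case: (_ == _); case: (_ == _); case: (_ == _); rewrite /= ?mulr1 ?mulr0; apply/andP; split; lra.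
Qed.

Lemma co_box q q' s t r u : co (bpt q q' s t r) u = (1 - r) * co (face_pt q s t) u + r * co (face_pt q' s t) u.
Proof. by rewrite /box_pt coD !coZ. Qed.

Lemma co_face_out q s t u : u \in K -> u \notin qverts q -> co (face_pt q s t) u = 0.
Proof.
move=> uK; rewrite co_face // !inE !negb_or => /and4P[/negPf-> /negPf-> /negPf-> /negPf->].
by rewrite !mulr0 !addr0.
Qed.

Section Box.
Variables q q' : quad.
Hypothesis qq_uniq : uniq (qverts q ++ qverts q').
Hypothesis qq_sub : {subset qverts q ++ qverts q' <= K}.

(** Linear forms which recover the prism coordinates. Being defined on the whole space, they extend
    the pushing direction continuously beyond the prism, as [no_push] requires. *)
Definition box_s (P : 'rV[R]_N) := co P (qv q 1) + co P (qv q 2) + (co P (qv q' 1) + co P (qv q' 2)).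
Definition box_t (P : 'rV[R]_N) := co P (qv q 2) + co P (qv q 3) + (co P (qv q' 2) + co P (qv q' 3)).
Definition box_r (P : 'rV[R]_N) := co P (qv q' 0) + co P (qv q' 1) + (co P (qv q' 2) + co P (qv q' 3)).

Lemma box_coords s t r :
  [/\ box_s (bpt q q' s t r) = s, box_t (bpt q q' s t r) = t & box_r (bpt q q' s t r) = r].
Proof.
move: (qq_uniq); rewrite cat_uniq => /and3P[uq /hasPn disj uq'].
have qK : {subset qverts q <= K} by move=> x xq; apply: qq_sub; rewrite mem_cat xq.
have q'K : {subset qverts q' <= K} by move=> x xq; apply: qq_sub; rewrite mem_cat xq orbT.
have [a1 a2 a3 a4] := co_face_corners s t uq qK.
have [b1 b2 b3 b4] := co_face_corners s t uq' q'K.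
have o' j : (j < 4)%N -> co (face_pt q s t) (qv q' j) = 0.
  by move=> j4; apply: co_face_out; [apply/q'K/qverts_qv|apply/disj/qverts_qv].
have o j : (j < 4)%N -> co (face_pt q' s t) (qv q j) = 0.
  move=> j4; apply: co_face_out; first by apply/qK/qverts_qv.
  by apply/negP => /disj; rewrite qverts_qv.
by rewrite /box_s /box_t /box_r !co_box !o ?o' // a2 a3 a4 b1 b2 b3 b4; split; ring.
Qed.

Lemma box_s_cvg : continuous box_s.
Proof.
move=> P; have c := @co_cvg T0 fl R _ P.
exact: (cvgD (cvgD (c _) (c _)) (cvgD (c _) (c _))).
Qed.

Lemma box_t_cvg : continuous box_t.
Proof.
move=> P; have c := @co_cvg T0 fl R _ P.
exact: (cvgD (cvgD (c _) (c _)) (cvgD (c _) (c _))).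
Qed.

Lemma box_r_cvg : continuous box_r.
Proof.
move=> P; have c := @co_cvg T0 fl R _ P.
exact: (cvgD (cvgD (c _) (c _)) (cvgD (c _) (c _))).
Qed.

Lemma face_cvg G : continuous (fun P => face_pt G (box_s P) (box_t P)).
Proof.
move=> P; have FF : Filter (nbhs P) := nbhs_filter P.
have s := box_s_cvg (x:=P); have t := box_t_cvg (x:=P).
have s' : 1 - box_s z @[z --> P] --> 1 - box_s P by exact: (cvgB (cvg_cst _) s).
have t' : 1 - box_t z @[z --> P] --> 1 - box_t P by exact: (cvgB (cvg_cst _) t).
have k (f : 'rV[R]_N -> R) j : f z @[z --> P] --> f P ->
    f z *: kdelta T0 fl R j @[z --> P] --> f P *: kdelta T0 fl R j.
  by move=> cf; exact: (cvgZr_tmp cf).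
have k0 := k _ (qv G 0) (cvgM s' t' : (1 - box_s z) * (1 - box_t z) @[z --> P] --> (1 - box_s P) * (1 - box_t P)).
have k1 := k _ (qv G 1) (cvgM s t' : box_s z * (1 - box_t z) @[z --> P] --> box_s P * (1 - box_t P)).
have k2 := k _ (qv G 2) (cvgM s t : box_s z * box_t z @[z --> P] --> box_s P * box_t P).
have k3 := k _ (qv G 3) (cvgM s' t : (1 - box_s z) * box_t z @[z --> P] --> (1 - box_s P) * box_t P).
have k03 := cvgD (cvgD (cvgD (k0 FF) (k1 FF)) (k2 FF)) (k3 FF).
exact: (k03 FF).
Qed.

(** The derivative of [box_pt] in the height [r]. *)
Definition push P := face_pt q' (box_s P) (box_t P) - face_pt q (box_s P) (box_t P).

Lemma push_cvg : continuous push.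
Proof. by move=> P; exact: (cvgB (@face_cvg q' P) (@face_cvg q P)). Qed.

Lemma push_box s t r x : bpt q q' s t r + x *: push (bpt q q' s t r) = bpt q q' s t (r + x).
Proof.
have [e1 e2 _] := box_coords s t r; rewrite /push e1 e2 /box_pt.
by apply/rowP => j; rewrite !mxE; ring.
Qed.

End Box.

Lemma not_interior v q : q \in kfaces T0 fl -> v \in qverts q ->
  (forall i j, (i < n)%N -> (j < n)%N ->
     has (same_face q) (old_quads (F i) ++ new_quads (F i)) ->
     has (same_face q) (old_quads (F j) ++ new_quads (F j)) -> i = j) ->
  ~ interior_vertex T0 fl R v.
Proof.
move=> qk vq one [vK [W [oO Ov H]]]; case: H => g [h [gU hB gK hK [cg ch]]].
have [q1 qq1 q1v] := rotate_to vq.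
have u1 : uniq (qverts q1) by apply: same_face_uniq qq1 (face_uniq qk).
have s1 : {subset qverts q1 <= K} by move=> x; rewrite -(same_face_verts qq1); exact: face_sub.
have hasE i : has (same_face q1) (old_quads (F i) ++ new_quads (F i)) =
    has (same_face q) (old_quads (F i) ++ new_quads (F i)).
  apply: eq_has => x; apply/idP/idP; first exact: same_face_trans.
  by apply: same_face_trans; rewrite same_face_sym.
have [e0 e00 He0] : exists2 e, 0 < e & ball (kdelta T0 fl R v) e `<=` W.
  by move: oO; rewrite openE => /(_ _ Ov)/nbhs_ballP[e e0 H]; exists e.
have [s s0 sb] := face_pt_near_corner q1 e00.
pose p := face_pt q1 s s.
have Op : W p by apply: He0; rewrite -q1v.
have us : unit_interval s by move: s0 => /andP[? ?]; apply/andP; split; lra.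
have Up : (W `&` @realization T0 fl R) p.
  by split=> //; apply: (faceset_realization qk); rewrite (same_face_set T0 fl R qq1); exists s, s.
have [e1 e10 H1] := near_face_nbhs u1 s1 s0 s0.
have loc P : @realization T0 fl R P -> ball p e1 P -> @faceset T0 fl R q1 P \/
  exists2 i, (i < n)%N & has (same_face q1) (old_quads (F i) ++ new_quads (F i)) /\
     @cubeset T0 fl R (F i) P.
  by move=> XP /H1; apply: (local_structure qk XP).
have [[i i_n hi]|none] := EM (exists2 i, (i < n)%N & has (same_face q1) (old_quads (F i) ++ new_quads (F i))); last first.
  have fs P : @realization T0 fl R P -> ball p e1 P -> @faceset T0 fl R q1 P.
    by move=> XP PB; case: (loc P XP PB) => // -[i i_n [hi _]]; case: none; exists i.
  have c := @co_cvg T0 fl R.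
  (* On the face these two sums are its parameters [s] and [t], so they separate its points. *)
  pose f1 (P : 'rV[R]_N) := co P (qv q1 1) + co P (qv q1 2).
  pose f2 (P : 'rV[R]_N) := co P (qv q1 2) + co P (qv q1 3).
  apply: (@no_planar_chart R _ _ g h gU hB gK hK ch p f1 f2 e1 Up e10).
  - by move=> P; exact: (cvgD (c _ P) (c _ P)).
  - by move=> P; exact: (cvgD (c _ P) (c _ P)).
  move=> P P' [_ XP] [_ XP'] /(fs _ XP)[a [b [_ _ ->]]] /(fs _ XP')[a' [b' [_ _ ->]]].
  have [_ k1 k2 k3] := co_face_corners a b u1 s1; have [_ l1 l2 l3] := co_face_corners a' b' u1 s1.
  rewrite /f1 /f2 k1 k2 k3 l1 l2 l3 => E1 E2.
  have aa : a = a' by lra.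
  have bb : b = b' by lra.
  by rewrite aa bb.
have [G G6 q1G] := hasP hi.
have [G' cubeE GG'] := cubeset_box T0 fl R G6.
have Gq1 : same_face G q1 by rewrite same_face_sym.
have [q' boxE q'G'] := same_face_boxset T0 fl R G' Gq1.
have qqP : perm_eq (qverts q1 ++ qverts q') (flip_verts (F i)).
  apply: perm_trans GG'; rewrite perm_sym; apply: perm_cat => //.
  apply: uniq_perm => //; first exact: same_face_uniq q1G u1.
  exact: same_face_verts.
have qqu : uniq (qverts q1 ++ qverts q') by rewrite (perm_uniq qqP); exact: flip_un.
have qqs : {subset qverts q1 ++ qverts q' <= K}.
  by move=> x; rewrite (perm_mem qqP); exact: flip_sub.
have box P : @realization T0 fl R P -> ball p e1 P -> @boxset T0 fl R q1 q' P.
  move=> XP PB; case: (loc P XP PB) => [[a [b [ha hb ->]]]|[j j_n [hj]]].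
    exists a, b, 0; split=> //; first by apply/andP; split; lra.
    by rewrite /box_pt subr0 scale1r scale0r addr0.
  have -> : j = i by apply: one => //; rewrite -hasE.
  by rewrite cubeE boxE.
have pE : p = bpt q1 q' s s 0 by rewrite /box_pt subr0 scale1r scale0r addr0.
have rp : box_r q' p = 0 by have [_ _] := box_coords qqu qqs s s 0; rewrite pE.
(* Pushed points must also remain in the open set [W], which follows from joint continuity at
   [(p, 0)]. *)
have [d d0 Hd] : exists2 d, 0 < d & forall P x, ball p d P -> 0 <= x < d -> W (P + x *: push q1 q' P).
  have FF : Filter (nbhs (p, 0 : R)) := nbhs_filter _.
  have c1 : z.1 @[z --> nbhs (p, 0 : R)] --> p by exact: cvg_fst.
  have c2 : z.2 @[z --> nbhs (p, 0 : R)] --> (0 : R) by exact: cvg_snd.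
  have c3 : push q1 q' z.1 @[z --> nbhs (p, 0 : R)] --> push q1 q' p.
    exact: cvg_comp c1 (@push_cvg q1 q' p).
  have cP : z.1 + z.2 *: push q1 q' z.1 @[z --> nbhs (p, 0 : R)] --> p + 0 *: push q1 q' p.
    exact: (cvgD c1 (cvgZ c2 c3)).
  rewrite scale0r addr0 in cP; have := cP W.
  move=> /(_ (open_nbhs_nbhs (conj oO Op)))[[A B] /= [/nbhs_ballP[a a0 Ha] /nbhs_ballP[b b0 Hb]] HO].
  exists (Num.min a b); first by rewrite lt_min a0.
  move=> P x PB /andP[x0 xd]; apply: (HO (P, x)); split=> /=.
    by apply: Ha; apply: le_ball PB; rewrite ge_min lexx.
  apply: Hb; rewrite /ball /= sub0r normrN ger0_norm //.
  by apply: lt_le_trans xd _; rewrite ge_min lexx orbT.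
(* A point of height below 1/2, pushed up by less than 1/2, stays in the prism. *)
have [e2 e20 H2] : exists2 e2, 0 < e2 & forall P, ball p e2 P -> 0 < 2^-1 - box_r q' P.
  apply: pos_near; last by rewrite rp subr0 invr_gt0 ltr0n.
  by move=> P; exact: (cvgB (cvg_cst _) (@box_r_cvg q' P)).
pose e := Num.min (Num.min e1 e2) (Num.min d 2^-1).
have ee1 : e <= e1 by rewrite /e !ge_min lexx.
have ee2 : e <= e2 by rewrite /e !ge_min lexx ?orbT.
have eed : e <= d by rewrite /e !ge_min lexx ?orbT.
have eeh : e <= 2^-1 by rewrite /e !ge_min lexx ?orbT.
have e0' : 0 < e by rewrite !lt_min e10 e20 d0 invr_gt0 ltr0n.
apply: (@no_push R _ _ g h gU hB gK hK cg ch p (push q1 q') e Up e0').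
- exact: push_cvg.
- move=> P x [OP XP] PB /andP[x0 xe]; split.
    by apply: Hd; [exact: le_ball PB|rewrite x0 (lt_le_trans xe)].
  have [a [b [r [ha hb hr PE]]]] := box P XP (le_ball ee1 PB).
  have := H2 P (le_ball ee2 PB); have [_ _] := box_coords qqu qqs a b r; rewrite -PE => -> rh.
  rewrite PE push_box //; apply: (cubeset_realization i_n); rewrite cubeE boxE.
  by exists a, b, (r + x); split=> //; move: hr => /andP[? ?]; apply/andP; split; lra.
(* Pushing only raises the height, which is nonnegative on the prism and zero at [p]. *)
- move=> P x [OP XP] PB /andP[x0 xe].
  have [a [b [r [ha hb /andP[r0 _] PE]]]] := box P XP (le_ball ee1 PB).
  rewrite PE push_box // => /(congr1 (box_r q')).
  by rewrite rp; have [_ _ ->] := box_coords qqu qqs a b (r + x); lra.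
Qed.

End NotInterior.

(** * The twisted K-hexahedron equations *)

Section CubeAlgebra.
Variables (R : realType).
Local Notation C := R[i].
Variables (z : bool -> bool -> bool -> C) (X Y Z u : C).
Local Notation o := false.
Local Notation i := true.
Local Notation w := (z o o o).

Definition cubeA := 2 * z i o o * z o i o * z o o i
   + w * (z i o o * z o i i + z o i o * z i o i + z o o i * z i i o).

Hypothesis w0 : w != 0.
Hypothesis uE : u = 1 \/ u = -1.
Hypothesis XE : X ^+ 2 = w * z o i i + z o i o * z o o i.
Hypothesis YE : Y ^+ 2 = w * z i o i + z o o i * z i o o.
Hypothesis ZE : Z ^+ 2 = w * z i i o + z i o o * z o i o.
Hypothesis tE : z i i i = (cubeA + 2 * u * X * Y * Z) / w ^+ 2.

Definition twist_x := (u * Y * Z + X * z i o o) / w.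
Definition twist_y := (u * X * Z + Y * z o i o) / w.
Definition twist_z := (u * X * Y + Z * z o o i) / w.

(** Eliminating the three middle vertices leaves [X], [Y], [Z], the bottom vertex and its neighbours
    as free variables, so the identities below become identities of rational functions, one for each
    sign [u]. *)
Let aE : z o i i = (X ^+ 2 - z o i o * z o o i) / w. Proof. by rewrite XE; field. Qed.
Let bE : z i o i = (Y ^+ 2 - z o o i * z i o o) / w. Proof. by rewrite YE; field. Qed.
Let cE : z i i o = (Z ^+ 2 - z i o o * z o i o) / w. Proof. by rewrite ZE; field. Qed.

Lemma twist_x_sqr : twist_x ^+ 2 = z i i i * z i o o + z i o i * z i i o.
Proof. by rewrite /twist_x tE /cubeA aE bE cE; case: uE => ->; field. Qed.

Lemma twist_y_sqr : twist_y ^+ 2 = z i i i * z o i o + z i i o * z o i i.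
Proof. by rewrite /twist_y tE /cubeA aE bE cE; case: uE => ->; field. Qed.

Lemma twist_z_sqr : twist_z ^+ 2 = z i i i * z o o i + z o i i * z i o i.
Proof. by rewrite /twist_z tE /cubeA aE bE cE; case: uE => ->; field. Qed.

Lemma twist_KC : KC z = 0.
Proof. by rewrite /KC tE /cubeA aE bE cE; case: uE => ->; field. Qed.

Definition face_at (old new : C) (b : bool) := if b then new else old.

Lemma twist_KCv (e : bool * bool * bool) : KCv z e.1.1 e.1.2 e.2 =
  (if e \in [:: (o, o, o); (i, i, i)] then 1 else -1) * u *
  (face_at X twist_x e.1.1 * face_at Y twist_y e.1.2 * face_at Z twist_z e.2).
Proof.
case: e => [[[] []] []]; rewrite /KCv /face_at /=; rewrite /twist_x /twist_y /twist_z tE /cubeA aE bE cE; by case: uE => ->; field.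
Qed.

End CubeAlgebra.

(** * Generic solutions *)

Section PolyFun.
Variable K : numClosedFieldType.

(** Polynomials in the values at the vertices [V], kept as functions. Substituting univariate
    polynomials for the values, as in [polyfun_poly], suffices to work with them. *)
Inductive polyfun (V : pred nat) : ((nat -> K) -> K) -> Prop :=
| polyfun_cst c : polyfun V (fun=> c)
| polyfun_var u : V u -> polyfun V (fun x => x u)
| polyfun_add f g : polyfun V f -> polyfun V g -> polyfun V (fun x => f x + g x)
| polyfun_mul f g : polyfun V f -> polyfun V g -> polyfun V (fun x => f x * g x).

Lemma polyfun_poly V f (X : nat -> {poly K}) : polyfun V f ->
  exists p : {poly K}, forall c, p.[c] = f (fun u => (X u).[c]).
Proof.
elim=> {f} [c|u _|f g _ [p hp] _ [q hq]|f g _ [p hp] _ [q hq]].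
- by exists c%:P => d; rewrite hornerC.
- by exists (X u).
- by exists (p + q) => c; rewrite hornerD hp hq.
- by exists (p * q) => c; rewrite hornerM hp hq.
Qed.

Lemma polyfun_local V f x y : polyfun V f -> (forall u, V u -> x u = y u) -> f x = f y.
Proof.
move=> pf xy; elim: pf => {f} [c|u /xy|f g _ -> _ ->|f g _ -> _ ->] //.
Qed.

Lemma poly_nonroot (p : {poly K}) : p != 0 -> exists c, p.[c] != 0.
Proof.
move=> p0; apply: contrapT => no.
have : all (root p) [seq k%:R | k <- iota 0 (size p)].
  by apply/allP => _ /mapP[k _ ->]; apply/negPn/negP => r; apply: no; exists k%:R.
move=> /(max_poly_roots p0); rewrite size_map size_iota ltnn; case/(_ _)/negP => //.
by rewrite map_inj_uniq ?iota_uniq // => a b /eqP; rewrite eqr_nat => /eqP.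
Qed.

Definition nzpoly V f := polyfun V f /\ exists x, f x != 0.

(** On the line joining a point where [f] does not vanish to one where [g] does not, both are
    nonzero univariate polynomials, and so is their product. *)
Lemma nzpoly_mul V f g : nzpoly V f -> nzpoly V g -> nzpoly V (fun x => f x * g x).
Proof.
move=> [pf [x fx]] [pg [y gy]]; split; first exact: polyfun_mul.
pose X u := (x u)%:P + (y u - x u) *: 'X : {poly K}.
have X0 : (fun u => (X u).[0]) = x by apply/funext => u; rewrite /X !hornerE.
have X1 : (fun u => (X u).[1]) = y by apply/funext => u; rewrite hornerD hornerC hornerZ hornerX mulr1 addrC subrK.
have [p hp] := polyfun_poly X pf; have [q hq] := polyfun_poly X pg.
have [c pqc] : exists c, (p * q).[c] != 0.
  apply: poly_nonroot; rewrite mulf_eq0 negb_or; apply/andP; split.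
    by apply: contraNneq fx => p0; rewrite -X0 -hp p0 horner0.
  by apply: contraNneq gy => q0; rewrite -X1 -hq q0 horner0.
by exists (fun u => (X u).[c]); rewrite -hp -hq -hornerM.
Qed.

Definition face_val (x : nat -> K) (q : quad) :=
  x (qv q 0) * x (qv q 2) + x (qv q 1) * x (qv q 3).

Lemma polyfun_face (V : pred nat) q : (forall u, u \in qverts q -> V u) -> polyfun V (face_val^~ q).
Proof.
move=> qV; have H j : (j < 4)%N -> V (qv q j).
  by move=> j4; apply: qV; case: j j4 => [|[|[|[|]]]] //= _; rewrite !inE eqxx ?orbT.
by apply: polyfun_add; apply: polyfun_mul; apply: polyfun_var; apply: H.
Qed.

Lemma nzpoly_face (V : pred nat) q : (forall u, u \in qverts q -> V u) -> nzpoly V (face_val^~ q).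
Proof.
move=> qV; split; first exact: polyfun_face.
by exists (fun=> 1); rewrite /face_val mulr1 -(natrD _ 1 1) pnatr_eq0.
Qed.

Lemma nzpoly_var (V : pred nat) u : V u -> nzpoly V (fun x => x u).
Proof. by move=> Vu; split; [exact: polyfun_var|exists (fun=> 1); rewrite oner_neq0]. Qed.

Lemma nzpoly_prod (I : eqType) (V : pred nat) (s : seq I) (f : I -> (nat -> K) -> K) :
  (forall i, i \in s -> nzpoly V (f i)) -> nzpoly V (fun x => \prod_(i <- s) f i x).
Proof.
elim: s => [_|i s IH H].
  have -> : (fun x => \prod_(i <- [::]) f i x) = fun=> 1 by apply/funext => x; rewrite big_nil.
  by split; [exact: polyfun_cst|exists (fun=> 0); rewrite oner_neq0].
have -> : (fun x => \prod_(j <- i :: s) f j x) = fun x => f i x * \prod_(j <- s) f j x.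
  by apply/funext => x; rewrite big_cons.
by apply: nzpoly_mul; [apply: H; rewrite inE eqxx|apply: IH => j js; apply: H; rewrite inE js orbT].
Qed.

Lemma face_val_same x q q' : same_face q q' -> face_val x q = face_val x q'.
Proof.
rewrite same_faceE; case: q => [[[a b] c] d]; rewrite !inE /face_val /qv.
by move=> /orP[|/orP[|/orP[|/orP[|/orP[|/orP[|/orP[|]]]]]]] /eqP-> /=; ring.
Qed.

Definition upd (x : nat -> K) v c := fun u => if u == v then c else x u.

End PolyFun.

Section Step.
Variable R : realType.
Local Notation C := R[i].
Variables (f : flip) (V : pred nat).
Hypothesis un : uniq (flip_verts f).
Hypothesis hexV : forall u, u \in [:: fw f; fa1 f; fa2 f; fa3 f; fa4 f; fa5 f; fa6 f] -> V u.
Local Notation w := (fw f).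
Local Notation v := (fv f).
Let V' := [pred u | V u && (u != w) || (u == v)].

Lemma xcube_upd (x : nat -> C) r i j k :
  xcube (upd x v r) f i j k = if [&& i, j & k] then r else x (cv f i j k).
Proof.
rewrite /xcube /upd; have := @cv_inj f (i, j, k) (true, true, true) un.
case: eqP => [/= -> /(_ erefl)[-> -> ->] //|ne _].
by case: i j k ne => [] [] [].
Qed.

Let A (x : nat -> C) := cubeA (xcube x f).
Let D (x : nat -> C) := face_val x (old_x f) * face_val x (old_y f) * face_val x (old_z f).

Let polyA : polyfun V A.
Proof.
have h u : u \in [:: fw f; fa1 f; fa2 f; fa3 f; fa4 f; fa5 f; fa6 f] -> polyfun V (fun x : nat -> C => x u).
  by move=> uf; apply/polyfun_var/hexV.
rewrite /A /cubeA /xcube /=.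
repeat first [apply: polyfun_add | apply: polyfun_mul | apply: polyfun_cst | by apply: h; rewrite !inE eqxx ?orbT].
Qed.

Let polyD : polyfun V D.
Proof.
have old q : q \in old_quads f -> polyfun V (fun x : nat -> C => face_val x q).
  move=> qo; apply: polyfun_face => u uq; apply: hexV; apply: (old_quads_verts _ uq).
  by apply/hasP; exists q => //; exact: same_face_refl.
by apply: polyfun_mul; [apply: polyfun_mul|]; apply: old; rewrite !inE eqxx ?orbT.
Qed.

Let root x s := (A x + 2 * s) / x w ^+ 2.

(** Modulo $s^2=D$ a polynomial in the root of the Kashaev equation becomes linear in [s], once a
    power of the bottom value clears the denominators. *)
Let reduce G : polyfun V' G -> exists k alpha beta, [/\ polyfun V alpha, polyfun V beta &
  forall x s, x w != 0 -> s ^+ 2 = D x ->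
    x w ^+ k * G (upd x v (root x s)) = alpha x + beta x * s].
Proof.
have pw : polyfun V (fun x : nat -> C => x w) by apply/polyfun_var/hexV; rewrite inE eqxx.
have pX (g : (nat -> C) -> C) k : polyfun V g -> polyfun V (fun x => g x * x w ^+ k).
  move=> pg; elim: k => [|k IH].
    by have -> : (fun x => g x * x w ^+ 0) = g by apply/funext => x; rewrite expr0 mulr1.
  have -> : (fun x => g x * x w ^+ k.+1) = (fun x => (g x * x w ^+ k) * x w).
    by apply/funext => x; rewrite exprSr mulrA.
  exact: polyfun_mul.
elim=> {G} [c|u Vu|g1 g2 _ [k1 [a1 [b1 [pa1 pb1 E1]]]] _ [k2 [a2 [b2 [pa2 pb2 E2]]]]
          |g1 g2 _ [k1 [a1 [b1 [pa1 pb1 E1]]]] _ [k2 [a2 [b2 [pa2 pb2 E2]]]]].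
- exists 0%N, (fun=> c), (fun=> 0); split; try exact: polyfun_cst.
  by move=> x s _ _; rewrite mul1r mul0r addr0.
- have [->|uv] := eqVneq u v.
    exists 2%N, A, (fun=> 2); split=> //; first exact: polyfun_cst.
    by move=> x s w0 _; rewrite /upd eqxx /root mulrC divfK // expf_neq0.
  exists 0%N, (fun x => x u), (fun=> 0); split; [|exact: polyfun_cst|].
    by apply: polyfun_var; move: Vu; rewrite /= (negPf uv) orbF => /andP[].
  by move=> x s _ _; rewrite /upd (negPf uv) mul1r mul0r addr0.
- exists (k1 + k2)%N, (fun x => a1 x * x w ^+ k2 + a2 x * x w ^+ k1),
    (fun x => b1 x * x w ^+ k2 + b2 x * x w ^+ k1); split.
  + by apply: polyfun_add; apply: pX.
  + by apply: polyfun_add; apply: pX.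
  + move=> x s w0 sD; rewrite exprD mulrDr.
    rewrite [_ * g1 _](_ : _ = x w ^+ k2 * (x w ^+ k1 * g1 (upd x v (root x s)))); last by ring.
    rewrite [_ * g2 _](_ : _ = x w ^+ k1 * (x w ^+ k2 * g2 (upd x v (root x s)))); last by ring.
    by rewrite E1 // E2 //; ring.
- exists (k1 + k2)%N, (fun x => a1 x * a2 x + b1 x * b2 x * D x), (fun x => a1 x * b2 x + b1 x * a2 x); split.
  + by apply: polyfun_add; [exact: polyfun_mul|apply: polyfun_mul => //; exact: polyfun_mul].
  + by apply: polyfun_add; apply: polyfun_mul.
  + move=> x s w0 sD; rewrite exprD.
    rewrite [LHS](_ : _ = (x w ^+ k1 * g1 (upd x v (root x s))) * (x w ^+ k2 * g2 (upd x v (root x s)))); last by ring.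
    by rewrite E1 // E2 // -sD; ring.
Qed.

(** In the bottom value [c], the coefficient of $c^2$ is $r^2$. If it vanishes, the coefficient of
    $c$ is $-4s$, with [s] a product of nonzero hexagon values. *)
Let kashaev_bottom (x : nat -> C) r : (forall a, a \in [:: fa1 f; fa2 f; fa3 f; fa4 f; fa5 f; fa6 f] -> x a != 0) ->
  exists2 p : {poly C}, p != 0 & forall c, p.[c] = KC (xcube (upd (upd x w c) v r) f).
Proof.
move=> xa0.
pose b := x (fa1 f) * x (fa4 f); pose c' := x (fa3 f) * x (fa6 f); pose d := x (fa5 f) * x (fa2 f).
pose s := x (fa4 f) * x (fa6 f) * x (fa2 f); pose t := r * x (fa1 f) * x (fa3 f) * x (fa5 f).
pose p2 := r ^+ 2; pose p1 := - (2 * r * (b + c' + d)) - 4 * s.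
pose p0 := 2 * (b ^+ 2 + c' ^+ 2 + d ^+ 2) - (b + c' + d) ^+ 2 - 4 * t.
exists (p2 *: 'X^2 + p1 *: 'X + p0%:P).
  have s0 : s != 0 by rewrite !mulf_neq0 // xa0 // !inE eqxx ?orbT.
  set p := (X in X != 0); apply/eqP => p0'.
  have P1 : p`_1 = 0 by rewrite p0' coef0.
  have P2 : p`_2 = 0 by rewrite p0' coef0.
  move: P1 P2; rewrite /p !coefD !coefZ !coefXn !coefX !coefC /= !mulr0 !mulr1 ?addr0 ?add0r => P1 /eqP.
  rewrite expf_eq0 /= => /eqP r0; move: P1; rewrite /p1 r0 mulr0 mul0r oppr0 add0r => /eqP.
  by rewrite oppr_eq0 mulf_eq0 pnatr_eq0 (negPf s0).
move=> c; rewrite /KC !xcube_upd /= /upd.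
have ne a : a \in [:: fa1 f; fa2 f; fa3 f; fa4 f; fa5 f; fa6 f] -> (a == w) = false.
  move=> af; apply/negP => /eqP aw; move: un; rewrite /flip_verts -aw => /andP[+ _].
  by rewrite inE negb_or af andbF.
rewrite eqxx !ne; try by rewrite !inE eqxx ?orbT.
by rewrite !hornerE /= /p2 /p1 /p0 /b /c' /d /s /t; ring.
Qed.

(* G' is, up to powers of the bottom vertex value, the norm of G over the quadratic
   Kashaev equation for the top vertex. It does not vanish identically, since only
   finitely many top values are bad and each of them solves the Kashaev equation
   for finitely many bottom values only. *)
Lemma nzpoly_step G : nzpoly V' G -> exists2 G', nzpoly V G' &
  forall x, G' x != 0 -> x w != 0 /\ forall s, s ^+ 2 = D x -> G (upd x v ((A x + 2 * s) / x w ^+ 2)) != 0.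
Proof.
move=> nG; have [pG _] := nG.
have [k [al [be [pal pbe E]]]] := reduce pG.
(* The norm is $\alpha^2-\beta^2D$; the extra factor keeps the bottom value away from zero. *)
exists (fun x => x w * (al x * al x + (-1) * (be x * be x * D x))); last first.
  move=> x; rewrite mulf_eq0 negb_or => /andP[w0 n0]; split=> // s sD.
  apply: contraNneq n0 => G0; have := E x s w0 sD; rewrite /root G0 mulr0 => /esym/eqP.
  by rewrite addr_eq0 => /eqP ->; rewrite -sD; apply/eqP; ring.
split.
  apply: polyfun_mul; first by apply/polyfun_var/hexV; rewrite inE eqxx.
  apply: polyfun_add; first exact: polyfun_mul.
  by apply: polyfun_mul; [exact: polyfun_cst|apply: polyfun_mul => //; exact: polyfun_mul].
pose hex := [:: fa1 f; fa2 f; fa3 f; fa4 f; fa5 f; fa6 f].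
have hex_w a : a \in hex -> a != w.
  move=> af; apply: contraTneq un => aw; rewrite /flip_verts cons_uniq inE -/hex -[fw f]aw af orbT.
  by [].
(* The hexagon values must not vanish if [kashaev_bottom] is to apply at [z]. *)
have [_ [z]] : nzpoly V' (fun x => G x * \prod_(a <- hex) x a).
  apply: nzpoly_mul => //; apply: nzpoly_prod => a ah; apply: nzpoly_var.
  by rewrite /= hex_w // hexV // inE ah orbT.
rewrite mulf_eq0 negb_or prodf_seq_neq0 => /andP[Gz /allP za].
have za0 a : a \in hex -> z a != 0 by move=> ah; have := za a ah.
have [P hP] := polyfun_poly (fun u => if u == v then 'X else (z u)%:P) pG.
have {}hP c : P.[c] = G (upd z v c).
  by rewrite hP; congr G; apply/funext => u; rewrite /upd; case: eqP; rewrite ?hornerX ?hornerC.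
have P0 : P != 0.
  apply: contraNneq Gz => P0; have := hP (z v); rewrite P0 horner0 => ->; apply/eqP; congr G.
  by apply/funext => u; rewrite /upd; case: eqP => [->|].
have [rs rsP] := closed_field_poly_normal P.
have /choice[Kp KpP] : forall r, exists p : {poly C}, p != 0 /\ forall c, p.[c] = KC (xcube (upd (upd z w c) v r) f).
  by move=> r; have [p p0 hp] := kashaev_bottom r za0; exists p.
(* The bottom value [c] is nonzero and avoids the Kashaev equation for each of the finitely many bad
   top values [rs]. *)
have [c] : exists c, ('X * \prod_(r <- rs) Kp r).[c] != 0.
  apply: poly_nonroot; rewrite mulf_eq0 polyX_eq0 /= prodf_seq_neq0.
  by apply/allP => r _; case: (KpP r).
rewrite hornerM hornerX horner_prod mulf_eq0 negb_or prodf_seq_neq0 => /andP[c0 /allP Kc].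
pose x := upd z w c.
have xw : x w = c by rewrite /x /upd eqxx.
pose X := sqrtC (face_val x (old_x f)); pose Y := sqrtC (face_val x (old_y f)).
pose Z := sqrtC (face_val x (old_z f)); pose s := X * Y * Z.
have sD : s ^+ 2 = D x by rewrite /s !exprMn !sqrtCK.
have Groot (u : C) : u = 1 \/ u = -1 -> G (upd x v (root x (u * s))) != 0.
  move=> u1; set r := root x (u * s).
  have KC0 : KC (xcube (upd x v r) f) = 0.
    apply: (@twist_KC R _ X Y Z u); rewrite ?xcube_upd //=.
    - by rewrite -/w xw.
    - by rewrite sqrtCK.
    - by rewrite sqrtCK /face_val /qv /=; ring.
    - by rewrite sqrtCK /face_val /qv /=; ring.
    - rewrite /r /root /A /cubeA !xcube_upd /= /xcube /= /s; congr (_ / _); ring.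
  have rrs : r \notin rs.
    by apply/negP => /Kc; case: (KpP r) => _ ->; rewrite -/x KC0 eqxx.
  have Pr : P.[r] != 0.
    rewrite rsP hornerZ horner_prod mulf_neq0 ?lead_coef_eq0 //.
    rewrite prodf_seq_neq0; apply/allP => r' r'rs; rewrite hornerXsubC subr_eq0.
    by apply: contraNneq rrs => ->.
  (* [G] does not involve the bottom vertex, so replacing its value by [c] leaves [G] unchanged. *)
  move: Pr; rewrite hP; congr (is_true (_ != _)); apply: (polyfun_local pG) => a.
  rewrite /= /x /upd; case: (a == v) => //; rewrite orbF => /andP[_ /negPf ->] //.
exists x; rewrite xw mulf_neq0 //.
have E1 := E x s; have E2 := E x (- s); rewrite xw sqrrN in E1 E2.
have n1 : al x + be x * s != 0.
  by rewrite -E1 // mulf_neq0 ?expf_neq0 //; have := Groot 1; rewrite mul1r; apply; left.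
have n2 : al x - be x * s != 0.
  by rewrite -mulrN -E2 // mulf_neq0 ?expf_neq0 //; have := Groot (-1); rewrite mulN1r; apply; right.
rewrite -sD (_ : _ + _ = (al x + be x * s) * (al x - be x * s)); last by ring.
exact: mulf_neq0.
Qed.
End Step.

Lemma nzpoly_sub (K : numClosedFieldType) (V V' : pred nat) (f : (nat -> K) -> K) :
  (forall u, V u -> V' u) -> nzpoly V f -> nzpoly V' f.
Proof.
move=> sub [pf nf]; split=> //; elim: pf => {f nf} [c|u /sub|f g _ ? _ ?|f g _ ? _ ?].
- exact: polyfun_cst.
- exact: polyfun_var.
- exact: polyfun_add.
- exact: polyfun_mul.
Qed.

Lemma face_val_upd (K : numClosedFieldType) (x : nat -> K) v c q :
  v \notin qverts q -> face_val (upd x v c) q = face_val x q.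
Proof.
rewrite /face_val /upd !inE !negb_or !(eq_sym v).
by move=> /and4P[/negPf-> /negPf-> /negPf-> /negPf->].
Qed.

(** * Twisted solutions along the pile *)

Section Solution.
Variables (R : realType) (Ts : seq (seq quad)) (fl : seq flip).
Local Notation C := R[i].
Local Notation T := (nth [::] Ts).
Local Notation F := (nth flip0 fl).
Local Notation n := (size fl).
Hypothesis T0_uniq : forall q, q \in T 0 -> uniq (qverts q).
Hypothesis flT : forall i, (i < n)%N -> is_flip (T i) (T i.+1) (F i).
Hypothesis fresh : forall i, (i < n)%N -> forall j, (j <= i)%N -> fv (F i) \notin verts (T j).

Variable u : nat -> C.
Hypothesis u1 : forall i, (i < n)%N -> u i = 1 \/ u i = -1.

(* For e = 1 these are the K-hexahedron equations of the cube. *)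
Definition twisted (e : C) (f : flip) (x : nat -> C) (y : quad -> C) : Prop :=
  let z := xcube x f in let X := y (old_x f) in let Y := y (old_y f) in let Z := y (old_z f) in
  [/\ y (new_x f) = twist_x z X Y Z e, y (new_y f) = twist_y z X Y Z e,
      y (new_z f) = twist_z z X Y Z e &
      x (fv f) = (cubeA z + 2 * e * X * Y * Z) / x (fw f) ^+ 2].

(** Face values are kept nonzero so that two extensions of the same vertex values differ by
    well-defined signs. *)
Definition twisted_solution k (x : nat -> C) (y : quad -> C) : Prop :=
  [/\ forall q q', same_face q q' -> y q = y q',
      forall a, a \in prefix_verts Ts fl k -> x a != 0,
      forall q, q \in prefix_faces Ts fl k -> y q ^+ 2 = face_val x q /\ y q != 0 &
      forall i, (i < k)%N -> twisted (u i) (F i) x y].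

Lemma flip_verts_prefix i : (i < n)%N -> {subset flip_verts (F i) <= prefix_verts Ts fl i.+1}.
Proof.
move=> i_n a; rewrite inE => /predU1P[->|].
  apply: (prefix_verts_sub (leqnSn i)); apply: (verts_prefix flT (ltnW i_n)).
  by apply: (verts_hexagon (flT i_n)); rewrite inE eqxx.
rewrite inE => /predU1P[->|H].
  apply: (verts_prefix flT i_n); by rewrite (verts_flip (flT i_n)) eqxx orbT.
apply: (prefix_verts_sub (leqnSn i)); apply: (verts_prefix flT (ltnW i_n)).
by apply: (verts_hexagon (flT i_n)); rewrite inE H orbT.
Qed.

Lemma old_quads_prefix i q : (i < n)%N -> q \in old_quads (F i) -> exists2 q', q' \in prefix_faces Ts fl i & same_face q q'.
Proof.
move=> i_n qo.
have qo' : has (same_face q) (old_quads (F i)) by apply/hasP; exists q => //; exact: same_face_refl.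
have /hasP[q' ? ?] := mem_face_prefix flT (ltnW i_n) (old_quads_mem (flT i_n) qo').
by exists q'.
Qed.

Lemma twisted_upd i k c x y y' : (i < k)%N -> (k < n)%N ->
  (forall q, fv (F k) \notin qverts q -> y' q = y q) ->
  twisted (u i) (F i) x y -> twisted (u i) (F i) (upd x (fv (F k)) c) y'.
Proof.
move=> ik kn yE; have i_n := ltn_trans ik kn.
have vN a : a \in flip_verts (F i) -> (a == fv (F k)) = false.
  move=> /(flip_verts_prefix i_n) /(prefix_verts_sub ik) ap.
  by apply: contraNF (fresh_prefix flT fresh kn) => /eqP <-.
have xE : xcube (upd x (fv (F k)) c) (F i) = xcube x (F i).
  apply/funext => a; apply/funext => b; apply/funext => d; rewrite /xcube /upd vN //.
  by case: a b d => [] [] []; rewrite !inE eqxx ?orbT.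
have qN q : q \in old_quads (F i) ++ new_quads (F i) -> y' q = y q.
  move=> qf; apply: yE; apply/negP => vq.
  have [un _] := flT i_n; have [e ve] := mem_cube_face qf vq.
  suff : fv (F k) \in flip_verts (F i) by move=> /vN; rewrite eqxx.
  by rewrite ve; case: e {ve} => [[[] []] []]; rewrite !inE eqxx ?orbT.
rewrite /twisted xE !qN; try by rewrite !inE eqxx ?orbT.
by rewrite /upd !vN // !inE eqxx ?orbT.
Qed.

(** The arbitrary condition [G] strengthens the induction: the nonvanishing required after a flip is
    translated by [nzpoly_step] into a condition on the vertices before it. *)
Lemma twisted_exists k G : (k <= n)%N -> nzpoly [pred a | a \in verts (T k)] G ->
  exists x y, twisted_solution k x y /\ G x != 0.
Proof.
elim: k G => [|k IH] G kn nG.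
  have [_ [x]] : nzpoly [pred a | a \in verts (T 0)]
      (fun x => G x * ((\prod_(a <- verts (T 0)) x a) * \prod_(q <- T 0) face_val x q)).
    apply: nzpoly_mul => //; apply: nzpoly_mul; apply: nzpoly_prod.
      by move=> a a0; exact: nzpoly_var.
    by move=> q q0; apply: nzpoly_face => a aq; apply/mem_vertsP; exists q.
  rewrite !mulf_eq0 !negb_or !prodf_seq_neq0 => /and3P[Gx /allP xa /allP xq].
  exists x, (fun q => sqrtC (face_val x q)); split=> //; split=> //.
  - by move=> q q' s; rewrite (face_val_same x s).
  - by move=> a; rewrite /prefix_verts take0 cats0; exact: xa.
  - move=> q; rewrite /prefix_faces take0 cats0 => q0; split; first exact: sqrtCK.
    by rewrite sqrtC_eq0; exact: (xq q q0).
set f := F k; have fk := flT kn; have [un _] := fk.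
pose V := [pred a | a \in verts (T k)]; pose V' := [pred a | V a && (a != fw f) || (a == fv f)].
have VE a : V' a = (a \in verts (T k.+1)) by rewrite (verts_flip fk).
have hexV a : a \in [:: fw f; fa1 f; fa2 f; fa3 f; fa4 f; fa5 f; fa6 f] -> V a.
  exact: (verts_hexagon fk).
have topV : ~~ V (fv f) by apply: fresh.
have newV q a : q \in new_quads f -> a \in qverts q -> V' a.
  move=> qn aq; rewrite VE; apply/mem_verts_face; exists q => //.
  by apply: (new_face_now flT kn); apply/hasP; exists q => //; exact: same_face_refl.
(* Besides [G], the values at the new vertex and at the three new faces must not vanish. *)
have nG2 : nzpoly V' (fun x => G x * (x (fv f) * \prod_(q <- new_quads f) face_val x q)).
  apply: nzpoly_mul; first by apply: (nzpoly_sub _ nG) => a; rewrite VE.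
  apply: nzpoly_mul; first by apply: nzpoly_var; rewrite /= eqxx orbT.
  by apply: nzpoly_prod => q qn; apply: nzpoly_face => a; exact: newV.
have [G' nG' stepG] := nzpoly_step un hexV nG2.
have [x [y [[yS x0 yq tw] G'x]]] := IH G' (ltnW kn) nG'.
have [w0 stepx] := stepG x G'x.
have uk := u1 kn.
set X := y (old_x f); set Y := y (old_y f); set Z := y (old_z f).
have oldE q : q \in old_quads f -> y q ^+ 2 = face_val x q.
  move=> qo; have [q' q'p s] := old_quads_prefix kn qo.
  by rewrite (yS _ _ s) (face_val_same x s); case: (yq q' q'p).
have XE : X ^+ 2 = face_val x (old_x f) by apply: oldE; rewrite !inE eqxx.
have YE : Y ^+ 2 = face_val x (old_y f) by apply: oldE; rewrite !inE eqxx ?orbT.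
have ZE : Z ^+ 2 = face_val x (old_z f) by apply: oldE; rewrite !inE eqxx ?orbT.
have sD : (u k * X * Y * Z) ^+ 2 = face_val x (old_x f) * face_val x (old_y f) * face_val x (old_z f).
  by rewrite -XE -YE -ZE; case: uk => ->; ring.
move: (stepx _ sD); set t := _ / _; set x' := upd x (fv f) t.
rewrite !mulf_eq0 !negb_or prodf_seq_neq0 => /and3P[Gx' x'v /allP new0].
pose z := xcube x' f.
have zE i j l : z i j l = if [&& i, j & l] then t else x (cv f i j l) by exact: xcube_upd.
have cAE : cubeA z = cubeA (xcube x f) by rewrite /cubeA !zE.
have z0 : z false false false != 0 by rewrite zE.
have tE : z true true true = (cubeA z + 2 * u k * X * Y * Z) / z false false false ^+ 2.
  by rewrite cAE !zE /= /t !mulrA.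
have zX : X ^+ 2 = z false false false * z false true true + z false true false * z false false true.
  by rewrite XE !zE /= /face_val /qv /=; ring.
have zY : Y ^+ 2 = z false false false * z true false true + z false false true * z true false false.
  by rewrite YE !zE /= /face_val /qv /=; ring.
have zZ : Z ^+ 2 = z false false false * z true true false + z true false false * z false true false.
  by rewrite ZE !zE /= /face_val /qv /=; ring.
have nX := twist_x_sqr z0 uk zX zY zZ tE.
have nY := twist_y_sqr z0 uk zX zY zZ tE.
have nZ := twist_z_sqr z0 uk zX zY zZ tE.
pose y' q := if same_face q (new_x f) then twist_x z X Y Z (u k) else
  if same_face q (new_y f) then twist_y z X Y Z (u k) else
  if same_face q (new_z f) then twist_z z X Y Z (u k) else y q.
have y'E q : fv f \notin qverts q -> y' q = y q.
  move=> vq; have N q' : q' \in new_quads f -> same_face q q' = false.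
    move=> qn; apply: contraNF vq => s; apply: new_quads_top.
    by apply/hasP; exists q'.
  by rewrite /y' !N // !inE eqxx ?orbT.
have := uniq_face_rep_new un; rewrite /= !inE !face_repE negb_or andbT => /andP[/andP[nxy nxz] nyz].
have y'x : y' (new_x f) = twist_x z X Y Z (u k) by rewrite /y' same_face_refl.
have y'y : y' (new_y f) = twist_y z X Y Z (u k).
  by rewrite /y' same_face_refl same_face_sym (negPf nxy).
have y'z : y' (new_z f) = twist_z z X Y Z (u k).
  by rewrite /y' same_face_refl !(same_face_sym (new_z f)) (negPf nxz) (negPf nyz).
have oldv q : q \in old_quads f -> y' q = y q.
  move=> qo; apply: y'E; apply: contraNN topV => vq; apply: hexV; apply: (old_quads_verts _ vq).
  by apply/hasP; exists q => //; exact: same_face_refl.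
exists x', y'; split=> //; split.
- move=> q q' s; have sE q1 : same_face q q1 = same_face q' q1.
    by apply/idP/idP; [|exact: same_face_trans]; apply: same_face_trans; rewrite same_face_sym.
  by rewrite /y' !sE (yS _ _ s).
- move=> a; rewrite prefix_vertsS // mem_rcons inE => /predU1P[->//|ap].
  rewrite /x' /upd; case: ifP => [/eqP av|_]; last exact: (x0 a ap).
  by have := fresh_prefix flT fresh kn; rewrite -/f -av ap.
- move=> q; rewrite prefix_facesS // mem_cat => /orP[qp|qn].
    have vq : fv f \notin qverts q.
      by apply: contraNN (fresh_prefix flT fresh kn) => /(prefix_face_verts flT (ltnW kn) qp).
    by rewrite y'E // /x' face_val_upd //; exact: yq.
  suff sq : y' q ^+ 2 = face_val x' q.
    by split=> //; have := new0 q qn; rewrite /= -sq expf_eq0.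
  move: qn; rewrite !inE => /or3P[] /eqP->.
  + by rewrite y'x nX /face_val /qv /= /z /xcube /=; ring.
  + by rewrite y'y nY /face_val /qv /= /z /xcube /=; ring.
  + by rewrite y'z nZ /face_val /qv /= /z /xcube /=; ring.
- move=> i; rewrite ltnS leq_eqVlt => /predU1P[->|ik]; last first.
    exact: (twisted_upd t ik kn y'E (tw i ik)).
  rewrite /twisted -/f (oldv (old_x f)) ?(oldv (old_y f)) ?(oldv (old_z f)) ?inE ?eqxx ?orbT //.
Qed.

End Solution.

(** * The theorem *)

Section Final.
Variable R : realType.

Lemma quadrilateral_uniq (pos : nat -> R * R) q :
  is_quadrilateral (pos (qv q 0)) (pos (qv q 1)) (pos (qv q 2)) (pos (qv q 3)) -> uniq (qverts q).
Proof.
case: q => [[[a b] c] d]; rewrite /is_quadrilateral /qverts /qv /= /collinear /det3.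
move=> /and5P[h1 h2 h3 h4 _]; rewrite !inE !negb_or !andbT.
have e (x y : nat) (P : R) : P != 0 -> (x = y -> P = 0) -> x != y.
  by move=> P0 H; apply: contraNneq P0 => /H ->.
apply/and3P; split; [apply/and3P; split|apply/andP; split|].
- by apply: e h1 _ => ->; ring.
- by apply: e h1 _ => ->; ring.
- by apply: e h3 _ => ->; ring.
- by apply: e h1 _ => ->; ring.
- by apply: e h2 _ => ->; ring.
- by apply: e h2 _ => ->; ring.
Qed.

Variables (Ts : seq (seq quad)) (fl : seq flip).
Local Notation C := R[i].
Local Notation T := (nth [::] Ts).
Local Notation F := (nth flip0 fl).
Local Notation n := (size fl).
Hypothesis T0_uniq : forall q, q \in T 0 -> uniq (qverts q).
Hypothesis flT : forall i, (i < n)%N -> is_flip (T i) (T i.+1) (F i).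
Hypothesis fresh : forall i, (i < n)%N -> forall j, (j <= i)%N -> fv (F i) \notin verts (T j).

Let flip_un i : (i < n)%N -> uniq (flip_verts (F i)).
Proof. by move=> /flT[]. Qed.

(** All later arguments use the topological definition of interior vertices through this
    consequence. *)
Lemma interior_vertexP v : interior_vertex (T 0) fl R v ->
  [/\ v \in kverts (T 0) fl, v \notin verts (T 0) & v \notin verts (T n)].
Proof.
move=> iv; have vk : v \in kverts (T 0) fl by case: iv.
suff : ~ (v \in verts (T 0) \/ v \in verts (T n)).
  by move=> H; split=> //; apply/negP => vT; apply: H; [left|right].
move=> /(boundary_face flT fresh vk)[q [qk vq one]].
apply: (not_interior _ _ _ _ qk vq one) iv => [q' q'k|q' q'k a aq|//|i i_n a].
- exact: kface_uniq q'k.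
- by rewrite -prefix_verts_n; apply: (prefix_face_verts flT (leqnn n)) aq; rewrite prefix_faces_n.
- exact: flip_vert_kvert.
Qed.

Lemma prod_flips (A : comPzRingType) (G : flip -> A) : \prod_(f <- fl) G f = \prod_(i < n) G (F i).
Proof. by rewrite (big_nth flip0) big_mkord. Qed.

Lemma prod_faces_at (A : comPzRingType) (phi : quad -> A) v :
  (forall q q', same_face q q' -> phi q = phi q') -> interior_vertex (T 0) fl R v ->
  \prod_(i < n) \prod_(e : bool * bool * bool | cv (F i) e.1.1 e.1.2 e.2 == v)
    (phi (facex (F i) e.1.1) * phi (facey (F i) e.1.2) * phi (facez (F i) e.2)) =
  \prod_(q <- kfaces (T 0) fl | v \in qverts q) phi q ^+ 2.
Proof.
move=> phiE /interior_vertexP[vk v0 vn].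
rewrite -(interior_prod_faces flT fresh v0 vn phiE) prod_flips.
by apply: eq_bigr => i _; rewrite prod_corner_faces // flip_un.
Qed.

Lemma prod_corner_cst (A : comPzRingType) f v (a : A) : uniq (flip_verts f) ->
  \prod_(e : bool * bool * bool | cv f e.1.1 e.1.2 e.2 == v) a = if in_cube f v then a else 1.
Proof.
move=> un; rewrite prod_corner // /in_cube; case: pickP => [e ev|no].
  by case: existsP => // -[]; exists e.
by case: existsP => // -[e]; rewrite no.
Qed.

(** As [t] agrees on opposite faces, [psi t] of a cube is the product of [t] over the three faces at
    any chosen corner. Around [v] every face then contributes the square of a sign. *)
Lemma comfortable_if (t : quad -> int) v : class_sign fl t -> interior_vertex (T 0) fl R v ->
  \prod_(i < n | in_cube (F i) v) psi t (F i) = 1.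
Proof.
move=> [ts [tS tC]] iv; rewrite big_mkcond /=.
transitivity (\prod_(q <- kfaces (T 0) fl | v \in qverts q) t q ^+ 2); last first.
  by apply: big1 => q _; case/orP: (ts q) => /eqP ->.
rewrite -(prod_faces_at tS iv); apply: eq_bigr => i _.
rewrite -prod_corner_cst ?flip_un //; apply: eq_bigr => e _.
have [ex ey ez] := tC i (ltn_ord i); rewrite /psi /facex /facey /facez.
by case: e.1.1; case: e.1.2; case: e.2; rewrite -?ex -?ey -?ez.
Qed.

Lemma prod_corner_sign v : interior_vertex (T 0) fl R v ->
  \prod_(i < n) \prod_(e : bool * bool * bool | cv (F i) e.1.1 e.1.2 e.2 == v)
    (if e \in [:: (false, false, false); (true, true, true)] then 1 else -1) = 1 :> C.
Proof.
move=> iv; have [vk v0 vn] := interior_vertexP iv.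
(* Each cube at [v] contributes $(-1)^3$, so this is the parity of the number of cubes at [v]; [c2]
   is the parity of those with [v] at the bottom or at the top. *)
have c1 := @prod_faces_at C (fun=> -1) v (fun _ _ _ => erefl) iv.
have c2 := prod_sign_verts flT fresh v C.
rewrite (negPf v0) (negPf vn) expr0 mul1r prod_flips in c2.
rewrite [RHS](_ : 1 = \prod_(q <- kfaces (T 0) fl | v \in qverts q) (-1 : C) ^+ 2); last first.
  by rewrite big1 // => q _; rewrite sqrrN expr1n.
rewrite -c1 -[RHS]mulr1 -[X in _ = _ * X]c2 -big_split; apply: eq_bigr => i _ /=.
have un := flip_un (ltn_ord i); set f := F i in un *.
rewrite !prod_corner //; case: pickP => [e /eqP <-|no].
  have E e' : (cv f e.1.1 e.1.2 e.2 == cv f e'.1.1 e'.1.2 e'.2) = (e == e').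
    by apply/eqP/eqP => [/(cv_inj un)|->].
  rewrite -[fw f]/(cv f (false, false, false).1.1 (false, false, false).1.2 (false, false, false).2).
  rewrite -[fv f]/(cv f (true, true, true).1.1 (true, true, true).1.2 (true, true, true).2).
  by rewrite !E; case: (e) => [[[] []] []] /=; ring.
rewrite mul1r; have := no (false, false, false); have := no (true, true, true).
by rewrite /= !(eq_sym v) => -> ->; rewrite mulr1.
Qed.

Lemma twisted_coherent (u : nat -> int) x y : (forall i, (i < n)%N -> is_sign (u i)) ->
  (forall v, interior_vertex (T 0) fl R v -> \prod_(i < n | in_cube (F i) v) u i = 1) ->
  twisted_solution Ts fl (fun i => (u i)%:~R : C) n x y -> coherent_solution (T 0) fl x.
Proof.
move=> us uint [yS x0 yq tw].
have u1 i : (i < n)%N -> (u i)%:~R = 1 :> C \/ (u i)%:~R = -1 :> C.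
  by move=> /us/orP[] /eqP ->; [left|right].
have old i q : (i < n)%N -> q \in old_quads (F i) -> y q ^+ 2 = face_val x q.
  move=> i_n qo; have [q' q'p s] := old_quads_prefix flT i_n qo.
  rewrite (yS _ _ s) (face_val_same x s).
  have q'n : q' \in prefix_faces Ts fl n.
    move: q'p; rewrite !mem_cat => /orP[->//|q'p]; apply/orP; right.
    case/(mem_flatten_take _ _ (ltnW i_n)): q'p => j ji q'j.
    by apply/(mem_flatten_take _ _ (leqnn n)); exists j => //; exact: ltn_trans ji i_n.
  by case: (yq q' q'n).
have cube i (i_n : (i < n)%N) : let z := xcube x (F i) in
    [/\ z false false false != 0, y (old_x (F i)) ^+ 2 = z false false false * z false true true + z false true false * z false false true,
     y (old_y (F i)) ^+ 2 = z false false false * z true false true + z false false true * z true false false &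
     y (old_z (F i)) ^+ 2 = z false false false * z true true false + z true false false * z false true false].
  split.
  - apply: x0; rewrite prefix_verts_n; apply: (flip_vert_kvert flT i_n).
    by rewrite inE eqxx.
  - by rewrite (old i) ?inE ?eqxx ?orbT // /face_val /xcube /qv /=; ring.
  - by rewrite (old i) ?inE ?eqxx ?orbT // /face_val /xcube /qv /=; ring.
  - by rewrite (old i) ?inE ?eqxx ?orbT // /face_val /xcube /qv /=; ring.
split=> [i i_n|v iv].
  have [z0 zX zY zZ] := cube i i_n; have [_ _ _ tE] := tw i i_n.
  exact: (twist_KC z0 (u1 i i_n) zX zY zZ tE).
(* The vertices of a face are distinct, so at most one of its corners is [v], and the factor there
   is the face value, a square. *)
transitivity (\prod_(q <- kfaces (T 0) fl | v \in qverts q) y q ^+ 2); last first.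
  rewrite big_mkcond big_seq [RHS]big_seq; apply: eq_bigr => q qk.
  have /yq[-> _] : q \in prefix_faces Ts fl n by rewrite prefix_faces_n.
  have := kface_uniq T0_uniq flT qk; case: q qk => [[[a b] c] d] _.
  rewrite /face_val /qverts /qv /= !inE !negb_or !andbT -!andbA.
  move=> /and5P[/negPf n1 /negPf n2 /negPf n3 /negPf n4 /andP[/negPf n5 /negPf n6]].
  rewrite big_mkcond !big_ord_recl big_ord0 /= !(eq_sym v).
  have [<-|_] := eqVneq a v; first by rewrite ?(eq_sym b a) ?(eq_sym c a) ?(eq_sym d a) n1 n2 n3 /=; ring.
  have [<-|_] := eqVneq b v; first by rewrite ?(eq_sym c b) ?(eq_sym d b) n4 n5 /=; ring.
  have [<-|_] := eqVneq c v; first by rewrite ?(eq_sym d c) n6 /=; ring.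
  have [<-|_] := eqVneq d v; by rewrite /=; ring.
have U : \prod_(i < n) \prod_(e : bool * bool * bool | cv (F i) e.1.1 e.1.2 e.2 == v) (u i)%:~R = 1 :> C.
  rewrite (eq_bigr (fun i : 'I_n => (if in_cube (F i) v then u i else 1)%:~R)); last first.
    by move=> i _; rewrite prod_corner_cst ?flip_un //; case: ifP.
  by rewrite -rmorph_prod -big_mkcond uint.
rewrite -(prod_faces_at yS iv) prod_flips.
(* Both inserted products equal 1; with them the two sides agree corner by corner through
   [twist_KCv]. *)
rewrite -[RHS]mul1r -[X in _ = X * _](prod_corner_sign iv) -[RHS]mul1r -[X in _ = X * _]U.
rewrite -!big_split; apply: eq_bigr => i _ /=.
rewrite -!big_split; apply: eq_bigr => e _ /=.
have [z0 zX zY zZ] := cube i (ltn_ord i); have [nX nY nZ tE] := tw i (ltn_ord i).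
rewrite (twist_KCv z0 (u1 i (ltn_ord i)) zX zY zZ tE e) /face_at -nX -nY -nZ.
rewrite /facex /facey /facez; case: e => [[[] []] []] /=; ring.
Qed.

Lemma twisted_not_extendable (u : nat -> int) x y : (forall i, (i < n)%N -> is_sign (u i)) ->
  twisted_solution Ts fl (fun i => (u i)%:~R : C) n x y -> K_hex_extendable (T 0) fl x ->
  exists t, class_sign fl t /\ forall i, (i < n)%N -> u i = psi t (F i).
Proof.
move=> us [yS x0 yq tw] [y' [y'S [_ [y'q hex]]]].
(* On faces of the complex both extensions are square roots of the same number, so [t] is their
   ratio. *)
pose t q : int := if y' q == y q then 1 else -1.
have ys q : q \in kfaces (T 0) fl -> y' q = (t q)%:~R * y q.
  move=> qk; rewrite /t; case: eqP => [->|ne]; first by rewrite mul1r.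
  have /yq[sq _] : q \in prefix_faces Ts fl n by rewrite prefix_faces_n.
  have : (y' q - y q) * (y' q + y q) = 0.
    by rewrite -subr_sqr y'q // sq /face_val subrr.
  move=> /eqP; rewrite mulf_eq0 subr_eq0 addr_eq0 => /orP[/eqP//|/eqP ->].
  by rewrite mulrN1z mulNr mul1r.
have tS q q' : same_face q q' -> t q = t q' by move=> s; rewrite /t (y'S _ _ s) (yS _ _ s).
have ysf i q : (i < n)%N -> q \in old_quads (F i) ++ new_quads (F i) ->
    y' q = (t q)%:~R * y q /\ y q != 0.
  move=> i_n; rewrite mem_cat => /orP[qo|qn].
    have [q' q'p s] := old_quads_prefix flT i_n qo.
    have q'n : q' \in prefix_faces Ts fl n.
      move: q'p; rewrite !mem_cat => /orP[->//|q'p]; apply/orP; right.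
      case/(mem_flatten_take _ _ (ltnW i_n)): q'p => j ji q'j.
      by apply/(mem_flatten_take _ _ (leqnn n)); exists j => //; exact: ltn_trans ji i_n.
    rewrite (y'S _ _ s) (yS _ _ s) (tS _ _ s) ys -?prefix_faces_n //.
    by split=> //; case: (yq q' q'n).
  have qn' : q \in prefix_faces Ts fl n.
    by rewrite mem_cat; apply/orP; right; apply/(mem_flatten_take _ _ (leqnn n)); exists i.
  by rewrite ys -?prefix_faces_n //; split=> //; case: (yq q qn').
have ts q : is_sign (t q) by rewrite /t /is_sign; case: ifP.
have tC q : (t q)%:~R = 1 :> C \/ (t q)%:~R = -1 :> C by rewrite /t; case: ifP; [left|right].
have sgnC (a b : int) : a%:~R = b%:~R :> C -> a = b.
  by move=> /eqP; rewrite eqr_int => /eqP.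
have key i : (i < n)%N -> [/\ u i = psi t (F i), t (old_x (F i)) = t (new_x (F i)),
    t (old_y (F i)) = t (new_y (F i)) & t (old_z (F i)) = t (new_z (F i))].
  move=> i_n; have := hex i i_n; cbv zeta; have := tw i i_n; rewrite /twisted.
  have w0 : xcube x (F i) false false false != 0.
    by apply: x0; rewrite prefix_verts_n; apply: (flip_vert_kvert flT i_n); rewrite inE eqxx.
  have [ox ox0] := ysf i (old_x (F i)) i_n (ltac:(by rewrite !inE eqxx ?orbT)).
  have [oy oy0] := ysf i (old_y (F i)) i_n (ltac:(by rewrite !inE eqxx ?orbT)).
  have [oz oz0] := ysf i (old_z (F i)) i_n (ltac:(by rewrite !inE eqxx ?orbT)).
  have [nx nx0] := ysf i (new_x (F i)) i_n (ltac:(by rewrite !inE eqxx ?orbT)).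
  have [ny ny0] := ysf i (new_y (F i)) i_n (ltac:(by rewrite !inE eqxx ?orbT)).
  have [nz nz0] := ysf i (new_z (F i)) i_n (ltac:(by rewrite !inE eqxx ?orbT)).
  rewrite ox oy oz nx ny nz /psi.
  set X := y (old_x (F i)) in ox0 *; set Y := y (old_y (F i)) in oy0 *; set Z := y (old_z (F i)) in oz0 *.
  case=> tx ty tz tt [hx hy hz ht].
  have two0 : (2 : C) != 0 by rewrite pnatr_eq0.
  have w20 : x (fw (F i)) ^+ 2 != 0 by rewrite expf_neq0.
  (* Both extensions yield the same top value and share the term [cubeA], so the triple products of
     face values agree. *)
  have uE : (u i)%:~R = (t (old_x (F i)))%:~R * (t (old_y (F i)))%:~R * (t (old_z (F i)))%:~R :> C.
    apply: (mulIf (_ : 2 * (X * Y * Z) != 0)); first by rewrite !mulf_neq0.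
    move: ht; rewrite /xcube /= tt => /(mulIf (invr_neq0 w20)); rewrite /cubeA => /addrI E.
    transitivity (2 * (u i)%:~R * X * Y * Z); first by ring.
    by rewrite E; ring.
  split.
  - by apply: sgnC; rewrite uE !rmorphM.
  (* Since $u=t_xt_yt_z$, changing the old face values by these signs multiplies the twisted value
     on [new_x] by $t_x$; likewise for the other two. *)
  - apply: sgnC => //; apply: (mulIf nx0); rewrite hx tx /twist_x uE.
    by case: (tC (old_x (F i))) => ->; case: (tC (old_y (F i))) => ->; case: (tC (old_z (F i))) => ->; field.
  - apply: sgnC => //; apply: (mulIf ny0); rewrite hy ty /twist_y uE.
    by case: (tC (old_x (F i))) => ->; case: (tC (old_y (F i))) => ->; case: (tC (old_z (F i))) => ->; field.
  - apply: sgnC => //; apply: (mulIf nz0); rewrite hz tz /twist_z uE.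
    by case: (tC (old_x (F i))) => ->; case: (tC (old_y (F i))) => ->; case: (tC (old_z (F i))) => ->; field.
exists t; split; last by move=> i /key[].
by split=> //; split=> // i /key[_ ? ? ?].
Qed.

End Final.

Theorem theorem8p11 (R : realType) (pos : nat -> R * R) (Rg : set (R * R))
    (Ts : seq (seq quad)) (fl : seq flip) :
  is_pile pos Rg Ts fl ->
  ~ comfortable (nth [::] Ts 0) fl R ->
  exists x : nat -> R[i],
    (forall u, u \in kverts (nth [::] Ts 0) fl -> x u != 0) /\
    coherent_solution (nth [::] Ts 0) fl x /\
    ~ K_hex_extendable (nth [::] Ts 0) fl x.
Proof.
move=> [sT [_ [quadT flipT]]] not_comf.
have T0_uniq q : q \in nth [::] Ts 0 -> uniq (qverts q).
  have [|_ [H _]] := quadT 0%N; first by rewrite sT.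
  by move=> /H; exact: quadrilateral_uniq.
have flT i : (i < size fl)%N -> is_flip (nth [::] Ts i) (nth [::] Ts i.+1) (nth flip0 fl i).
  by case/flipT.
have fresh i : (i < size fl)%N -> forall j, (j <= i)%N -> fv (nth flip0 fl i) \notin verts (nth [::] Ts j).
  by case/flipT.
have [u [us nu]] : exists u : nat -> int, (forall i, (i < size fl)%N -> is_sign (u i)) /\
    ~ ((exists t, class_sign fl t /\ forall i, (i < size fl)%N -> u i = psi t (nth flip0 fl i))
       <-> (forall v, interior_vertex (nth [::] Ts 0) fl R v ->
              \prod_(i < size fl | in_cube (nth flip0 fl i) v) u i = 1)).
  by apply: contrapT => H; apply: not_comf => u us; apply: contrapT => nu; apply: H; exists u.
(* By [comfortable_if] membership in the image always implies the vertex conditions, so the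
   equivalence can only fail for a [u] that meets the conditions and lies outside the image. *)
have not_im : ~ exists t, class_sign fl t /\ forall i, (i < size fl)%N -> u i = psi t (nth flip0 fl i).
  move=> im; apply: nu; split=> // _ v iv; case: im => t [tc ut].
  rewrite (eq_bigr (fun i : 'I_(size fl) => psi t (nth flip0 fl i))); last by move=> i _; exact: ut.
  exact: (comfortable_if T0_uniq flT fresh tc iv).
have u_int v : interior_vertex (nth [::] Ts 0) fl R v ->
    \prod_(i < size fl | in_cube (nth flip0 fl i) v) u i = 1.
  move: v; apply: contrapT => H; apply: nu; split=> //.
have u1 i : (i < size fl)%N -> (u i)%:~R = 1 :> R[i] \/ (u i)%:~R = -1 :> R[i].
  by move=> /us/orP[] /eqP ->; [left|right].
have [|x [y [sol _]]] := twisted_exists flT fresh u1 (leqnn _) (G := fun=> 1).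
  by split; [exact: polyfun_cst|exists (fun=> 0); rewrite oner_neq0].
exists x; split; first by case: sol => _ + _ _; rewrite prefix_verts_n.
split; first exact: (twisted_coherent T0_uniq flT fresh us u_int sol).
by move=> /(twisted_not_extendable flT us sol).
Qed.
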